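(* Let $p_t$ be the joint probability density of $(\mathbf u_I(t),\mathbf u_{II}(t))$, let $\hat p_t$ be the hybrid estimator built from $L$ independent trajectories with bandwidth $H>0$ and constants $c_1,\dots,c_{N_I}>0$, and let $\bar p_t=\mathbb E\,\hat p_t$ (all as defined in the context). Let $M(\mathbf u_I,\mathbf u_{II})$ be a function bounding the third order directional derivatives of $p_t$ in the $\mathbf u_I$ directions, i.e. $$\left|\frac{d^3}{ds^3}p_t(\mathbf u_I+s\mathbf v,\mathbf u_{II})\Big|_{s=0}\right|\le M(\mathbf u_I,\mathbf u_{II})\quad\text{for all }\mathbf v\in\mathbb R^{N_I},\ |\mathbf v|\le 1 ,$$ for all $(\mathbf u_I,\mathbf u_{II})$. Then the two parts of the mean integrated squared error $$\mathbb E\int|p_t-\hat p_t|^2\,d\mathbf u_I d\mathbf u_{II}=\mathrm{Variance}+\mathrm{Bias},$$ $$\mathrm{Variance}=\mathbb E\int|\hat p_t-\bar p_t|^2\,d\mathbf u_Id\mathbf u_{II},\qquad \mathrm{Bias}=\int|p_t-\bar p_t|^2\,d\mathbf u_Id\mathbf u_{II},$$ satisfy $$\mathrm{Variance}\le\frac1L\,\mathbb E\left(\prod_{i=1}^{N_I}(\pi Hc_i^2)\,\det(\pi\mathbf R_{II}(t))\right)^{-1/2},$$ and, for every fixed $\delta>0$, $$\mathrm{Bias}\le\frac{1+\delta}{4}H^2J\left(\sum_{i=1}^{N_I}c_i^2\,\partial^2_{\mathbf u_{I,i}}p_t\right)+\frac{1+\delta^{-1}}{2}H^3\left(\sum_{i=1}^{N_I}c_i^2\right)^3J(M),$$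 where $\partial^2_{\mathbf u_{I,i}}$ is the second partial derivative in the $i$-th component of $\mathbf u_I$ and $J(f)=\int f^2(\mathbf u_I,\mathbf u_{II})\,d\mathbf u_Id\mathbf u_{II}$.
   Context: Conditional Gaussian system: $\mathbf u=(\mathbf u_I,\mathbf u_{II})$ with $\mathbf u_I\in\mathbb R^{N_I}$, $\mathbf u_{II}\in\mathbb R^{N_{II}}$ solves $$d\mathbf u_I=[\mathbf A_0(t,\mathbf u_I)+\mathbf A_1(t,\mathbf u_I)\mathbf u_{II}]dt+\boldsymbol\Sigma_I(t,\mathbf u_I)d\mathbf W_I(t),$$ $$d\mathbf u_{II}=[\mathbf a_0(t,\mathbf u_I)+\mathbf a_1(t,\mathbf u_I)\mathbf u_{II}]dt+\boldsymbol\Sigma_{II}(t,\mathbf u_I)d\mathbf W_{II}(t),$$ with $\mathbf W_I,\mathbf W_{II}$ independent Wiener processes, $\boldsymbol\Sigma_I$ non-degenerate. Given the path $\mathbf u_I(s)$, $s\le t$, the conditional law of $\mathbf u_{II}(t)$ is Gaussian $\mathcal N(\bar{\mathbf u}_{II}(t),\mathbf R_{II}(t))$, with density denoted $p(\mathbf u_{II}\mid\mathbf u_I(s\le t))$; the conditional mean and covariance evolve (all coefficients evaluated at $(t,\mathbf u_I(t))$) by $$d\bar{\mathbf u}_{II}=[\mathbf a_0+\mathbf a_1\bar{\mathbf u}_{II}]dt+\mathbf R_{II}\mathbf A_1^*(\boldsymbol\Sigma_I\boldsymbol\Sigma_I^* )^{-1}[d\mathbf u_I-(\mathbf A_0+\mathbf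 A_1\bar{\mathbf u}_{II})dt],$$ $$d\mathbf R_{II}=\{\mathbf a_1\mathbf R_{II}+\mathbf R_{II}\mathbf a_1^*+\boldsymbol\Sigma_{II}\boldsymbol\Sigma_{II}^*-\mathbf R_{II}\mathbf A_1^*(\boldsymbol\Sigma_I\boldsymbol\Sigma_I^* )^{-1}\mathbf A_1\mathbf R_{II}\}dt.$$ $\mathbf R_{II}(t)$ is random through its dependence on the path of $\mathbf u_I$. Hybrid estimator: let $\mathbf u_I^1,\dots,\mathbf u_I^L$ be the $\mathbf u_I$-components of $L$ independent trajectories of the system. For $H>0$ and $c_1,\dots,c_{N_I}>0$, let $K_H$ be the density of the Gaussian $\mathcal N(0,H\mathbf C)$ on $\mathbb R^{N_I}$, $\mathbf C=\mathrm{diag}(c_1^2,\dots,c_{N_I}^2)$, i.e. $K_H(x)=\prod_{i=1}^{N_I}(2\pi Hc_i^2)^{-1/2}\exp\left(-\sum_{i=1}^{N_I}\frac{x_i^2}{2Hc_i^2}\right)$. Then $$\hat p_t(\mathbf u_I,\mathbf u_{II})=\frac1L\sum_{i=1}^LK_H(\mathbf u_I-\mathbf u_I^i(t))\,p(\mathbf u_{II}\mid\mathbf u_I^i(s\le t)).$$ $\mathbb E$ denotes expectation over the random trajectories. The density $p_t$ is assumed three times differentiable in $\mathbf u_I$ (implicit in the definition of $M$). *)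

(* Defs.v *)
From HB Require Import structures.
From mathcomp Require Import all_boot all_order all_algebra.
From mathcomp Require Import all_classical all_reals all_analysis.

Set Implicit Arguments.
Unset Strict Implicit.
Unset Printing Implicit Defensive.

Import Order.TTheory GRing.Theory Num.Theory.
Import numFieldTopology.Exports numFieldNormedType.Exports.

Local Open Scope classical_set_scope.
Local Open Scope ring_scope.

Definition matrix_display : measure_display. Proof. exact. Qed.

Section matrix_measurable.
Context {R : realType} {m n : nat}.

(* For real entries the product sigma-algebra is the Borel sigma-algebra. *)
Definition matrix_measurable : set (set 'M[R]_(m, n)) :=
  <<s [set A | exists (i : 'I_m) (j : 'I_n) (B : set R),
         measurable B /\ A = [set M : 'M[R]_(m, n) | B (M i j)]] >>.

Let matrix_measurable0 : matrix_measurable set0.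
Proof. exact: sigma_algebra0. Qed.

Let matrix_measurableC A : matrix_measurable A -> matrix_measurable (~` A).
Proof. exact: sigma_algebraC. Qed.

Let matrix_measurable_bigcup (F : _^nat) :
  (forall i, matrix_measurable (F i)) -> matrix_measurable (\bigcup_i F i).
Proof. exact: sigma_algebra_bigcup. Qed.

HB.instance Definition _ := @isMeasurable.Build matrix_display
  'M[R]_(m, n) matrix_measurable matrix_measurable0 matrix_measurableC
  matrix_measurable_bigcup.

End matrix_measurable.

Section matrix_measurable_fun.
Context {R : realType}.

Lemma measurable_entry m n (i : 'I_m) (j : 'I_n) :
  measurable_fun [set: 'M[R]_(m, n)] (fun M => M i j).
Proof.
by move=> _ B mB; rewrite setTI; apply: sub_gen_smallest; exists i, j, B.
Qed.

Lemma measurable_fun_matrix d (T : measurableType d) m n (f : T -> 'M[R]_(m, n)) :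
  (forall i j, measurable_fun setT (fun x => f x i j)) -> measurable_fun setT f.
Proof.
move=> mf _ B mB; rewrite setTI.
pose C : set (set 'M[R]_(m, n)) := [set A | measurable (f @^-1` A)].
suff : matrix_measurable `<=` C by move/(_ _ mB).
apply: smallest_sub.
  split => [|A CA|F CF].
  - by rewrite /C/= preimage_set0.
  - by rewrite /C/= setTD preimage_setC; apply: measurableC.
  - rewrite /C/= preimage_bigcup; apply: bigcup_measurable => k _; exact: CF.
move=> _ [i [j [D [mD ->]]]]; rewrite /C/=.
by have := mf i j measurableT D mD; rewrite setTI.
Qed.

End matrix_measurable_fun.

Section lebesgue_cV.
Context {R : realType}.
Local Open Scope ereal_scope.

Section step.
Context {n : nat}.

Definition cV_cons (z : R * 'cV[R]_n) : 'cV[R]_n.+1 :=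
  col_mx (z.1%:M : 'M[R]_1) z.2.

Definition cV_uncons (v : 'cV[R]_n.+1) : R * 'cV[R]_n :=
  ((v : 'cV[R]_(1 + n)) ord0 ord0, dsubmx (v : 'cV[R]_(1 + n))).

Lemma cV_cons0 z j : cV_cons z ord0 j = z.1.
Proof.
rewrite (_ : ord0 = lshift n (ord0 : 'I_1) :> 'I_(1 + n)); last exact/val_inj.
by rewrite /cV_cons [LHS]col_mxEu mxE [j]ord1 eqxx mulr1n.
Qed.

Lemma cV_consS z i j : cV_cons z (lift ord0 i) j = z.2 i j.
Proof.
rewrite (_ : lift ord0 i = rshift 1 i :> 'I_(1 + n)); last exact/val_inj.
by rewrite /cV_cons [LHS]col_mxEd.
Qed.

Lemma cV_unconsK : cancel cV_uncons cV_cons.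
Proof.
move=> v; rewrite /cV_cons/= -[RHS](@vsubmxK _ 1 n 1 v).
rewrite (_ : _%:M = usubmx (v : 'cV[R]_(1 + n)))//.
by apply/colP => i; rewrite !mxE [i]ord1 eqxx mulr1n; congr (v _ _); exact/val_inj.
Qed.

Lemma cV_consK : cancel cV_cons cV_uncons.
Proof.
by move=> [x v]; rewrite /cV_uncons cV_cons0 /cV_cons/= col_mxKd.
Qed.

Lemma measurable_cV_cons : measurable_fun setT cV_cons.
Proof.
apply: measurable_fun_matrix => i j; case: (unliftP ord0 i) => [k ->|->].
- under eq_fun do rewrite cV_consS.
  exact: (measurableT_comp (measurable_entry k j) measurable_snd).
- by under eq_fun do rewrite cV_cons0; exact: measurable_fst.
Qed.

Lemma measurable_cV_uncons : measurable_fun setT cV_uncons.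
Proof.
apply/measurable_fun_pairP; split; first exact: measurable_entry.
apply: measurable_fun_matrix => i j.
rewrite [X in measurable_fun _ X](_ : _ =
  (fun v : 'cV[R]_n.+1 => v (rshift 1 i : 'I_n.+1) j)).
  exact: measurable_entry.
by apply/funext => v /=; rewrite mxE.
Qed.

Variable mu : {sigma_finite_measure set 'cV[R]_n -> \bar R}.

Definition lebesgue_step : set 'cV[R]_n.+1 -> \bar R :=
  pushforward (lebesgue_measure \x mu) cV_cons.

Let step0 : lebesgue_step set0 = 0.
Proof. by rewrite /lebesgue_step /pushforward preimage_set0 measure0. Qed.

Let step_ge0 A : 0 <= lebesgue_step A.
Proof. exact: (measure_ge0 (lebesgue_measure \x mu)). Qed.

Let step_sigma_additive : semi_sigma_additive lebesgue_step.
Proof.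
have mc A : measurable A -> measurable (cV_cons @^-1` A).
  by move=> mA; rewrite -[X in measurable X]setTI; exact: measurable_cV_cons.
move=> F mF tF mUF; rewrite /lebesgue_step /pushforward preimage_bigcup.
apply: measure_semi_sigma_additive => [i||]; first exact: mc.
- apply/trivIsetP => /= i j _ _ ij; rewrite -preimage_setI.
  by move/trivIsetP : tF => /(_ _ _ _ _ ij) ->//; rewrite preimage_set0.
- by rewrite -preimage_bigcup; exact: mc.
Qed.

HB.instance Definition _ := isMeasure.Build _ _ _ lebesgue_step
  step0 step_ge0 step_sigma_additive.

Let step_sigma_finite : sigma_finite setT lebesgue_step.
Proof.
have /sigma_finiteP[F [TF ndF Foo]] :=
  sigma_finiteT (lebesgue_measure : {sigma_finite_measure set _ -> \bar R}).
have /sigma_finiteP[G [TG ndG Goo]] := sigma_finiteT mu.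
exists (fun k => cV_uncons @^-1` (F k `*` G k)).
  rewrite -preimage_bigcup (_ : \bigcup_k _ = setT) ?preimage_setT//.
  rewrite -setXTT TF TG predeqE => -[x y]; split.
    by move=> [n0 _ []/= ? ?]; split; exists n0.
  move=> [/= [i _ Fix] [k _ Gky]]; exists (maxn i k) => //; split.
  - by move: x Fix; exact/subsetPset/ndF/leq_maxl.
  - by move: y Gky; exact/subsetPset/ndG/leq_maxr.
move=> k; have [mF Fkoo] := Foo k; have [mG Gkoo] := Goo k; split.
  rewrite -[X in measurable X]setTI; apply: measurable_cV_uncons => //.
  exact: measurableX.
rewrite /lebesgue_step /pushforward -comp_preimage.
rewrite (_ : cV_uncons \o cV_cons = id); last first.
  by apply/funext => z /=; exact: cV_consK.
by rewrite preimage_id product_measure1E// lte_mul_pinfty// ge0_fin_numE.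
Qed.

HB.instance Definition _ := Measure_isSigmaFinite.Build _ _ _ lebesgue_step
  step_sigma_finite.

End step.

(* Lebesgue measure on R^n, built one coordinate at a time. *)
Fixpoint lebesgue_cV (n : nat) : {sigma_finite_measure set 'cV[R]_n -> \bar R} :=
  match n with
  | 0 => dirac (0%R : 'cV[R]_0)
  | n'.+1 => lebesgue_step (lebesgue_cV n')
  end.

Lemma lebesgue_cV_box n (A : 'I_n -> set R) : (forall i, measurable (A i)) ->
  lebesgue_cV n [set v | forall i, A i (v i ord0)] =
  \prod_(i < n) lebesgue_measure (A i).
Proof.
elim: n => [|n ih] in A * => mA.
  by rewrite big_ord0/= diracE mem_set//= => -[].
have mB : measurable [set v : 'cV[R]_n | forall i, A (lift ord0 i) (v i ord0)].
  rewrite (_ : mkset _ = \bigcap_(i in [set: 'I_n])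
     [set v : 'cV[R]_n | A (lift ord0 i) (v i ord0)]).
    apply: fin_bigcap_measurable => // i _.
    by rewrite -[X in measurable X]setTI; exact: measurable_entry.
  by apply/seteqP; split => v /= Av i => [_|]; exact: Av.
have {}ih := ih _ (fun i => mA (lift ord0 i)).
rewrite big_ord_recl -{}ih -product_measure1E //; last exact: mA.
rewrite /= /lebesgue_step /pushforward.
congr (_ _); apply/seteqP; split => -[x v] /=.
- by move=> Av; split => [|i]; [have := Av ord0; rewrite cV_cons0
    |have := Av (lift ord0 i); rewrite cV_consS].
- move=> [A0 Av] i; case: (unliftP ord0 i) => [k ->|->].
  + by rewrite cV_consS.
  + by rewrite cV_cons0.
Qed.

End lebesgue_cV.

Section vectors.
Context {R : realType}.

(* Sum of the squared entries; the library norm on matrices is the sup norm. *)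
Definition frob2 m n (A : 'M[R]_(m, n)) : R := \sum_i \sum_j A i j ^+ 2.

Definition enorm n (v : 'cV[R]_n) : R := Num.sqrt (frob2 v).

Definition posdef n (S : 'M[R]_n) : Prop :=
  S^T = S /\ forall v : 'cV[R]_n, v != 0 -> 0 < (v^T *m S *m v) ord0 ord0.

(* k-fold Frechet differentiability: all iterated directional derivatives of
   order less than k exist and are differentiable functions. *)
Fixpoint times_differentiable (k : nat) n (f : 'cV[R]_n -> R) : Prop :=
  if k is k'.+1 then
    (forall x, differentiable f x) /\
    (forall v, times_differentiable k' ('D_v f))
  else True.

Definition gauss_density n (m : 'cV[R]_n) (S : 'M[R]_n) (y : 'cV[R]_n) : R :=
  \det ((2 * pi) *: S) `^ (- 2^-1) *
  expR (- 2^-1 * ((y - m)^T *m invmx S *m (y - m)) ord0 ord0).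

End vectors.

Section stochastic.
Context {R : realType} {d : measure_display} {T : measurableType d}.
Variable P : probability T R.

(* The time parameter ranges over R; only nonnegative times are used. *)
Record filtration (F : R -> set (set T)) : Prop := Filtration {
  filtration_sigma : forall s, 0 <= s -> sigma_algebra setT (F s);
  filtration_sub : forall s, 0 <= s -> F s `<=` measurable;
  filtration_mono : forall s t, 0 <= s -> s <= t -> F s `<=` F t }.

Definition adapted (F : R -> set (set T)) d' (U : measurableType d')
    (X : R -> T -> U) : Prop :=
  forall s, 0 <= s -> forall B, measurable B -> F s (X s @^-1` B).

Definition as_continuous (V : topologicalType) (X : R -> T -> V) : Prop :=
  {ae P, forall w, {within `[0, +oo[, continuous (fun s => X s w)}}.

(* The components are independent and the increments are independent of the
   past, so W = (W1; W2) being a Wiener process makes W1 and W2 independent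
   Wiener processes. *)
Record wiener (F : R -> set (set T)) k (W : R -> T -> 'cV[R]_k) : Prop := Wiener {
  wiener_adapted : adapted F W;
  wiener_continuous : as_continuous W;
  wiener0 : {ae P, forall w, W 0 w = 0};
  wiener_incr : forall s t, 0 <= s -> s < t ->
    forall (A : set T) (B : 'I_k -> set R),
      F s A -> (forall i, measurable (B i)) ->
      P (A `&` [set w | forall i, B i ((W t w - W s w) i ord0)]) =
      (P A * \prod_(i < k) normal_prob 0 (Num.sqrt (t - s)) (B i))%E }.

(* Convergence to 0 in probability. The events are only required to be
   contained in measurable ones of vanishing probability. *)
Definition cvg0_in_probability (Z : nat -> T -> \bar R) : Prop :=
  forall e : R, 0 < e -> exists A : nat -> set T,
    [/\ forall n, measurable (A n),
        forall n, [set w | (e%:E <= Z n w)%E] `<=` A n &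
        P (A n) @[n --> \oo] --> 0%E].

(* Elementary integrands: value j on the time interval ]node j, node j.+1],
   for j < size, and 0 elsewhere. *)
Record elementary m k := Elementary {
  el_size : nat;
  el_node : nat -> R;
  el_value : nat -> T -> 'M[R]_(m, k) }.

Definition el_predictable (F : R -> set (set T)) m k (Y : elementary m k) : Prop :=
  [/\ forall j, 0 <= el_node Y j,
      forall j, el_node Y j <= el_node Y j.+1,
      forall j B, measurable B -> F (el_node Y j) (el_value Y j @^-1` B) &
      exists C : R, forall j w, frob2 (el_value Y j w) <= C].

Definition el_at m k (Y : elementary m k) (s : R) (w : T) : 'M[R]_(m, k) :=
  \sum_(j < el_size Y)
    if (el_node Y j < s) && (s <= el_node Y j.+1) then el_value Y j w else 0.

Definition el_integral m k (Y : elementary m k) (W : R -> T -> 'cV[R]_k)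
    (t : R) (w : T) : 'cV[R]_m :=
  \sum_(j < el_size Y) el_value Y j w *m
    (W (Num.min (el_node Y j.+1) t) w - W (Num.min (el_node Y j) t) w).

(* I is (a version of) the Ito integral of X with respect to W over [0, t]. *)
Definition ito_integral (F : R -> set (set T)) m k (W : R -> T -> 'cV[R]_k)
    (X : R -> T -> 'M[R]_(m, k)) (t : R) (I : T -> 'cV[R]_m) : Prop :=
  exists Y : nat -> elementary m k,
    [/\ forall n, el_predictable F (Y n),
        cvg0_in_probability (fun n w =>
          (\int[lebesgue_measure]_(s in `[0%R, t])
             (frob2 (el_at (Y n) s w - X s w))%:E)%E) &
        cvg0_in_probability (fun n w =>
          (frob2 (el_integral (Y n) W t w - I w))%:E)].

(* dX = b dt + s dW *)
Record ito_process (F : R -> set (set T)) m k (W : R -> T -> 'cV[R]_k)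
    (X : R -> T -> 'cV[R]_m) (b : R -> T -> 'cV[R]_m)
    (s : R -> T -> 'M[R]_(m, k)) : Prop := ItoProcess {
  ito_adapted : adapted F X;
  ito_continuous : as_continuous X;
  ito_drift : {ae P, forall w, forall t, 0 <= t -> forall i,
    lebesgue_measure.-integrable `[0, t] (fun r => (b r w i ord0)%:E)};
  ito_diffusion : {ae P, forall w, forall t, 0 <= t ->
    (\int[lebesgue_measure]_(r in `[0%R, t]) (frob2 (s r w))%:E < +oo)%E};
  ito_eq : forall t, 0 <= t -> exists2 I, ito_integral F W s t I &
    {ae P, forall w, X t w = X 0 w +
       \col_i (\int[lebesgue_measure]_(r in `[0, t]) (b r w i ord0)) + I w} }.

End stochastic.

(* The sigma-algebra on paths generated by the evaluations at times in D. *)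
Definition path_events {R : realType} (D : set R) d (U : measurableType d) :
    set (set (R -> U)) :=
  <<s [set A | exists s B, [/\ D s, measurable B & A = [set x : R -> U | B (x s)]]] >>.

Record cg_coefficients (R : realType) (N1 N2 k1 k2 : nat) := CGCoefficients {
  cA0 : R -> 'cV[R]_N1 -> 'cV[R]_N1;
  cA1 : R -> 'cV[R]_N1 -> 'M[R]_(N1, N2);
  cS1 : R -> 'cV[R]_N1 -> 'M[R]_(N1, k1);
  ca0 : R -> 'cV[R]_N1 -> 'cV[R]_N2;
  ca1 : R -> 'cV[R]_N1 -> 'M[R]_(N2, N2);
  cS2 : R -> 'cV[R]_N1 -> 'M[R]_(N2, k2) }.

Definition jointly_measurable {R : realType} {N m n : nat}
    (f : R -> 'cV[R]_N -> 'M[R]_(m, n)) : Prop :=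
  measurable_fun [set z : R * 'cV[R]_N | 0 <= z.1]
    (fun z : R * 'cV[R]_N => f z.1 z.2).

Section cg_system.
Context {R : realType} {N1 N2 k1 k2 : nat}.
Variable co : cg_coefficients R N1 N2 k1 k2.

Record cg_regular : Prop := CGRegular {
  cA0_measurable : jointly_measurable (cA0 co);
  cA1_measurable : jointly_measurable (cA1 co);
  cS1_measurable : jointly_measurable (cS1 co);
  ca0_measurable : jointly_measurable (ca0 co);
  ca1_measurable : jointly_measurable (ca1 co);
  cS2_measurable : jointly_measurable (cS2 co);
  cS1_nondegenerate : forall s x, 0 <= s ->
    cS1 co s x *m (cS1 co s x)^T \in unitmx }.

Section solution.
Context {d : measure_display} {T : measurableType d}.
Variable P : probability T R.

Record cg_solution (F : R -> set (set T)) (W1 : R -> T -> 'cV[R]_k1)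
    (W2 : R -> T -> 'cV[R]_k2) (u1 : R -> T -> 'cV[R]_N1)
    (u2 : R -> T -> 'cV[R]_N2) : Prop := CGSolution {
  cg_filtration : filtration F;
  cg_wiener : wiener P F (fun s w => col_mx (W1 s w) (W2 s w));
  cg_u1 : ito_process P F W1 u1
    (fun s w => cA0 co s (u1 s w) + cA1 co s (u1 s w) *m u2 s w)
    (fun s w => cS1 co s (u1 s w));
  cg_u2 : ito_process P F W2 u2
    (fun s w => ca0 co s (u1 s w) + ca1 co s (u1 s w) *m u2 s w)
    (fun s w => cS2 co s (u1 s w)) }.

(* mu t and Sg t are the conditional mean and covariance of u2 t, as functions
   of the observed path of u1 up to time t. *)
Record cg_filter (F : R -> set (set T)) (W1 : R -> T -> 'cV[R]_k1)
    (u1 : R -> T -> 'cV[R]_N1) (u2 : R -> T -> 'cV[R]_N2)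
    (mu : R -> (R -> 'cV[R]_N1) -> 'cV[R]_N2)
    (Sg : R -> (R -> 'cV[R]_N1) -> 'M[R]_N2) : Prop := CGFilter {
  cg_mean_path : forall t, 0 <= t -> forall B, measurable B ->
    path_events `[0, t] (mu t @^-1` B);
  cg_cov_path : forall t, 0 <= t -> forall B, measurable B ->
    path_events `[0, t] (Sg t @^-1` B);
  (* The conditional law of u2 t given u1 up to time t is N(mu t, Sg t), which
     is stated through its density as soon as it has one. *)
  cg_cond_law : forall t, 0 <= t ->
    {ae P, forall w, posdef (Sg t (u1 ^~ w))} ->
    forall (A : set (R -> 'cV[R]_N1)) (B : set 'cV[R]_N2),
      path_events `[0, t] A -> measurable B ->
      P [set w | A (u1 ^~ w) /\ B (u2 t w)] =
      (\int[P]_(w in [set w | A (u1 ^~ w)])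
         \int[lebesgue_cV N2]_(y in B)
           (gauss_density (mu t (u1 ^~ w)) (Sg t (u1 ^~ w)) y)%:E)%E;
  (* With gain G = Sg A1^T (S1 S1^T)^-1, the term G du1 is expanded with
     du1 = (A0 + A1 u2) dt + S1 dW1. *)
  cg_mean_eq :
    let gain s w := Sg s (u1 ^~ w) *m (cA1 co s (u1 s w))^T *m
      invmx (cS1 co s (u1 s w) *m (cS1 co s (u1 s w))^T) in
    ito_process P F W1 (fun s w => mu s (u1 ^~ w))
      (fun s w => ca0 co s (u1 s w) + ca1 co s (u1 s w) *m mu s (u1 ^~ w) +
         gain s w *m ((cA0 co s (u1 s w) + cA1 co s (u1 s w) *m u2 s w) -
           (cA0 co s (u1 s w) + cA1 co s (u1 s w) *m mu s (u1 ^~ w))))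
      (fun s w => gain s w *m cS1 co s (u1 s w));
  cg_cov_eq :
    let rhs s w : 'M[R]_N2 :=
      let A1 := cA1 co s (u1 s w) in
      let S1 := cS1 co s (u1 s w) in
      let a1 := ca1 co s (u1 s w) in
      let S2 := cS2 co s (u1 s w) in
      let S := Sg s (u1 ^~ w) in
      a1 *m S + S *m a1^T + S2 *m S2^T -
      S *m A1^T *m invmx (S1 *m S1^T) *m A1 *m S in
    {ae P, forall w, forall t, 0 <= t -> forall i j,
      lebesgue_measure.-integrable `[0, t] (fun s => (rhs s w i j)%:E) /\
      Sg t (u1 ^~ w) i j = Sg 0 (u1 ^~ w) i j +
        \int[lebesgue_measure]_(s in `[0, t]) (rhs s w i j)} }.

End solution.

(* Independent trajectories (v1 i, v2 i) of the system, i < L, all distributed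
   as the trajectory (u1, u2). *)
Record cg_samples d (T : measurableType d) (P : probability T R)
    (u1 : R -> T -> 'cV[R]_N1) (u2 : R -> T -> 'cV[R]_N2)
    d' (T' : measurableType d') (P' : probability T' R) (L : nat)
    (v1 : 'I_L -> R -> T' -> 'cV[R]_N1) (v2 : 'I_L -> R -> T' -> 'cV[R]_N2) : Prop :=
    CGSamples {
  cg_samples_solution : forall i, exists F W1 W2,
    cg_solution P' F W1 W2 (v1 i) (v2 i);
  cg_samples_law : forall i (A : set (R -> 'cV[R]_N1 * 'cV[R]_N2)),
    path_events `[0, +oo[ A ->
    P' [set w | A (fun s => (v1 i s w, v2 i s w))] =
    P [set w | A (fun s => (u1 s w, u2 s w))];
  cg_samples_indep : forall A : 'I_L -> set (R -> 'cV[R]_N1 * 'cV[R]_N2),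
    (forall i, path_events `[0, +oo[ (A i)) ->
    P' [set w | forall i, A i (fun s => (v1 i s w, v2 i s w))] =
    (\prod_(i < L) P' [set w | A i (fun s => (v1 i s w, v2 i s w))])%E }.

End cg_system.

Section estimator.
Context {R : realType} {N1 N2 : nat}.
Local Notation path := (R -> 'cV[R]_N1).

(* Density of N(0, H diag(c_1^2, ..., c_N1^2)). *)
Definition gauss_kernel (H : R) (c : 'I_N1 -> R) (x : 'cV[R]_N1) : R :=
  (\prod_i (2 * pi * H * c i ^+ 2) `^ (- 2^-1)) *
  expR (- \sum_i (x i ord0 ^+ 2 / (2 * H * c i ^+ 2))).

Record joint_density d (T : measurableType d) (P : probability T R)
    (u1 : R -> T -> 'cV[R]_N1) (u2 : R -> T -> 'cV[R]_N2) (t : R)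
    (p : 'cV[R]_N1 -> 'cV[R]_N2 -> R) : Prop := JointDensity {
  density_measurable : measurable_fun setT (fun z : 'cV[R]_N1 * 'cV[R]_N2 => p z.1 z.2);
  density_ge0 : forall x y, 0 <= p x y;
  density_law : forall C : set ('cV[R]_N1 * 'cV[R]_N2), measurable C ->
    P [set w | C (u1 t w, u2 t w)] =
    (\int[lebesgue_cV N1 \x lebesgue_cV N2]_(z in C) (p z.1 z.2)%:E)%E }.

Definition hybrid (T : Type) (H : R) (c : 'I_N1 -> R)
    (mu : R -> path -> 'cV[R]_N2) (Sg : R -> path -> 'M[R]_N2)
    (L : nat) (v1 : 'I_L -> R -> T -> 'cV[R]_N1) (t : R)
    (w : T) (x : 'cV[R]_N1) (y : 'cV[R]_N2) : R :=
  L%:R^-1 * \sum_(i < L) gauss_kernel H c (x - v1 i t w) *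
    gauss_density (mu t (v1 i ^~ w)) (Sg t (v1 i ^~ w)) y.

Definition J (f : 'cV[R]_N1 -> 'cV[R]_N2 -> R) : \bar R :=
  (\int[lebesgue_cV N1 \x lebesgue_cV N2]_z ((f z.1 z.2) ^+ 2)%:E)%E.

End estimator.

(* Main.v *)
(* Bias. The conditional law integrates the path out, so pbar is p smoothed by
   the kernel K in the u_I variable, almost everywhere. Taylor's formula under
   the smoothing integral kills the odd moments of K, turns the second order
   term into (H/2) sum_i c_i^2 d_i^2 p, and leaves the integral of
   K(z) (1-s)^2/2 |z|^3 M(x + s z). Minkowski's inequality is avoided by
   (a + b)^2 <= (1 + delta) a^2 + (1 + 1/delta) b^2 and Cauchy-Schwarz, splitting
   |z|^3 M as |z| times |z|^2 M: this costs E|Z|^2 E|Z|^4 <= 3 H^3 (sum_i c_i^2)^3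
   and, with the weight (1-s)^2/2 of total mass 1/6, a factor 3/36 <= 1/2.

   Variance. The summands are i.i.d., so the variance at a point is at most 1/L
   times the second moment of one summand; integrating over space, one factor of
   the squared summand is bounded by its supremum and the other integrates to 1.

   The Gaussian integral in dimension N_II is never computed: that the
   conditional density has mass 1 is read off the conditional law. *)
Require Import Defs.
From HB Require Import structures.
From mathcomp Require Import all_boot all_order all_algebra.
From mathcomp Require Import all_classical all_reals all_analysis.
From mathcomp Require Import measurable_realfun.
From mathcomp Require Import ring lra.

Set Implicit Arguments.
Unset Strict Implicit.
Unset Printing Implicit Defensive.

Import Order.TTheory GRing.Theory Num.Theory.
Import numFieldTopology.Exports numFieldNormedType.Exports.

Local Open Scope classical_set_scope.
Local Open Scope ring_scope.

(** * Taylor's formula with a measurable bound on the third derivative *)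

(** The errors live in the extended nonnegative reals: [M] is merely measurable, and [J M], the
    remainder at a point or the second moment of a summand may be infinite. Each step therefore has
    a form that survives the value [+oo]: Taylor's formula is an inequality obtained without
    integrating the third derivative, cross terms are cancelled through finite positive and negative
    parts, and integrals are exchanged by Tonelli's theorem on nonnegative functions. The estimator
    is studied for an abstract observation [U] with values in a measurable space [Om], together with
    a conditional density [g] of [V] given [U]. For the theorem, [Om] consists of the paths of the
    first component, with the sigma-algebra generated by the evaluations up to time [t]. The
    conditional law speaks only of rectangles; uniqueness of finite measures extends it to the
    product sigma-algebra, and monotone convergence to nonnegative functions. *)

Lemma le01_of_locally_nondecreasing (R : realType) (g : R -> R) :
  (forall s : R, 0 <= s -> s < 1 -> exists2 d : R, 0 < d &
    forall r : R, s < r -> r < s + d -> r <= 1 -> g s <= g r) ->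
  (forall s e : R, 0 < s -> s <= 1 -> 0 < e -> exists2 d : R, 0 < d &
    forall r : R, s - d < r -> r < s -> g r <= g s + e) ->
  g 0 <= g 1.
Proof.
move=> gr gl.
(* Continuous induction on [c = sup A]. The two hypotheses are one-sided, so [g] may jump upwards:
   they fit a monotone function, of unknown continuity, minus a differentiable one. *)
pose A : set R := [set s | 0 <= s <= 1 /\ forall r : R, 0 <= r -> r <= s -> g 0 <= g r].
have A0 : A 0.
  split; first by rewrite lexx ler01.
  by move=> r r0 r0'; rewrite (_ : r = 0)//; apply/eqP; rewrite eq_le r0 r0'.
have supA : has_sup A by split; [exists 0|exists 1 => s [/andP[]]].
pose c := sup A.
have c0 : 0 <= c by apply: sup_upper_bound.
have c1 : c <= 1 by apply: ge_sup => [|s [/andP[]]//]; exists 0.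
have below (r : R) : 0 <= r -> r < c -> g 0 <= g r.
  move=> r0 rc; have cr : 0 < c - r by rewrite subr_gt0.
  have [s [_ As] rs] := sup_adherent cr supA.
  by apply: As => //; rewrite -/c in rs; lra.
have gc : g 0 <= g c.
  have [c_gt0|] := ltP 0 c; last by move=> c0'; rewrite (_ : c = 0)//; apply/eqP; rewrite eq_le c0 c0'.
  apply/ler_addgt0Pr => e e0.
  have [d d0 hd] := gl _ _ c_gt0 c1 e0.
  pose r := Num.max (c - d / 2) (c / 2).
  have rc : r < c by rewrite /r gt_max; apply/andP; split; lra.
  have rd : c - d < r by rewrite /r lt_max; apply/orP; left; lra.
  have r0 : 0 <= r by rewrite /r le_max; apply/orP; right; lra.
  by apply: (le_trans (below _ r0 rc)); apply: hd.
have Ac : A c.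
  split; first by rewrite c0 c1.
  move=> r r0; rewrite le_eqVlt => /predU1P[->//|]; exact: below.
have [cl1|] := ltP c 1; last by move=> c1'; rewrite (_ : 1 = c)//; apply/eqP; rewrite eq_le c1 c1'.
have [d d0 hd] := gr _ c0 cl1.
pose r := Num.min (c + d / 2) 1.
have rc : c < r by rewrite /r lt_min; apply/andP; split; lra.
have r1 : r <= 1 by rewrite /r ge_min lexx orbT.
have rd : r <= c + d / 2 by rewrite /r ge_min lexx.
suff : A r by move=> /(sup_upper_bound supA); rewrite -/c; lra.
split; first by apply/andP; split => //; lra.
move=> s s0 sr; have [sc|cs] := leP s c; first exact: Ac.2.
by apply: (le_trans gc); apply: hd => //; lra.
Qed.

Lemma is_derive_le_right (R : realType) (h : R -> R) (s l e : R) :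
  is_derive s (1 : R) h l -> 0 < e ->
  exists2 d : R, 0 < d & forall r : R, s < r -> r < s + d ->
    h r - h s <= (l + e) * (r - s).
Proof.
move=> [dh <-] e0.
have /cvgrPdist_lt/(_ _ e0)[d /= d0 hd] := dh.
exists d => // r sr rsd.
have := hd (r - s); rewrite /= sub0r normrN gtr0_norm ?subr_gt0// ltrBlDl.
move=> /(_ rsd); rewrite gt_eqF ?subr_gt0// => /(_ isT).
rewrite distrC => /ltW/ler_distlDr; rewrite -/('D_1 h s).
rewrite /GRing.scale/= mulr1 subrK => hle.
by rewrite -ler_pdivrMr ?subr_gt0// mulrC.
Qed.

Lemma le_lebesgue_measure (R : realType) (A B : set R) :
  measurable A -> measurable B -> A `<=` B ->
  (lebesgue_measure A <= lebesgue_measure B)%E.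
Proof.
by move=> mA mB AB; apply: le_measure => //; rewrite inE; [exact: mA|exact: mB].
Qed.

(* [h'] need not be integrable, so the fundamental theorem of calculus is not
   available. Up to [e], [m] is dominated by a series of [k.+1 * e] times
   indicators of open sets [U k], whose primitive [F] grows locally at least as
   fast as [h]. *)
Lemma increment_le_integral (R : realType) (h h' m : R -> R) :
  (forall s : R, 0 <= s <= 1 -> is_derive s (1 : R) h (h' s)) ->
  (forall s : R, 0 <= s <= 1 -> h' s <= m s) ->
  (forall s : R, 0 <= s <= 1 -> 0 <= m s) ->
  measurable_fun (`[0, 1]%classic : set R) m ->
  ((h 1 - h 0)%:E <= \int[lebesgue_measure]_(s in `[0%R, 1%R]) (m s)%:E)%E.
Proof.
move=> dh hm m0 mm.
have mI : measurable (`[0%R : R, 1]%classic : set R) by exact: measurable_itv.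
have int0 : (0 <= \int[lebesgue_measure]_(s in `[0%R, 1%R]) (m s)%:E)%E.
  by apply: integral_ge0 => s /=; rewrite in_itv/= lee_fin => /m0.
have [->|intfin] := eqVneq (\int[lebesgue_measure]_(s in `[0%R, 1%R]) (m s)%:E)%E +oo%E.
  by rewrite leey.
apply/lee_addgt0Pr => e' e'0.
(* Three errors of size [e] arise: the discretisation of [m], the excess of the open sets over the
   level sets, and the slack in the difference quotients of [h]. *)
pose e : R := e' / 3; have e0 : 0 < e by rewrite /e divr_gt0.
(* Slicing by height: on [E k] the constant [k.+1 * e] exceeds [m] by at most [e]. *)
pose E (k : nat) : set R := `[0, 1]%classic `&` [set s | k%:R * e <= m s < k.+1%:R * e].
have mE k : measurable (E k).
  rewrite /E (_ : [set s | _] = m @^-1` `[k%:R * e, k.+1%:R * e[); last first.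
    by apply/seteqP; split => s /=; rewrite in_itv.
  by apply: mm => //; exact: measurable_itv.
have EI k : E k `<=` `[0, 1]%classic by move=> s [].
have muE k : (lebesgue_measure (E k) < +oo)%E.
  apply: (@le_lt_trans _ _ (lebesgue_measure `[0, 1]%classic)).
    by apply: le_lebesgue_measure.
  by rewrite lebesgue_measure_itv/= lte_fin ltr01 -EFinD ltry.
(* Chosen so that [k.+1 * e * del k = e / 2 ^ k.+1], which sums to [e] over [k]. *)
pose del (k : nat) : R := (2 ^ k.+1)%:R^-1 / k.+1%:R.
have del0 k : 0 < del k by rewrite divr_gt0 ?invr_gt0 ?ltr0n ?expn_gt0.
have /choice[U hU] k : exists U : set R,
    [/\ open U, E k `<=` U & (lebesgue_measure (U `\` E k) < (del k)%:E)%E].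
  by apply: lebesgue_regularity_outer; [exact: mE|exact: muE|exact: del0].
have oU k : open (U k) by have [] := hU k.
have EU k : E k `<=` U k by have [] := hU k.
have UE k : (lebesgue_measure (U k `\` E k) < (del k)%:E)%E by have [] := hU k.
have mU k : measurable (U k) by exact: open_measurable.
pose co k : R := k.+1%:R * e.
have co0 k : 0 <= co k by rewrite mulr_ge0 ?ler0n ?ltW.
(* Primitive of the dominating step series. It is shown to be finite only after [F 1] has been
   compared with the finite integral of [m]. *)
pose F (s : R) : \bar R := (\sum_(k <oo) (co k)%:E * lebesgue_measure (U k `&` `[0%R, s]))%E.
have mUs k (s : R) : measurable (U k `&` `[0, s]) by apply: measurableI.
have t0 k (s : R) : (0 <= (co k)%:E * lebesgue_measure (U k `&` `[0%R, s]))%E.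
  by apply: mule_ge0; rewrite ?lee_fin.
have F0 s : (0 <= F s)%E by apply: nneseries_ge0 => n _ _; exact: t0.
have cover : \bigcup_k E k = `[0, 1]%classic.
  apply/seteqP; split => [s [k _ []]//|s /= sI].
  have /m0 ms0 : 0 <= s <= 1 by move: sI; rewrite in_itv.
  exists (Num.truncn (m s / e)) => //; split => //=.
  have me0 : 0 <= m s / e by rewrite divr_ge0 // ltW.
  have /andP[h1 h2] := truncn_itv me0.
  by rewrite -ler_pdivlMr// h1/= -ltr_pdivrMr.
have trE : trivIset setT E.
  apply/trivIsetP => i j _ _ ij; apply/seteqP; split => // s [[_ /= /andP[i1 i2]] [_ /andP[j1 j2]]].
  have := le_lt_trans i1 j2; have := le_lt_trans j1 i2.
  rewrite !ltr_pM2r// !ltr_nat !ltnS => ji ij'.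
  by move: ij; rewrite eqn_leq ji ij'.
have F1 : (F 1%R <= \int[lebesgue_measure]_(s in `[0%R, 1%R]) (m s)%:E + e%:E + e%:E)%E.
  have step k : ((co k)%:E * lebesgue_measure (U k `&` `[0%R, 1%R]) <=
      \int[lebesgue_measure]_(s in E k) (m s + e)%:E + (e / (2 ^ k.+1)%:R)%:E)%E.
    apply: (@le_trans _ _ ((co k)%:E * (lebesgue_measure (E k) + (del k)%:E))%E).
      apply: lee_wpmul2l; first by rewrite lee_fin.
      apply: (@le_trans _ _ (lebesgue_measure (E k `|` (U k `\` E k)))).
        apply: le_lebesgue_measure => //.
          by apply: measurableU => //; exact: measurableD.
        by move=> s [Us _]; have [|] := pselect (E k s); [left|right].
      have mUE : measurable (U k `\` E k) by exact: measurableD.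
      apply: (@le_trans _ _ (lebesgue_measure (E k) + lebesgue_measure (U k `\` E k))%E).
        by apply: measureU2; [exact: mE|exact: mUE].
      by rewrite leeD2l// ltW.
    rewrite ge0_muleDr//; last by rewrite lee_fin ltW.
    apply: leeD.
      have -> : ((co k)%:E * lebesgue_measure (E k) =
          \int[lebesgue_measure]_(s in E k) (co k)%:E)%E.
        by rewrite integral_cst//; exact: mE.
      apply: ge0_le_integral.
      - exact: mE.
      - by move=> s _; rewrite lee_fin.
      - exact: measurable_cst.
      - apply/measurable_EFinP; apply: measurable_funD => //.
        by apply: measurable_funS mm.
      - move=> s [_ /= /andP[k1 _]]; rewrite lee_fin /co -natr1 mulrDl mul1r.
        by rewrite lerD2r.
    rewrite -EFinM lee_fin /co /del; have := ltr0Sn R k; move=> k0.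
    by rewrite le_eqVlt; apply/orP; left; apply/eqP; field; rewrite addrC natr1 !gt_eqF ?exprn_gt0.
  apply: (@le_trans _ _ (\sum_(k <oo) (\int[lebesgue_measure]_(s in E k) (m s + e)%:E + (e / (2 ^ k.+1)%:R)%:E))%E).
    by apply: lee_nneseries => // k _; exact: step.
  have mme : measurable_fun (`[0, 1]%classic : set R) (fun s => (m s + e)%:E).
    by apply/measurable_EFinP; exact: measurable_funD.
  have me0 s : (`[0, 1]%classic : set R) s -> (0 <= (m s + e)%:E)%E.
    rewrite /= in_itv/= => /m0 ?; rewrite lee_fin; lra.
  apply: (@le_trans _ _ (\sum_(k <oo) (\int[lebesgue_measure]_(s in E k) (m s + e)%:E) + e%:E)%E).
    apply: epsilon_trick; last exact: ltW.
    by move=> k; apply: integral_ge0 => s /EI /me0.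
  apply: leeD => //.
    rewrite -ge0_integral_bigcup ?cover //.
    under eq_integral do rewrite EFinD.
    rewrite ge0_integralD//.
    - apply: leeD => //.
      have -> : (\int[lebesgue_measure]_(s in `[0%R, 1%R]) e%:E =
          e%:E * lebesgue_measure (`[0%R, 1%R]%classic : set R))%E.
        by rewrite integral_cst//; exact: mI.
      by rewrite lebesgue_measure_itv/= lte_fin ltr01 -EFinD -EFinM lee_fin oppr0 addr0 mulr1.
    - exact/measurable_EFinP.
    - by move=> s _; rewrite lee_fin ltW.
have Fmono (s r : R) : s <= r -> (F s <= F r)%E.
  move=> sr; apply: lee_nneseries => [k _ _|k _]; first exact: t0.
  apply: lee_wpmul2l; first by rewrite lee_fin.
  apply: le_lebesgue_measure => // x [Ux]; rewrite /= !in_itv/= => /andP[-> xs].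
  by split => //; exact: le_trans sr.
have F1fin : (F 1%R < +oo)%E.
  apply: (le_lt_trans F1); rewrite -addeA -EFinD lte_add_pinfty ?ltry//.
  by rewrite ltey.
have Ffin s : s <= 1 -> F s \is a fin_num.
  by move=> s1; rewrite (ge0_fin_numE (F0 s)); exact: (le_lt_trans (Fmono _ _ s1) F1fin).
pose Fr s := fine (F s).
have Frmono s r : s <= r -> r <= 1 -> Fr s <= Fr r.
  move=> sr r1; apply: fine_le; rewrite ?Ffin//; first exact: le_trans r1.
  exact: Fmono.
(* The linear term pays for the slack [e] between the difference quotients of [h] and its
   derivative. *)
pose g s := Fr s + e * s - h s.
suff : g 0 <= g 1.
  have Fr0 : Fr 0 = 0.
    rewrite /Fr /F eseries0// => k _ _; rewrite set_itv1.
    apply/eqP; rewrite mule_eq0; apply/orP; right; rewrite -measure_le0.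
    by rewrite -(lebesgue_measure_set1 (0 : R)); apply: le_lebesgue_measure => //; exact: measurableI.
  rewrite /g Fr0 mulr0 mulr1 addr0 add0r => g01.
  apply: (@le_trans _ _ (F 1%R + e%:E)%E).
    by rewrite -(fineK (Ffin _ (lexx 1))) -EFinD lee_fin -/(Fr 1); lra.
  apply: (le_trans (leeD2r _ F1)).
  have -> : e'%:E = (e%:E + e%:E + e%:E)%E by rewrite -!EFinD /e; congr EFin; field.
  by rewrite !addeA.
apply: le01_of_locally_nondecreasing => [s s0 s1|s eps s0 s1 eps0].
- have : (`[0, 1]%classic : set R) s by rewrite /= in_itv/= s0 ltW.
  rewrite -cover => -[k _ Ek].
  have ds : is_derive s (1 : R) h (h' s) by apply: dh; rewrite s0 ltW.
  have [d1 d10 hd1] := is_derive_le_right ds e0.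
  have /nbhs_ballP[d2 /= d20 hd2] : nbhs s (U k) by apply: open_nbhs_nbhs; split => //; exact: EU.
  exists (Num.min d1 d2); first by rewrite lt_min d10 d20.
  move=> r sr; rewrite -ltrBlDl lt_min => /andP[rd1 rd2] r1.
  have hr := hd1 r sr; rewrite -ltrBlDl in hr; have {}hr := hr rd1.
  have mk : h' s <= co k.
    by case: Ek => _ /= /andP[_ /ltW]; apply: le_trans; apply: hm; rewrite s0 ltW.
  have hr2 : h r - h s <= (co k + e) * (r - s).
    by apply: (le_trans hr); rewrite ler_wpM2r ?lerD2r// subr_ge0 ltW.
  (* For [r] close to [s] the whole interval from [s] to [r] lies in the open set [U k], so the
     [k]-th term alone grows by [co k * (r - s)], and no other term decreases. *)
  have Fsr : Fr s + co k * (r - s) <= Fr r.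
    rewrite -lee_fin EFinD !fineK ?Ffin// ?(ltW s1)//.
    rewrite /F (nneseriesD1 (n := k))// [leRHS](nneseriesD1 (n := k))//.
    rewrite addeAC leeD//.
      have mB : measurable (`]s, r]%classic : set R) by exact: measurable_itv.
      have disj : U k `&` `[0, s] `&` `]s, r] = set0.
        apply/seteqP; split => // x [[_]]; rewrite /= !in_itv/= => /andP[_ xs] /andP[sx _].
        by move: xs; rewrite leNgt sx.
      have mUU : (lebesgue_measure ((U k `&` `[0%R, s]) `|` `]s, r]) =
          lebesgue_measure (U k `&` `[0%R, s]) + (r - s)%:E)%E.
        have := @measureU _ _ _ (@lebesgue_measure R) (U k `&` `[0, s]) `]s, r]%classic (mUs k s) mB.
        have lsr : lebesgue_measure (`]s, r]%classic : set R) = (r - s)%:E.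
          by rewrite lebesgue_measure_itv/= lte_fin sr EFinB.
        by rewrite -lsr => /(_ disj) e1; exact: e1.
      rewrite [leLHS](_ : _ = (co k)%:E * lebesgue_measure ((U k `&` `[0%R, s]) `|` `]s, r]))%E; last first.
        by rewrite mUU ge0_muleDr ?EFinM// lee_fin subr_ge0 ltW.
      apply: lee_wpmul2l; first by rewrite lee_fin.
      apply: le_lebesgue_measure; [exact: measurableU|exact: mUs|].
      move=> x [[Ux]|] /=; rewrite !in_itv/=.
        by move=> /andP[-> xs]; split => //; rewrite (le_trans xs)// ltW.
      move=> /andP[sx xr]; split; last by rewrite xr andbT (le_trans s0)// ltW.
      by apply: hd2; rewrite /ball/= ltr_distlC; apply/andP; split; lra.
    apply: lee_nneseries => [j _ _|j _]; first exact: t0.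
    apply: lee_wpmul2l; first by rewrite lee_fin.
    apply: le_lebesgue_measure => // x [Ux]; rewrite /= !in_itv/= => /andP[-> xs].
    by split => //; rewrite (le_trans xs)// ltW.
  rewrite /g; have : (co k + e) * (r - s) = co k * (r - s) + e * r - e * s by ring.
  by lra.
(* To the left of [s], monotonicity of [Fr] and continuity of [h] are enough. *)
- have ds : is_derive s (1 : R) h (h' s) by apply: dh; rewrite s1 ltW.
  have ch : {for s, continuous h}.
    by apply: differentiable_continuous; apply/derivable1_diffP; case: ds.
  have /cvgrPdist_lt/(_ _ eps0)[d /= d0 hd] := ch.
  exists d => // r rd rs.
  have rsd : `|s - r| < d by rewrite ltr_distlC; apply/andP; split; lra.
  have := hd r rsd; rewrite ltr_distlC => /andP[hr _].
  have := Frmono _ _ (ltW rs) s1.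
  have : e * r <= e * s by rewrite ler_pM2l// ltW.
  by rewrite /g; lra.
Qed.

Section taylor.
Context {R : realType} {n : nat}.
Implicit Types (f : 'cV[R]_n -> R) (x v z : 'cV[R]_n).

Let difference_quotient_along f x v (s : R) :
  (fun h : R => h^-1 *: (((fun s : R => f (x + s *: v)) \o shift s) (h *: (1 : R)) -
    f (x + s *: v))) =
  (fun h : R => h^-1 *: ((f \o shift (x + s *: v)) (h *: v) - f (x + s *: v))).
Proof. by apply/funext => h /=; rewrite [h%:A]mulr1 scalerDl addrCA. Qed.

Lemma derive_along f x v (s : R) :
  'D_1 (fun s : R => f (x + s *: v)) s = 'D_v f (x + s *: v).
Proof. by rewrite /derive difference_quotient_along. Qed.

Lemma is_derive_along f x v (s : R) : differentiable f (x + s *: v) ->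
  is_derive s (1 : R) (fun s : R => f (x + s *: v)) ('D_v f (x + s *: v)).
Proof.
move=> df; apply: DeriveDef; last exact: derive_along.
by rewrite /derivable difference_quotient_along; exact: diff_derivable.
Qed.

Lemma derive1n_along f x v k :
  derive1n k (fun s : R => f (x + s *: v)) =
  (fun s : R => iter k (fun g => 'D_v g) f (x + s *: v)).
Proof.
elim: k => // k ih; rewrite derive1nS ih; apply/funext => s.
by rewrite derive1E derive_along.
Qed.

Lemma derive_scale f x (k : R) v : differentiable f x ->
  'D_(k *: v) f x = k * 'D_v f x.
Proof. by move=> df; rewrite !deriveE// linearZ. Qed.

Lemma derive_cmul f x (k : R) v : differentiable f x ->
  'D_v (k \*: f) x = k * 'D_v f x.
Proof. by move=> df; rewrite deriveZ//; exact: diff_derivable. Qed.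

Lemma derive_coord f x v : differentiable f x ->
  'D_v f x = \sum_i v i ord0 * 'D_(delta_mx i ord0) f x.
Proof.
move=> df; rewrite deriveE// {1}(matrix_sum_delta v) linear_sum; apply: eq_bigr => i _.
by rewrite big_ord1 linearZ/= deriveE.
Qed.

Lemma derive2_coord f x v : times_differentiable 2 f ->
  'D_v ('D_v f) x = \sum_i \sum_j v i ord0 * v j ord0 *
    'D_(delta_mx i ord0) ('D_(delta_mx j ord0) f) x.
Proof.
move=> [df d2f].
rewrite derive_coord; last by case: (d2f v).
apply: eq_bigr => i _.
transitivity (v i ord0 * \sum_j (v j ord0 * 'D_(delta_mx i ord0) ('D_(delta_mx j ord0) f) x)); last first.
  by rewrite mulr_sumr; apply: eq_bigr => j _; rewrite mulrA.
congr (_ * _).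
have -> : 'D_v f = \sum_j (v j ord0 \*: 'D_(delta_mx j ord0) f).
  by apply/funext => y; rewrite derive_coord// fct_sumE.
rewrite derive_sum => [|j]; last first.
  by apply: derivableZ; apply: diff_derivable; case: (d2f (delta_mx j ord0)).
apply: eq_bigr => j _; rewrite deriveZ//.
by apply: diff_derivable; case: (d2f (delta_mx j ord0)).
Qed.

Lemma enorm_ge0 v : 0 <= enorm v. Proof. exact: sqrtr_ge0. Qed.

Lemma enorm_sqr v : enorm v ^+ 2 = \sum_i v i ord0 ^+ 2.
Proof.
rewrite sqr_sqrtr; last by do 2 (apply: sumr_ge0 => ? _); rewrite sqr_ge0.
by apply: eq_bigr => i _; rewrite big_ord1.
Qed.

Lemma enorm_eq0 v : enorm v = 0 -> v = 0.
Proof.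
move=> v0; apply/colP => i; rewrite mxE.
have : \sum_i v i ord0 ^+ 2 = 0 by rewrite -enorm_sqr v0 expr0n.
move/eqP; rewrite psumr_eq0 => [/allP/(_ i (mem_index_enum _))|j _]; last exact: sqr_ge0.
by rewrite sqrf_eq0 => /eqP.
Qed.

Lemma enormZ (k : R) v : 0 <= k -> enorm (k *: v) = k * enorm v.
Proof.
move=> k0; apply/eqP; rewrite -(@eqrXn2 _ 2)// ?mulr_ge0 ?enorm_ge0//.
rewrite exprMn !enorm_sqr mulr_sumr; apply/eqP; apply: eq_bigr => i _.
by rewrite mxE exprMn.
Qed.

(** Homogeneity of degree three: with [v = enorm v *: w], each of the three derivatives releases one
    factor [enorm v], by differentiability of the function derived. For [v = 0] the direction [0] in
    the hypothesis shows that [m x] is nonnegative. *)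
Lemma third_derive_le f (m : 'cV[R]_n -> R) : times_differentiable 3 f ->
  (forall x v, enorm v <= 1 -> `|derive1n 3 (fun s : R => f (x + s *: v)) 0| <= m x) ->
  forall x v, `|'D_v ('D_v ('D_v f)) x| <= enorm v ^+ 3 * m x.
Proof.
move=> [df d2f] fm x v.
have [/eqP/enorm_eq0 ->|v0] := boolP (enorm v == 0).
  rewrite derive0 normr0 mulr_ge0 ?exprn_ge0 ?enorm_ge0//.
  apply: le_trans (fm x 0 _); first exact: normr_ge0.
  by rewrite /enorm /frob2; rewrite big1 ?sqrtr0 ?ler01// => i _; rewrite big1// => j _; rewrite mxE expr0n.
pose w := (enorm v)^-1 *: v.
have vw : v = enorm v *: w by rewrite scalerA divff ?scale1r.
have w1 : enorm w <= 1 by rewrite enormZ ?invr_ge0 ?enorm_ge0// mulVf.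
have dvw g y : differentiable g y -> 'D_v g y = enorm v * 'D_w g y.
  by move=> dgy; rewrite {1}vw derive_scale.
have D1 : 'D_v f = enorm v \*: 'D_w f.
  by apply/funext => y; rewrite dvw.
have dw y : differentiable ('D_w f) y by case: (d2f w).
have dww y : differentiable ('D_w ('D_w f)) y by case: (d2f w) => _ /(_ w) [].
have D2 : 'D_v ('D_v f) = (enorm v ^+ 2) \*: 'D_w ('D_w f).
  apply/funext => y; rewrite D1 derive_cmul; last exact: dw.
  by rewrite dvw; [rewrite mulrA|exact: dw].
have -> : 'D_v ('D_v ('D_v f)) x = enorm v ^+ 3 * 'D_w ('D_w ('D_w f)) x.
  transitivity ('D_v (enorm v ^+ 2 \*: 'D_w ('D_w f)) x).
    exact: (congr1 (fun g : 'cV[R]_n -> R => 'D_v g x) D2).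
  transitivity (enorm v ^+ 2 * 'D_v ('D_w ('D_w f)) x).
    exact: (derive_cmul _ _ (dww x)).
  by rewrite (dvw _ _ (dww x)) mulrA -exprSr.
rewrite normrM ger0_norm ?exprn_ge0 ?enorm_ge0// ler_wpM2l ?exprn_ge0 ?enorm_ge0//.
by have := fm x w w1; rewrite derive1n_along /= scale0r addr0.
Qed.

(* With [g1], [g2], [g3] the successive derivatives of [g0], the telescoping in
   this derivative leaves only the third-order term. *)
Lemma is_derive_taylor_remainder (g0 g1 g2 : R -> R) (c g3 s : R) :
  is_derive s (1 : R) g0 (g1 s) -> is_derive s (1 : R) g1 (g2 s) ->
  is_derive s (1 : R) g2 g3 ->
  is_derive s (1 : R)
    (fun s : R => c - (g0 s + (1 - s) * g1 s + (1 - s) ^+ 2 / 2 * g2 s))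
    (- ((1 - s) ^+ 2 / 2 * g3)).
Proof.
move=> d0 d1 d2; apply: is_derive_eq.
by rewrite /GRing.scale/=; field.
Qed.

(** Moving the base point of the expansion from [x] to [x + z] makes the error vanish, and its
    derivative contains third derivatives only. The right-hand side may be [+oo]. *)
Lemma taylor3_le f (m : 'cV[R]_n -> R) : times_differentiable 3 f ->
  (forall x v, enorm v <= 1 -> `|derive1n 3 (fun s : R => f (x + s *: v)) 0| <= m x) ->
  forall x z, measurable_fun setT (fun s : R => m (x + s *: z)) ->
  (`|f (x + z) - f x - 'D_z f x - 2^-1 * 'D_z ('D_z f) x|%:E <=
   \int[lebesgue_measure]_(s in `[0%R, 1%R])
     ((1 - s) ^+ 2 / 2 * enorm z ^+ 3 * m (x + s *: z))%:E)%E.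
Proof.
move=> hf fm x z mm.
have [df d2f] := hf.
pose g k (s : R) := iter k (fun g => 'D_z g) f (x + s *: z).
have dg k s : (k < 3)%N -> is_derive s (1 : R) (g k) (g k.+1 s).
  move=> k3; apply: is_derive_along; case: k k3 => [|[|[|//]]] _ //=.
  - by case: (d2f z).
  - by case: (d2f z) => _ /(_ z) [].
(* Error at [x + z] of the second order expansion around [x + s *: z]. *)
pose h (s : R) := f (x + z) - (g 0%N s + (1 - s) * g 1%N s + (1 - s) ^+ 2 / 2 * g 2%N s).
pose h' (s : R) := - ((1 - s) ^+ 2 / 2 * g 3%N s).
have dh s : is_derive s (1 : R) h (h' s).
  exact: (is_derive_taylor_remainder _ (dg 0%N s isT) (dg 1%N s isT) (dg 2%N s isT)).
have h1 : h 1 = 0 by rewrite /h /g /= scale1r; ring.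
have h0 : h 0 = f (x + z) - f x - 'D_z f x - 2^-1 * 'D_z ('D_z f) x.
  by rewrite /h /g /= scale0r addr0; field.
pose b (s : R) := (1 - s) ^+ 2 / 2 * enorm z ^+ 3 * m (x + s *: z).
have h'b s : `|h' s| <= b s.
  rewrite /h' normrN normrM ger0_norm ?divr_ge0 ?sqr_ge0// /b -mulrA.
  by apply: ler_wpM2l; [rewrite divr_ge0 ?sqr_ge0|exact: third_derive_le].
have b0 s : 0 <= b s by exact: le_trans (h'b s).
have mb : measurable_fun (`[0, 1]%classic : set R) b.
  apply: measurable_funTS; apply: measurable_funM => //; apply: measurable_funM => //.
  apply: measurable_funM => //; apply: measurable_funX.
  exact: measurable_funB.
rewrite -h0.
(* The increment bound is one-sided, so the sign of [h 0] decides whether it is applied to [- h] or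
   to [h]. *)
have [h0ge|h0lt] := leP 0 (h 0).
- have -> : `|h 0| = - h 1 - (- h 0) by rewrite ger0_norm// h1; ring.
  apply: (increment_le_integral (h := fun s => - h s) (h' := fun s => - h' s)) => //.
    by move=> s _; apply: le_trans (h'b s); rewrite -normrN ler_norm.
  by move=> s _; exact: b0.
- have -> : `|h 0| = h 1 - h 0 by rewrite ltr0_norm// h1; ring.
  apply: (increment_le_integral (h := h) (h' := h')) => //.
    by move=> s _; apply: le_trans (h'b s); rewrite ler_norm.
  by move=> s _; exact: b0.
Qed.

End taylor.

(** * Integration on column vectors and Gaussian moments *)

Section density.
Local Open Scope ereal_scope.
Context d1 d2 (X : measurableType d1) (Y : measurableType d2) (R : realType).
Variables (mu : {measure set X -> \bar R}) (phi : X -> Y) (k : X -> R).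
Hypothesis mphi : measurable_fun setT phi.
Hypothesis mk : measurable_fun setT k.
Hypothesis k0 : forall x, (0 <= k x)%R.

Import HBNNSimple.

Let mpre C : measurable C -> measurable (phi @^-1` C).
Proof. by move=> mC; rewrite -(setTI (_ @^-1` _)); exact: mphi. Qed.

(** Change of variables and change of density in one statement, by simple functions and monotone
    convergence. The weight [1] transfers laws; the identity for [phi] handles densities. *)
Lemma ge0_integral_density (nu : {measure set Y -> \bar R}) (f : Y -> \bar R) :
  (forall C, measurable C -> nu C = \int[mu]_(x in phi @^-1` C) (k x)%:E) ->
  measurable_fun setT f -> (forall y, 0 <= f y) ->
  \int[nu]_y f y = \int[mu]_x (f (phi x) * (k x)%:E).
Proof.
move=> nuE mf f0.
pose f_ := nnsfun_approx measurableT mf.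
have mkE : measurable_fun setT (fun x => (k x)%:E) by exact/measurable_EFinP.
transitivity (limn (fun n => \int[nu]_y (f_ n y)%:E)).
  rewrite -monotone_convergence//.
  - apply: eq_integral => y _; apply/esym/cvg_lim => //.
    by apply: cvg_nnsfun_approx.
  - by move=> n; exact/measurable_EFinP/measurable_funP.
  - by move=> n y _; rewrite lee_fin.
  - by move=> y _ m n mn; rewrite lee_fin; exact/lefP/nd_nnsfun_approx.
rewrite [X in limn X](_ : _ =
    (fun n => \int[mu]_x ((f_ n (phi x))%:E * (k x)%:E))); last first.
  apply/funext => n.
  transitivity (\sum_(r \in range (f_ n))
      \int[mu]_x ((r * \1_(f_ n @^-1` [set r]) (phi x))%:E * (k x)%:E)).
    under eq_integral do rewrite fimfunE -fsumEFin//.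
    rewrite ge0_integral_fsum//; last 2 first.
    - by move=> y; exact/measurable_EFinP/measurable_funM.
    - by move=> y x _; rewrite nnfun_muleindic_ge0.
    apply: eq_fsbigr => r; rewrite inE => -[y _ <-{r}].
    rewrite integralZl_indic_nnsfun// integral_indic// setIT nuE//.
    rewrite integral_mkcond -ge0_integralZl ?lee_fin//; last 2 first.
    - apply/(measurable_restrictT _ _).1 => //; first exact: mpre.
      exact: measurable_funTS.
    - by move=> x _; rewrite patchE; case: ifPn => // _; rewrite lee_fin.
    apply: eq_integral => x _; rewrite patchE indicE -!EFinM -mulrA.
    have -> : (x \in phi @^-1` (f_ n @^-1` [set f_ n y])) =
        (phi x \in f_ n @^-1` [set f_ n y]) by apply/idP/idP; rewrite !inE.
    by case: ifPn => xr; rewrite ?mul1r ?mul0r ?mulr0 ?[LHS]mule0.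
  rewrite -ge0_integral_fsum//.
  - apply: eq_integral => x _.
    rewrite [in RHS]fimfunE.
    rewrite -fsumEFin// -ge0_mule_fsuml//.
    by move=> r; rewrite nnfun_muleindic_ge0.
  - move=> r; apply: emeasurable_funM => //; apply/measurable_EFinP.
    by apply: measurable_funM => //; apply: measurableT_comp.
  - move=> r x _; apply: mule_ge0; last by rewrite lee_fin.
    by rewrite EFinM; exact: nnfun_muleindic_ge0.
rewrite -monotone_convergence//.
- apply: eq_integral => x _; apply/cvg_lim => //.
  by apply: cvgeMr => //; apply: cvg_nnsfun_approx.
- move=> n; apply: emeasurable_funM => //; apply/measurable_EFinP.
  by apply: measurableT_comp.
- by move=> n x _; rewrite mule_ge0 ?lee_fin.
- move=> x _ m n mn; apply: lee_wpmul2r; first by rewrite lee_fin.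
  by rewrite lee_fin; exact/lefP/nd_nnsfun_approx.
Qed.

(** Pushforward along [phi] of the measure with density [k] with respect to [mu]. As a bundled
    measure it can be compared with another one by uniqueness on rectangles. *)
Definition density_measure (C : set Y) : \bar R :=
  \int[mu]_(x in phi @^-1` C) (k x)%:E.

Let density_measure0 : density_measure set0 = 0.
Proof. by rewrite /density_measure preimage_set0 integral_set0. Qed.

Let density_measure_ge0 C : 0 <= density_measure C.
Proof. by apply: integral_ge0 => x _; rewrite lee_fin. Qed.

Let density_measure_sigma_additive : semi_sigma_additive density_measure.
Proof.
move=> F mF tF mUF; rewrite /density_measure preimage_bigcup.
rewrite ge0_integral_bigcup//=.
- apply: is_cvg_ereal_nneg_natsum_cond => n _ _.
  by apply: integral_ge0 => x _; rewrite lee_fin.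
- by move=> i; exact: mpre.
- by apply: measurable_funTS; exact/measurable_EFinP.
- by move=> x _; rewrite lee_fin.
- apply/trivIsetP => /= i j _ _ ij; rewrite -preimage_setI.
  by move/trivIsetP : tF => /(_ _ _ _ _ ij) ->//; rewrite preimage_set0.
Qed.

HB.instance Definition _ := isMeasure.Build _ _ _ density_measure
  density_measure0 density_measure_ge0 density_measure_sigma_additive.

Definition measure_of_density : {measure set Y -> \bar R} := density_measure.

End density.

Section lebesgue_cV_integral.
Local Open Scope ereal_scope.
Context {R : realType}.

Lemma ge0_integral_cV_cons n (f : 'cV[R]_n.+1 -> \bar R) :
  measurable_fun setT f -> (forall v, 0 <= f v) ->
  \int[lebesgue_cV n.+1]_v f v =
  \int[lebesgue_measure]_x \int[lebesgue_cV n]_v f (cV_cons (x, v)).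
Proof.
move=> mf f0; rewrite /= /lebesgue_step ge0_integral_pushforward//=; last first.
  exact: measurable_cV_cons.
rewrite preimage_setT fubini_tonelli1//.
by apply: measurableT_comp => //; exact: measurable_cV_cons.
Qed.

Lemma measurable_col_map d (T : measurableType d) n (g : 'I_n -> T -> R) :
  (forall i, measurable_fun setT (g i)) ->
  measurable_fun setT (fun x => \col_i g i x : 'cV[R]_n).
Proof.
move=> mg; apply: measurable_fun_matrix => i j.
rewrite (_ : (fun _ => _) = g i)//.
by apply/funext => x; rewrite mxE.
Qed.

(** The measure is built one coordinate at a time, so one-dimensional invariance propagates by
    induction. Translations and sign changes of one coordinate are the two instances. *)
Lemma ge0_integral_cV_map n (tau : 'I_n -> R -> R) (f : 'cV[R]_n -> \bar R) :
  (forall i, measurable_fun setT (tau i)) ->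
  (forall i (g : R -> \bar R), measurable_fun setT g -> (forall x, 0 <= g x) ->
    \int[lebesgue_measure]_x g (tau i x) = \int[lebesgue_measure]_x g x) ->
  measurable_fun setT f -> (forall v, 0 <= f v) ->
  \int[lebesgue_cV n]_v f (\col_i tau i (v i ord0)) = \int[lebesgue_cV n]_v f v.
Proof.
elim: n => [|n ih] in tau f *.
  move=> mtau tauE mf f0; apply: eq_integral => v _; congr f.
  by apply/colP => -[].
move=> mtau tauE mf f0.
have mcoord m (s : 'I_m -> R -> R) : (forall i, measurable_fun setT (s i)) ->
    measurable_fun setT (fun v : 'cV[R]_m => \col_i s i (v i ord0)).
  move=> ms; apply: measurable_col_map => i.
  by apply: (measurableT_comp (ms i)); exact: measurable_entry.
rewrite ge0_integral_cV_cons//; last exact: (measurableT_comp mf (mcoord _ _ mtau)).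
rewrite [RHS](ge0_integral_cV_cons mf f0).
have mcons : measurable_fun setT (fun z : R * 'cV[R]_n => f (cV_cons z)).
  by apply: measurableT_comp => //; exact: measurable_cV_cons.
have mg : measurable_fun setT (fun x : R => \int[lebesgue_cV n]_v f (cV_cons (x, v))).
  exact: (measurable_fun_fubini_tonelli_F (fun z : R * 'cV[R]_n => f (cV_cons z))).
rewrite -(tauE ord0 _ mg); last by move=> x; exact: integral_ge0.
apply: eq_integral => x _.
transitivity (\int[lebesgue_cV n]_v
    f (cV_cons (tau ord0 x, \col_i tau (lift ord0 i) (v i ord0)))).
  apply: eq_integral => v _; congr f; apply/colP => i; rewrite mxE.
  case: (unliftP ord0 i) => [j ->|->]; last by rewrite !cV_cons0.
  by rewrite !cV_consS mxE.
apply: (ih (fun i => tau (lift ord0 i)) (fun v => f (cV_cons (tau ord0 x, v)))) => //.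
- by move=> i; exact: tauE.
- by apply: (measurableT_comp mcons); exact: measurable_fun_pair.
Qed.

Lemma ge0_integral_cV_prod n (g : 'I_n -> R -> R) :
  (forall i, measurable_fun setT (g i)) -> (forall i x, (0 <= g i x)%R) ->
  \int[lebesgue_cV n]_v (\prod_i g i (v i ord0))%:E =
  \prod_(i < n) \int[lebesgue_measure]_x (g i x)%:E.
Proof.
elim: n => [|n ih] in g *.
  move=> mg g0; rewrite big_ord0.
  under eq_integral do rewrite big_ord0.
  by rewrite integral_dirac//= diracT mul1e.
move=> mg g0; rewrite ge0_integral_cV_cons//; last 2 first.
- apply/measurable_EFinP; apply: measurable_prod => i _.
  by apply: (measurableT_comp (mg i)); exact: measurable_entry.
- by move=> v; rewrite lee_fin prodr_ge0.
rewrite big_ord_recl -ih//.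
have mgx i : measurable_fun setT (fun x => (g i x)%:E) by exact/measurable_EFinP.
rewrite -ge0_integralZr//; last 3 first.
- exact: mgx.
- by move=> x _; rewrite lee_fin.
- by apply: integral_ge0 => v _; rewrite lee_fin prodr_ge0.
apply: eq_integral => x _; rewrite -ge0_integralZl//; last 3 first.
- apply/measurable_EFinP; apply: measurable_prod => i _.
  by apply: (measurableT_comp (mg _)); exact: measurable_entry.
- by move=> v _; rewrite lee_fin prodr_ge0.
- by rewrite lee_fin.
apply: eq_integral => v _; rewrite -EFinM big_ord_recl cV_cons0.
by congr (_ * _)%:E; apply: eq_bigr => i _; rewrite cV_consS.
Qed.

Lemma ge0_integral_shift (a : R) (g : R -> \bar R) :
  measurable_fun setT g -> (forall x, 0 <= g x) ->
  \int[lebesgue_measure]_x g (x + a)%R = \int[lebesgue_measure]_x g x.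
Proof.
move=> mg g0.
pose s : measurableTypeR R -> measurableTypeR R := fun x => (x + a)%R.
have ms : measurable_fun setT s by exact: measurable_funD.
have := @ge0_integral_pushforward _ _ _ _ R s ms lebesgue_measure setT g measurableT mg (fun y _ => g0 y).
rewrite preimage_setT => <-.
apply: eq_measure_integral => A mA _.
apply/esym/lebesgue_measure_unique => // _ [[x y]] _ <-.
have sE : s @^-1` `]x, y]%classic = `](x - a)%R, (y - a)%R]%classic.
  by apply/seteqP; split => z /=; rewrite !in_itv/= /s ltrBlDr lerBrDr.
transitivity (lebesgue_measure (s @^-1` `]x, y]%classic)) => //.
rewrite sE !lebesgue_measure_itv/= !lte_fin ltrD2r.
by case: ifP => // _; rewrite -!EFinB; congr EFin; ring.
Qed.

Lemma ge0_integral_opp (g : R -> \bar R) :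
  measurable_fun setT g -> (forall x, 0 <= g x) ->
  \int[lebesgue_measure]_x g (- x)%R = \int[lebesgue_measure]_x g x.
Proof.
move=> mg g0.
pose s : measurableTypeR R -> measurableTypeR R := fun x => (- x)%R.
have ms : measurable_fun setT s by exact: oppr_measurable.
have := @ge0_integral_pushforward _ _ _ _ R s ms lebesgue_measure setT g measurableT mg (fun y _ => g0 y).
rewrite preimage_setT => <-.
by apply: eq_measure_integral => A mA _; exact: lebesgue_measureN.
Qed.

Lemma ge0_integral_cV_shift n (a : 'cV[R]_n) (f : 'cV[R]_n -> \bar R) :
  measurable_fun setT f -> (forall v, 0 <= f v) ->
  \int[lebesgue_cV n]_v f (v + a)%R = \int[lebesgue_cV n]_v f v.
Proof.
move=> mf f0.
transitivity (\int[lebesgue_cV n]_v f (\col_i (v i ord0 + a i ord0)%R)).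
  by apply: eq_integral => v _; congr f; apply/colP => i; rewrite !mxE.
apply: (@ge0_integral_cV_map _ (fun i x => x + a i ord0)%R) => //.
- by move=> i; exact: measurable_funD.
- by move=> i g mg g0; exact: ge0_integral_shift.
Qed.

Definition flip_cV n (k : 'I_n) (v : 'cV[R]_n) : 'cV[R]_n :=
  \col_i (if i == k then - v i ord0 else v i ord0)%R.

Lemma ge0_integral_cV_flip n (k : 'I_n) (f : 'cV[R]_n -> \bar R) :
  measurable_fun setT f -> (forall v, 0 <= f v) ->
  \int[lebesgue_cV n]_v f (flip_cV k v) = \int[lebesgue_cV n]_v f v.
Proof.
move=> mf f0.
apply: (@ge0_integral_cV_map _ (fun i x => if i == k then - x else x)%R) => // i.
- by case: eqP => _ //; exact: oppr_measurable.
- by move=> g mg g0; case: eqP => _ //; exact: ge0_integral_opp.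
Qed.

(** The flip exchanges the positive and the negative part, whose integrals are then equal;
    integrability makes them finite, so they cancel. *)
Lemma integral_cV_odd n (k : 'I_n) (f : 'cV[R]_n -> R) :
  (lebesgue_cV n).-integrable setT (EFin \o f) ->
  (forall v, f (flip_cV k v) = - f v)%R ->
  \int[lebesgue_cV n]_v (f v)%:E = 0.
Proof.
move=> fi fodd; have mf := measurable_int _ fi.
rewrite integralE -[X in _ - X](ge0_integral_cV_flip k)//; last first.
  exact: measurable_funeneg.
rewrite (_ : \int[_]_v _ (flip_cV k v) = \int[lebesgue_cV n]_v ((EFin \o f)^\+ v)).
  by rewrite subee//; exact: integrable_pos_fin_num.
by apply: eq_integral => v _; rewrite funenegE funeposE fodd EFinN oppeK.
Qed.

End lebesgue_cV_integral.

(** * Even moments of the centred normal law *)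

Section normal_moments.
Context {R : realType}.
Variables (s : R).
Hypothesis s0 : s != 0.

Let phi := normal_pdf 0 s.

Let phiE x : phi x = normal_peak s * expR (- (s ^+ 2 *+ 2)^-1 * x ^+ 2).
Proof.
by rewrite /phi normal_pdfE// /normal_fun subr0 mulNr mulNr [X in - X]mulrC.
Qed.

Let is_derive_pow_normal (k : nat) (x : R) :
  is_derive x (1 : R) (fun x : R => x ^+ k.+1 * phi x)
    (k.+1%:R * (x ^+ k * phi x) - x ^+ k.+2 * phi x / s ^+ 2).
Proof.
have dphi : is_derive x (1 : R) phi (- x / s ^+ 2 * phi x).
  have -> : phi = (fun x => normal_peak s * expR (- (s ^+ 2 *+ 2)^-1 * x ^+ 2)).
    by apply/funext => y; rewrite phiE.
  apply: is_derive_eq.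
  rewrite /GRing.scale/= !mulr1; field.
  exact: s0.
have dp : is_derive x (1 : R) (fun x : R => x ^+ k.+1) (k.+1%:R * x ^+ k).
  have -> : (fun x : R => x ^+ k.+1) = (@id R) ^+ k.+1.
    by apply/funext => y; rewrite exprfctE.
  by apply: is_derive_eq; rewrite /GRing.scale/= !mulr1.
apply: (is_derive_eq (is_deriveM dp dphi)).
rewrite /GRing.scale/= !exprS; field.
exact: s0.
Qed.

Let continuous_pow_normal (k : nat) : continuous (fun x : R => x ^+ k * phi x).
Proof.
move=> x; apply: cvgM; first exact: exprn_continuous.
exact: continuous_normal_pdf.
Qed.

Let pow_normal_cvg0 (k : nat) :
  (n.+1%:R : R) ^+ k.+1 * phi n.+1%:R @[n --> \oo] --> (0 : R).
Proof.
(* From [expR y >= y ^+ k.+1 / k.+1!] at [y = x ^+ 2 / (2 * s ^+ 2)]: the boundary term is at most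
   [C / x ^+ k.+1], hence at most [C / x] for [x >= 1]. *)
pose C : R := normal_peak s * (k.+1)`!%:R * (s ^+ 2 *+ 2) ^+ k.+1.
have s20 : 0 < s ^+ 2 *+ 2 by rewrite pmulrn_lgt0// exprn_even_gt0.
apply: (@squeeze_cvgr _ _ _ _ (fun=> 0) (fun n : nat => C * (n.+1%:R)^-1)); last 2 first.
- exact: cvg_cst.
- rewrite -[X in _ --> X](mulr0 C); apply: cvgMr.
  exact: cvg_harmonic.
apply: nearW => n; apply/andP; split.
  by rewrite mulr_ge0 ?exprn_ge0// normal_pdf_ge0.
set x : R := n.+1%:R.
have x0 : 0 < x by rewrite ltr0n.
have x1 : 1 <= x by rewrite ler1n.
rewrite phiE mulNr expRN.
have y0 : 0 < (s ^+ 2 *+ 2)^-1 * x ^+ 2 by rewrite mulr_gt0 ?invr_gt0 ?exprn_gt0.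
have := expR_ge1Dxn k (ltW y0).
set y := _ * x ^+ 2 => hy.
have yk : y ^+ k.+1 / (k.+1)`!%:R <= expR y by apply: le_trans hy; rewrite lerDr.
have f0 : 0 < (k.+1)`!%:R :> R by rewrite ltr0n fact_gt0.
have yk0 : 0 < y ^+ k.+1 / (k.+1)`!%:R by rewrite divr_gt0 ?exprn_gt0.
have /le_trans : x ^+ k.+1 * (normal_peak s * (expR y)^-1) <=
    x ^+ k.+1 * (normal_peak s * (y ^+ k.+1 / (k.+1)`!%:R)^-1).
  rewrite ler_wpM2l ?exprn_ge0 ?(ltW x0)// ler_wpM2l ?normal_peak_ge0//.
  by rewrite lef_pV2// ?posrE// expR_gt0.
apply.
have -> : x ^+ k.+1 * (normal_peak s * (y ^+ k.+1 / (k.+1)`!%:R)^-1) = C * (x ^+ k.+1)^-1.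
  rewrite /C /y exprMn -exprM mulnC exprM exprVn invf_div.
  field; rewrite ?expf_neq0 ?gt_eqF//.
apply: ler_wpM2l.
  by rewrite !mulr_ge0 ?normal_peak_ge0// exprn_ge0// ltW.
rewrite lef_pV2 ?posrE ?exprn_gt0//.
by rewrite exprS ler_peMr ?(ltW x0)// exprn_ege1.
Qed.

(** Integration by parts on symmetric intervals: the derivative of [x ^+ k.+1 * phi x] combines the
    two moments, and the boundary terms tend to 0. For even [k] the integrands are nonnegative, so
    the truncated integrals converge monotonically, and finiteness of the higher moment is part of
    the conclusion. *)
Lemma normal_moment_step (k : nat) (A : R) : ~~ odd k ->
  (\int[lebesgue_measure]_x (x ^+ k * normal_pdf 0 s x)%:E = A%:E)%E ->
  (\int[lebesgue_measure]_x (x ^+ k.+2 * normal_pdf 0 s x)%:E =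
    (s ^+ 2 * k.+1%:R * A)%:E)%E.
Proof.
move=> ek Ak.
(* The successor keeps the interval nondegenerate, as the fundamental theorem of calculus
   requires. *)
pose I (n : nat) : set R := `[- n.+1%:R, n.+1%:R]%classic.
have pow0 m (x : R) : ~~ odd m -> 0 <= x ^+ m * phi x.
  by move=> em; rewrite mulr_ge0 ?exprn_even_ge0 ?normal_pdf_ge0.
have mI n : measurable (I n) by exact: measurable_itv.
have mpow m : measurable_fun setT (fun x : R => (x ^+ m * phi x)%:E).
  apply/measurable_EFinP; exact: continuous_measurable_fun.
have UI : \bigcup_n I n = setT.
  apply/seteqP; split => // x _; exists (Num.truncn `|x|) => //.
  rewrite /I /= in_itv/= -ler_norml ltW//.
  by have /andP[] := truncn_itv (normr_ge0 x).
have cvgI m : ~~ odd m ->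
   (\int[lebesgue_measure]_(x in I n) (x ^+ m * phi x)%:E @[n --> \oo] -->
    \int[lebesgue_measure]_x (x ^+ m * phi x)%:E)%E.
  move=> em; rewrite -UI; apply: ge0_nondecreasing_set_cvg_integral => //.
  - move=> a b ab; apply/subsetPset => x; rewrite /I /= !in_itv/= -!ler_norml.
    by move=> /le_trans; apply; rewrite ler_nat ltnS.
  - by move=> i; exact: (measurable_funTS (mpow m)).
  - by move=> i x _; rewrite lee_fin pow0.
pose fI m n := fine (\int[lebesgue_measure]_(x in I n) (x ^+ m * phi x)%:E)%E.
have intI m n : lebesgue_measure.-integrable (I n) (fun x : R => (x ^+ m * phi x)%:E).
  apply: continuous_compact_integrable; first exact: segment_compact.
  by apply: continuous_subspaceT; exact: continuous_pow_normal.
have finI m n : (\int[lebesgue_measure]_(x in I n) (x ^+ m * phi x)%:E = (fI m n)%:E)%E.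
  by rewrite fineK//; apply: (integrable_fin_num _ (intI m n)); exact: mI.
have FTC n : k.+1%:R * fI k n - s ^- 2 * fI k.+2 n = 2 * (n.+1%:R ^+ k.+1 * phi n.+1%:R).
  apply: EFin_inj.
  rewrite EFinB (EFinM k.+1%:R) (EFinM (s ^- 2)) -!finI.
  have nn : - n.+1%:R < n.+1%:R :> R.
    have : 0 < n.+1%:R :> R by rewrite ltr0n.
    by lra.
  pose g (x : R) := k.+1%:R * (x ^+ k * phi x) - x ^+ k.+2 * phi x / s ^+ 2.
  pose F (x : R) := x ^+ k.+1 * phi x.
  have cg : continuous g.
    move=> x; apply: cvgB; first by apply: cvgMr; exact: continuous_pow_normal.
    by apply: cvgMl; exact: continuous_pow_normal.
  have FT : (\int[lebesgue_measure]_(x in I n) (g x)%:E = (F n.+1%:R)%:E - (F (- n.+1%:R))%:E)%E.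
    apply: continuous_FTC2 => //.
    - exact: continuous_subspaceT.
    - split => [x _||].
      + by case: (is_derive_pow_normal k x).
      + by apply: cvg_at_right_filter; exact: continuous_pow_normal.
      + by apply: cvg_at_left_filter; exact: continuous_pow_normal.
    - by move=> x _; rewrite derive1E; have := is_derive_pow_normal k x => h; rewrite derive_val.
  have FN : F (- n.+1%:R) = - F n.+1%:R.
    rewrite /F exprNn -signr_odd /= (negbTE ek) /= expr1 mulN1r !mulNr !phiE.
    by rewrite sqrrN.
  have -> : (k.+1%:R%:E * \int[lebesgue_measure]_(x in I n) (x ^+ k * phi x)%:E -
      (s ^- 2)%:E * \int[lebesgue_measure]_(x in I n) (x ^+ k.+2 * phi x)%:E =
      \int[lebesgue_measure]_(x in I n) (g x)%:E)%E.
    have mI' : @measurable _ (measurableTypeR R) (I n) by exact: mI.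
    rewrite -(integralZl mI' (intI k n)) -(integralZl mI' (intI k.+2 n)).
    rewrite -(integralB mI' (integrableZl mI' _ (intI k n)) (integrableZl mI' _ (intI k.+2 n))).
    by apply: eq_integral => x _; rewrite -!EFinM -EFinB /g [X in _ - X]mulrC.
  rewrite FT FN -EFinB; congr EFin; rewrite /F; ring.
have B : (\int[lebesgue_measure]_(x in I n) (x ^+ k.+2 * phi x)%:E @[n --> \oo] -->
    (s ^+ 2 * k.+1%:R * A)%:E)%E.
  have -> : (fun n => \int[lebesgue_measure]_(x in I n) (x ^+ k.+2 * phi x)%:E)%E =
      (fun n => (s ^+ 2 * (k.+1%:R * fI k n - 2 * (n.+1%:R ^+ k.+1 * phi n.+1%:R)))%:E).
    apply/funext => n; rewrite finI -FTC; congr EFin; field.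
    exact: s0.
  apply: cvg_EFin; first exact: nearW.
  rewrite -[X in _ --> X]mulrA; apply: cvgMr.
  rewrite -[X in _ --> X]subr0 -[X in _ --> _ - X](mulr0 2); apply: cvgB; apply: cvgMr => //.
  have := cvgI k ek; rewrite Ak => /fine_cvg; exact.
apply: (cvg_unique _ (cvgI k.+2 _) B).
  exact: ereal_hausdorff.
by rewrite /= negbK.
Qed.

End normal_moments.

(** * Size and moments of the Gaussian kernel *)

Section gauss_kernel_integrals.
Context {R : realType} {N : nat}.
Variables (H : R) (c : 'I_N -> R).
Hypotheses (hH : 0 < H) (hc : forall i, 0 < c i).
Local Notation K := (gauss_kernel H c).
Local Notation leb := (lebesgue_cV N).

Let sg i := Num.sqrt H * c i.

Let sg0 i : sg i != 0.
Proof. by rewrite gt_eqF// mulr_gt0// sqrtr_gt0. Qed.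

Let sg2 i : sg i ^+ 2 = H * c i ^+ 2.
Proof. by rewrite exprMn sqr_sqrtr// ltW. Qed.

(** The coordinates are independent normals with standard deviations [sg i], so even moments of one
    coordinate reduce to one-dimensional ones. *)
Lemma gauss_kernelE x : K x = \prod_i normal_pdf 0 (sg i) (x i ord0).
Proof.
rewrite /gauss_kernel -sumrN expR_sum -big_split/=; apply: eq_bigr => i _.
rewrite normal_pdfE// /normal_fun subr0 /normal_peak sg2; congr (_ * expR _).
  rewrite powRN powR12_sqrt; last first.
    by rewrite !mulr_ge0 ?pi_ge0 ?exprn_ge0 ?(ltW hH) ?(ltW (hc i)).
  by congr (Num.sqrt _)^-1; rewrite -mulr_natl; ring.
by rewrite mulNr -[H * _ *+ 2]mulr_natl mulrA.
Qed.

Lemma gauss_kernel_ge0 x : 0 <= K x.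
Proof. by rewrite gauss_kernelE; apply: prodr_ge0 => i _; exact: normal_pdf_ge0. Qed.

Lemma measurable_gauss_kernel : measurable_fun setT K.
Proof.
rewrite (_ : K = fun x => \prod_i normal_pdf 0 (sg i) (x i ord0)); last first.
  by apply/funext => x; rewrite gauss_kernelE.
apply: measurable_prod => i _.
by apply: (measurableT_comp (measurable_normal_pdf _ _)); exact: measurable_entry.
Qed.

(** The maximum has [2 * pi] in place of [pi]; the weaker bound is the kernel factor of the
    announced variance estimate. *)
Lemma gauss_kernel_le x : K x <= (\prod_i (pi * H * c i ^+ 2)) `^ (- 2^-1).
Proof.
have p0 i : 0 < pi * H * c i ^+ 2 :> R by rewrite !mulr_gt0 ?pi_gt0 ?exprn_gt0.
rewrite powRN powR12_sqrt ?prodr_ge0// => [|i _]; last exact: ltW.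
have -> : (Num.sqrt (\prod_i (pi * H * c i ^+ 2)))^-1 =
    \prod_i (Num.sqrt (pi * H * c i ^+ 2))^-1.
  rewrite prodfV; congr (_^-1).
  suff [] : 0 <= \prod_i (pi * H * c i ^+ 2) /\ Num.sqrt (\prod_i (pi * H * c i ^+ 2)) =
      \prod_i Num.sqrt (pi * H * c i ^+ 2) by [].
  apply: (big_rec2 (fun a b : R => 0 <= b /\ Num.sqrt b = a)).
    by rewrite ler01 sqrtr1.
  by move=> i a b _ [b0 <-]; rewrite sqrtrM ?(ltW (p0 i))// (mulr_ge0 (ltW (p0 i)) b0).
rewrite gauss_kernelE; apply: ler_prod => i _; rewrite normal_pdf_ge0/=.
apply: (le_trans (normal_pdf_ub _ _ (sg0 i))).
rewrite /normal_peak sg2 lef_pV2 ?posrE ?sqrtr_gt0//; last first.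
  by rewrite pmulrn_lgt0// mulr_gt0// ?pi_gt0// mulr_gt0// exprn_gt0.
rewrite ler_sqrt; last first.
  by rewrite pmulrn_lge0// mulr_ge0// ?pi_ge0// mulr_ge0 ?exprn_ge0 ?ltW.
by rewrite -mulr_natl; have := p0 i; lra.
Qed.

Lemma gauss_kernelN x : K (- x) = K x.
Proof.
rewrite /gauss_kernel; congr (_ * expR (- _)); apply: eq_bigr => i _.
by rewrite mxE sqrrN.
Qed.

Lemma gauss_kernel_flip k x : K (flip_cV k x) = K x.
Proof.
rewrite /gauss_kernel; congr (_ * expR (- _)); apply: eq_bigr => i _.
by rewrite mxE; case: eqP => // _; rewrite sqrrN.
Qed.

(** An even power keeps each factor nonnegative, as the product formula for integrals demands; the
    other coordinates contribute total mass 1. *)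
Let gauss_kernel_even_moment i k : ~~ odd k ->
  (\int[leb]_x (x i ord0 ^+ k * K x)%:E =
   \int[lebesgue_measure]_y (y ^+ k * normal_pdf 0 (sg i) y)%:E)%E.
Proof.
move=> ek.
pose g j (y : R) := if j == i then y ^+ k * normal_pdf 0 (sg i) y else normal_pdf 0 (sg j) y.
transitivity (\int[leb]_x (\prod_j g j (x j ord0))%:E)%E.
  apply: eq_integral => x _; congr EFin.
  rewrite gauss_kernelE (bigD1 i)//= [RHS](bigD1 i)//= /g eqxx mulrA; congr (_ * _).
  by apply: eq_bigr => j /negbTE ->.
rewrite ge0_integral_cV_prod; last 2 first.
- move=> j; rewrite /g; case: eqP => _; last exact: measurable_normal_pdf.
  by apply: measurable_funM; [exact: exprn_measurable|exact: measurable_normal_pdf].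
- move=> j x; rewrite /g; case: eqP => _; last exact: normal_pdf_ge0.
  by rewrite mulr_ge0 ?exprn_even_ge0 ?normal_pdf_ge0.
rewrite (bigD1 i)//= big1 ?mule1; last first.
  by move=> j /negbTE ji; rewrite /g ji; exact: integral_normal_pdf.
by rewrite /g eqxx.
Qed.

Lemma integral_gauss_kernel : (\int[leb]_x (K x)%:E = 1)%E.
Proof.
under eq_integral do rewrite gauss_kernelE.
rewrite (@ge0_integral_cV_prod _ _ (fun i => normal_pdf 0 (sg i))); last 2 first.
- by move=> i; exact: measurable_normal_pdf.
- by move=> i x; exact: normal_pdf_ge0.
by rewrite big1// => i _; exact: integral_normal_pdf.
Qed.

Lemma gauss_kernel_moment2 i :
  (\int[leb]_x (x i ord0 ^+ 2 * K x)%:E = (H * c i ^+ 2)%:E)%E.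
Proof.
rewrite gauss_kernel_even_moment//.
rewrite (normal_moment_step (sg0 i) (A := 1))// ?mulr1 ?sg2//.
by under eq_integral do rewrite mul1r; exact: integral_normal_pdf.
Qed.

Lemma gauss_kernel_moment4 i :
  (\int[leb]_x (x i ord0 ^+ 4 * K x)%:E = (3 * (H * c i ^+ 2) ^+ 2)%:E)%E.
Proof.
rewrite gauss_kernel_even_moment//.
rewrite (normal_moment_step (sg0 i) (A := H * c i ^+ 2))//.
  by congr EFin; rewrite sg2; ring.
by rewrite -gauss_kernel_even_moment// gauss_kernel_moment2.
Qed.

Lemma integrable_gauss_kernel : leb.-integrable setT (EFin \o K).
Proof.
apply/integrableP; split; first by apply/measurable_EFinP; exact: measurable_gauss_kernel.
under eq_integral do rewrite /= ger0_norm ?gauss_kernel_ge0//.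
by rewrite integral_gauss_kernel ltry.
Qed.

Let integrable_pow i k : ~~ odd k ->
  (\int[leb]_x (x i ord0 ^+ k * K x)%:E < +oo)%E ->
  leb.-integrable setT (fun x => (x i ord0 ^+ k * K x)%:E).
Proof.
move=> ek fin; apply/integrableP; split.
  apply/measurable_EFinP; apply: measurable_funM; last exact: measurable_gauss_kernel.
  by apply: measurable_funX; exact: measurable_entry.
rewrite (eq_integral (fun x : 'cV[R]_N => (x i ord0 ^+ k * K x)%:E))// => x _.
by rewrite /= ger0_norm// mulr_ge0 ?exprn_even_ge0 ?gauss_kernel_ge0.
Qed.

Lemma integrable_gauss_kernel_mul i j :
  leb.-integrable setT (fun x => (x i ord0 * x j ord0 * K x)%:E).
Proof.
have i2 k : leb.-integrable setT (fun x => (x k ord0 ^+ 2 * K x)%:E).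
  by apply: integrable_pow => //; rewrite gauss_kernel_moment2 ltry.
(* The product of two coordinates is dominated by the sum of their squares. *)
apply: (le_integrable measurableT _ _ (integrableD measurableT (i2 i) (i2 j))).
  apply/measurable_EFinP; apply: measurable_funM; last exact: measurable_gauss_kernel.
  by apply: measurable_funM; exact: measurable_entry.
move=> x _; rewrite /= lee_fin normrM [leRHS]ger0_norm; last first.
  by rewrite addr_ge0// mulr_ge0 ?sqr_ge0 ?gauss_kernel_ge0.
rewrite (ger0_norm (gauss_kernel_ge0 x)) -mulrDl ler_wpM2r ?gauss_kernel_ge0//.
rewrite normrM -(real_normK (num_real (x i ord0))) -(real_normK (num_real (x j ord0))).
have := normr_ge0 (x i ord0); have := normr_ge0 (x j ord0).
by move: `|_| `|_| => a b a0 b0; nra.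
Qed.

Lemma integrable_gauss_kernel_coord i :
  leb.-integrable setT (fun x => (x i ord0 * K x)%:E).
Proof.
have i2 : leb.-integrable setT (fun x => (x i ord0 ^+ 2 * K x)%:E).
  by apply: integrable_pow => //; rewrite gauss_kernel_moment2 ltry.
(* Domination by [a ^+ 2 + 1], with [a] the absolute value of the coordinate. *)
apply: (le_integrable measurableT _ _ (integrableD measurableT i2 integrable_gauss_kernel)).
  apply/measurable_EFinP; apply: measurable_funM; last exact: measurable_gauss_kernel.
  exact: measurable_entry.
move=> x _; rewrite /= lee_fin normrM [leRHS]ger0_norm; last first.
  by rewrite addr_ge0 ?gauss_kernel_ge0// mulr_ge0 ?sqr_ge0 ?gauss_kernel_ge0.
rewrite (ger0_norm (gauss_kernel_ge0 x)) -[X in _ + X]mul1r -mulrDl.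
rewrite ler_wpM2r ?gauss_kernel_ge0// -(real_normK (num_real (x i ord0))).
by have := normr_ge0 (x i ord0); move: `|_| => a a0; nra.
Qed.

Lemma integral_gauss_kernel_coord i : (\int[leb]_x (x i ord0 * K x)%:E = 0)%E.
Proof.
apply: (integral_cV_odd (k := i)); first exact: integrable_gauss_kernel_coord.
by move=> x; rewrite gauss_kernel_flip mxE eqxx mulNr.
Qed.

Lemma integral_gauss_kernel_mul i j : i != j ->
  (\int[leb]_x (x i ord0 * x j ord0 * K x)%:E = 0)%E.
Proof.
move=> ij.
apply: (integral_cV_odd (k := i)); first exact: integrable_gauss_kernel_mul.
by move=> x; rewrite gauss_kernel_flip !mxE eqxx eq_sym (negbTE ij) !mulNr.
Qed.

End gauss_kernel_integrals.

(** * Bias of kernel smoothing *)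

Section cauchy_schwarz.
Local Open Scope ereal_scope.
Context d (T : measurableType d) (R : realType) (mu : {measure set T -> \bar R}).

Let poweR2 (u : \bar R) : 0 <= u -> u `^ 2 = u * u.
Proof.
case: u => [r| |]//; last by move=> _; rewrite mulyy poweRyr.
by rewrite lee_fin => r0; rewrite poweR_EFin powR_mulrn// expr2 EFinM.
Qed.

(** Hoelder's inequality with both exponents 2, multiplied by itself: in this form infinite
    integrals are covered without square roots. *)
Lemma cauchy_schwarz_integral (f g : T -> R) :
  measurable_fun setT f -> measurable_fun setT g ->
  (forall x, (0 <= f x)%R) -> (forall x, (0 <= g x)%R) ->
  (\int[mu]_x (f x * g x)%:E) * (\int[mu]_x (f x * g x)%:E) <=
  \int[mu]_x ((f x) ^+ 2)%:E * \int[mu]_x ((g x) ^+ 2)%:E.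
Proof.
move=> mf mg f0 g0.
have half2 : (2^-1 + 2^-1 = 1 :> R)%R by field.
have := hoelder mu mf mg (ltr0Sn _ 1) (ltr0Sn _ 1) half2; rewrite Lnorm1.
have -> : \int[mu]_x `|(EFin \o (f \* g)%R) x| = \int[mu]_x (f x * g x)%:E.
  by apply: eq_integral => x _; rewrite /= ger0_norm// mulr_ge0.
have NE (h : T -> R) : (forall x, (0 <= h x)%R) ->
    'N[mu]_2%:E[EFin \o h] * 'N[mu]_2%:E[EFin \o h] = \int[mu]_x ((h x) ^+ 2)%:E.
  move=> h0; rewrite -poweR2 ?Lnorm_ge0// powR_Lnorm//.
  by apply: eq_integral => x _; rewrite /= ger0_norm// powR_mulrn.
rewrite -(NE f)// -(NE g)// => fg.
have fg0 : 0 <= \int[mu]_x (f x * g x)%:E.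
  by apply: integral_ge0 => x _; rewrite lee_fin mulr_ge0.
rewrite muleACA.
by apply: lee_pmul.
Qed.

End cauchy_schwarz.

Section smoothing_bias.
Context {R : realType} {N : nat}.
Variables (H : R) (c : 'I_N -> R).
Hypotheses (hH : 0 < H) (hc : forall i, 0 < c i).
Local Notation K := (gauss_kernel H c).
Local Notation leb := (lebesgue_cV N).
Local Notation e_ i := (delta_mx i ord0 : 'cV[R]_N).

(** Linear and off-diagonal terms are odd in some coordinate and vanish; the diagonal ones give the
    second moments [H * c i ^+ 2]. *)
Lemma integral_gauss_kernel_quadratic (a : R) (b : 'I_N -> R) (q : 'I_N -> 'I_N -> R) :
  let F z := K z * (a + \sum_i z i ord0 * b i +
    2^-1 * \sum_i \sum_j z i ord0 * z j ord0 * q i j) in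
  leb.-integrable setT (EFin \o F) /\
  (\int[leb]_z (F z)%:E = (a + H / 2 * \sum_i c i ^+ 2 * q i i)%:E)%E.
Proof.
move=> F.
have FE : EFin \o F = (fun z => a%:E * (K z)%:E + \sum_i ((b i)%:E * (z i ord0 * K z)%:E) +
    \sum_i \sum_j ((2^-1 * q i j)%:E * (z i ord0 * z j ord0 * K z)%:E))%E.
  apply/funext => z /=; rewrite -!EFinM sumEFin.
  under [X in (_ + X)%E]eq_bigr do rewrite sumEFin.
  rewrite sumEFin -!EFinD; congr EFin.
  rewrite /F !mulrDr; congr (_ + _ + _); first exact: mulrC.
    by rewrite mulr_sumr; apply: eq_bigr => i _; ring.
  rewrite mulrA mulr_sumr; apply: eq_bigr => i _.
  by rewrite mulr_sumr; apply: eq_bigr => j _; ring.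
have i0 : leb.-integrable setT (fun z => a%:E * (K z)%:E)%E.
  by apply: integrableZl => //; exact: integrable_gauss_kernel.
have i1' i : leb.-integrable setT (fun z => (b i)%:E * (z i ord0 * K z)%:E)%E.
  by apply: integrableZl => //; exact: integrable_gauss_kernel_coord.
have i1 : leb.-integrable setT (fun z => \sum_i ((b i)%:E * (z i ord0 * K z)%:E))%E.
  exact: integrable_sum.
have i2'' i j : leb.-integrable setT
    (fun z => (2^-1 * q i j)%:E * (z i ord0 * z j ord0 * K z)%:E)%E.
  by apply: integrableZl => //; exact: integrable_gauss_kernel_mul.
have i2' i : leb.-integrable setT
    (fun z => \sum_j ((2^-1 * q i j)%:E * (z i ord0 * z j ord0 * K z)%:E))%E.
  exact: integrable_sum.
have i2 : leb.-integrable setT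
    (fun z => \sum_i \sum_j ((2^-1 * q i j)%:E * (z i ord0 * z j ord0 * K z)%:E))%E.
  exact: integrable_sum.
have i01 := integrableD measurableT i0 i1.
split; first by rewrite FE; exact: (integrableD measurableT i01 i2).
transitivity (\int[leb]_z (EFin \o F) z)%E => //; rewrite FE.
rewrite (integralD measurableT i01 i2) (integralD measurableT i0 i1).
rewrite integralZl//; last exact: integrable_gauss_kernel.
rewrite integral_gauss_kernel// mule1 integral_sum//.
rewrite big1 ?adde0; last first.
  move=> i _; rewrite integralZl//; last exact: integrable_gauss_kernel_coord.
  by rewrite integral_gauss_kernel_coord// mule0.
rewrite EFinD; congr (_ + _)%E; rewrite integral_sum// mulr_sumr -sumEFin.
apply: eq_bigr => i _; rewrite integral_sum// (bigD1 i)//= big1 ?adde0; last first.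
  move=> j ji; rewrite integralZl//; last exact: integrable_gauss_kernel_mul.
  by rewrite integral_gauss_kernel_mul ?mule0// eq_sym.
rewrite integralZl//; last exact: integrable_gauss_kernel_mul.
under eq_integral do rewrite -expr2.
by rewrite gauss_kernel_moment2// -EFinM; congr EFin; field.
Qed.

Lemma enorm0 n : enorm (0 : 'cV[R]_n) = 0.
Proof.
rewrite /enorm /frob2 big1 ?sqrtr0// => i _.
by rewrite big1// => j _; rewrite mxE expr0n.
Qed.

(** The indicator turns the weight of the Taylor remainder into a function on the whole line, so
    that [(z, s)] can be integrated against a product measure. *)
Definition taylor_weight (s : R) : R := \1_(`[0, 1]%classic : set R) s * ((1 - s) ^+ 2 / 2).

Lemma measurable_taylor_weight : measurable_fun setT taylor_weight.
Proof.
apply: measurable_funM; first exact: measurable_indic.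
by apply: measurable_funM => //; apply: measurable_funX; exact: measurable_funB.
Qed.

Lemma taylor_weight_ge0 s : 0 <= taylor_weight s.
Proof. by rewrite mulr_ge0// divr_ge0// sqr_ge0. Qed.

Lemma integral_taylor_weight :
  (\int[lebesgue_measure]_s (taylor_weight s)%:E = (6^-1)%:E)%E.
Proof.
pose F (s : R) : R := - (1 - s) ^+ 3 / 6.
have dF (s : R) : is_derive s (1 : R) F ((1 - s) ^+ 2 / 2).
  by apply: is_derive_eq; rewrite /GRing.scale/=; field.
have cF : continuous F.
  move=> s; apply: differentiable_continuous; apply/derivable1_diffP.
  by case: (dF s).
have <- : (\int[@lebesgue_measure R]_(s in `[0%R, 1%R]) ((1 - s) ^+ 2 / 2)%:E = (6^-1)%:E)%E.
  rewrite (@continuous_FTC2 _ _ F)//.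
  - by rewrite -EFinB /F; congr EFin; field.
  - apply: continuous_subspaceT => s; apply: cvgMl.
    apply: (@continuous_comp _ _ _ (fun s : R => 1 - s) (fun s : R => s ^+ 2)).
      by apply: cvgB; [exact: cvg_cst|exact: cvg_id].
    exact: exprn_continuous.
  - split => [s _||].
    + by case: (dF s).
    + by apply: cvg_at_right_filter; exact: cF.
    + by apply: cvg_at_left_filter; exact: cF.
  - by move=> s _; rewrite derive1E; have h := dF s; rewrite derive_val.
rewrite [RHS]integral_mkcond; apply: eq_integral => s _.
rewrite patchE /taylor_weight indicE; case: ifPn => _; by rewrite ?mul1r ?mul0r.
Qed.

Lemma measurable_enorm n : measurable_fun setT (@enorm R n).
Proof.
have ms : measurable_fun setT (@Num.sqrt R).
  by apply: continuous_measurable_fun; exact: sqrt_continuous.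
suff mf : measurable_fun setT (@frob2 R n 1) by exact: (measurableT_comp ms mf).
apply: measurable_sum => i; apply: measurable_sum => j.
by apply: measurable_funX; exact: measurable_entry.
Qed.

Lemma measurable_ray d (T : measurableType d) n (a b : T -> 'cV[R]_n) (s : T -> R) :
  measurable_fun setT a -> measurable_fun setT b -> measurable_fun setT s ->
  measurable_fun setT (fun t => a t + s t *: b t).
Proof.
move=> ma mb ms; apply: measurable_fun_matrix => i j.
rewrite (_ : (fun _ => _) = (fun t => a t i j + s t * b t i j)); last first.
  by apply/funext => t; rewrite !mxE.
apply: measurable_funD; first exact: (measurableT_comp (measurable_entry i j) ma).
apply: measurable_funM => //; exact: (measurableT_comp (measurable_entry i j) mb).
Qed.

Lemma measurable_cV_add d (T : measurableType d) n (a b : T -> 'cV[R]_n) :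
  measurable_fun setT a -> measurable_fun setT b ->
  measurable_fun setT (fun t => a t + b t).
Proof.
move=> ma mb; rewrite (_ : (fun _ => _) = (fun t => a t + 1 *: b t)).
  exact: measurable_ray.
by apply/funext => t; rewrite scale1r.
Qed.

(** Pointwise bias: Taylor's formula is integrated against [K], and the finite smoothed value minus
    the integral of the quadratic polynomial is the integral of the remainder. The remainder bound
    stays an integral over [(z, s)], possibly infinite. *)
Lemma smoothing_bias_le (f m : 'cV[R]_N -> R) (x : 'cV[R]_N) :
  measurable_fun setT f -> (forall v, 0 <= f v) -> times_differentiable 3 f ->
  measurable_fun setT m ->
  (forall x v, enorm v <= 1 -> `|derive1n 3 (fun s : R => f (x + s *: v)) 0| <= m x) ->
  (\int[leb]_z (K z * f (x + z)%R)%:E < +oo)%E ->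
  (`|f x - fine (\int[leb]_z (K z * f (x + z)%R)%:E)|%:E <=
   (H / 2 * `|\sum_i c i ^+ 2 * 'D_(e_ i) ('D_(e_ i) f) x|)%:E +
   \int[leb \x lebesgue_measure]_u (K u.1 * taylor_weight u.2 *
     (enorm u.1 ^+ 3 * m (x + u.2 *: u.1)%R))%:E)%E.
Proof.
move=> mf f0 hf mm fm qfin.
pose b i := 'D_(e_ i) f x.
pose q i j := 'D_(e_ i) ('D_(e_ j) f) x.
have [iP IP] := integral_gauss_kernel_quadratic (f x) b q.
have df y : differentiable f y by case: hf.
have hf2 : times_differentiable 2 f.
  by case: hf => ? d2; split => // v; case: (d2 v).
set P := (fun z : 'cV[R]_N => _) in iP IP.
have mfx : measurable_fun setT (fun z => f (x + z)).
  by apply: (measurableT_comp mf); exact: measurable_cV_add.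
have mKf : measurable_fun setT (fun z => (K z * f (x + z))%:E).
  by apply/measurable_EFinP; apply: measurable_funM => //; exact: measurable_gauss_kernel.
have iKf : leb.-integrable setT (fun z => (K z * f (x + z))%:E).
  apply/integrableP; split => //.
  rewrite (eq_integral (fun z : 'cV[R]_N => (K z * f (x + z))%:E))// => z _.
  by rewrite /= ger0_norm// mulr_ge0 ?gauss_kernel_ge0.
pose rem z := f (x + z) - f x - 'D_z f x - 2^-1 * 'D_z ('D_z f) x.
have KremE z : ((K z * f (x + z))%:E - (P z)%:E)%E = (K z * rem z)%:E.
  rewrite -EFinB; congr EFin; rewrite /rem /P derive_coord// derive2_coord//.
  by rewrite /b /q; ring.
have iKrem := integrableB measurableT iKf iP.
have iKrem' : leb.-integrable setT (fun z => (K z * rem z)%:E).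
  by under eq_fun do rewrite -KremE.
have IKrem : (\int[leb]_z (K z * rem z)%:E =
    (fine (\int[leb]_z (K z * f (x + z)%R)%:E) -
     (f x + H / 2 * \sum_i c i ^+ 2 * q i i))%:E)%E.
  under eq_integral do rewrite -KremE.
  rewrite integralB// IP EFinB fineK//.
  exact: integrable_fin_num.
have rem_le : (`|\int[leb]_z (K z * rem z)%:E| <=
   \int[leb \x lebesgue_measure]_u (K u.1 * taylor_weight u.2 *
     (enorm u.1 ^+ 3 * m (x + u.2 *: u.1)%R))%:E)%E.
  have m0 v : 0 <= m v by apply: le_trans (fm v 0 _); rewrite ?enorm0.
  have mG : measurable_fun setT (fun u : 'cV[R]_N * R =>
      (K u.1 * taylor_weight u.2 * (enorm u.1 ^+ 3 * m (x + u.2 *: u.1)))%:E).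
    apply/measurable_EFinP; apply: measurable_funM.
      apply: measurable_funM.
        exact: (measurableT_comp (measurable_gauss_kernel hH hc) measurable_fst).
      exact: (measurableT_comp measurable_taylor_weight measurable_snd).
    apply: measurable_funM.
      by apply: measurable_funX; exact: (measurableT_comp (@measurable_enorm N) measurable_fst).
    by apply: (measurableT_comp mm); exact: measurable_ray.
  have G0 (u : 'cV[R]_N * R) :
      (0 <= (K u.1 * taylor_weight u.2 * (enorm u.1 ^+ 3 * m (x + u.2 *: u.1)))%:E)%E.
    rewrite lee_fin; apply: mulr_ge0; apply: mulr_ge0 => //.
    - exact: gauss_kernel_ge0.
    - exact: taylor_weight_ge0.
    - by rewrite exprn_ge0 ?enorm_ge0.
  apply: (le_trans (le_abse_integral _ measurableT (measurable_int _ iKrem'))).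
  rewrite fubini_tonelli1//; apply: ge0_le_integral => //.
  - by apply: measurableT_comp => //; exact: measurable_int iKrem'.
  - exact: measurable_fun_fubini_tonelli_F.
  move=> z _; rewrite /fubini_F/=.
  have mms : measurable_fun setT (fun s : R => m (x + s *: z)).
    by apply: (measurableT_comp mm); exact: measurable_ray.
  have := taylor3_le hf fm mms; rewrite -/(rem z) => trem.
  apply: (@le_trans _ _ ((K z)%:E * \int[lebesgue_measure]_(s in `[0%R, 1%R])
     ((1 - s) ^+ 2 / 2 * enorm z ^+ 3 * m (x + s *: z)%R)%:E)%E).
    rewrite normrM ger0_norm ?gauss_kernel_ge0// EFinM.
    by apply: lee_wpmul2l => //; rewrite lee_fin gauss_kernel_ge0.
  rewrite integral_mkcond -ge0_integralZl//; last 3 first.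
  - apply: (measurable_restrictT _ _).1; first exact: measurable_itv.
    apply: measurable_funTS; apply/measurable_EFinP; apply: measurable_funM => //.
    apply: measurable_funM => //; apply: measurable_funM => //.
    by apply: measurable_funX; exact: measurable_funB.
  - move=> s _; apply: erestrict_ge0 => {}s _; rewrite lee_fin.
    by rewrite mulr_ge0// mulr_ge0 ?exprn_ge0 ?enorm_ge0// divr_ge0 ?sqr_ge0.
  - by rewrite lee_fin gauss_kernel_ge0.
  rewrite le_eqVlt; apply/orP; left; apply/eqP; apply: eq_integral => s _.
  rewrite patchE /taylor_weight indicE; case: ifPn => _; last by rewrite !(mul0r, mulr0, mule0).
  by rewrite -EFinM; congr EFin; rewrite mul1r; ring.
rewrite IKrem in rem_le.
apply: le_trans (leeD2l _ rem_le); rewrite /= lee_fin.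
set A := \sum_i _ * _ in rem_le *; set Q := fine _.
have -> : f x - Q = - (H / 2 * A) - (Q - (f x + H / 2 * A)) by ring.
apply: (le_trans (ler_normB _ _)).
by rewrite normrN normrM ger0_norm// divr_ge0// ltW.
Qed.

End smoothing_bias.

Section sigma_finite_product.
Local Open Scope ereal_scope.
Context d1 d2 (T1 : measurableType d1) (T2 : measurableType d2) (R : realType).
Variables (m1 : {sigma_finite_measure set T1 -> \bar R})
  (m2 : {sigma_finite_measure set T2 -> \bar R}).

(* The canonical sigma-finite instance of [m1 \x m2] only covers
   subprobabilities, hence this alias. *)
Definition sigma_finite_product : set (T1 * T2) -> \bar R := m1 \x m2.

HB.instance Definition _ := Measure.copy sigma_finite_product (m1 \x m2).

Let sigma_finite_productP : sigma_finite setT sigma_finite_product.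
Proof.
have /sigma_finiteP[F [TF ndF Foo]] := sigma_finiteT m1.
have /sigma_finiteP[G [TG ndG Goo]] := sigma_finiteT m2.
exists (fun n => F n `*` G n).
  rewrite -setXTT TF TG; apply/seteqP; split => [[x y] [[i _ Fx] [j _ Gy]]|].
    exists (maxn i j) => //; split => /=.
    - by have /subsetPset := ndF _ _ (leq_maxl i j); exact.
    - by have /subsetPset := ndG _ _ (leq_maxr i j); exact.
  by move=> [x y] [i _ [Fx Gy]]; split; exists i.
move=> i; have [mF Fi] := Foo i; have [mG Gi] := Goo i; split.
  exact: measurableX.
by rewrite [X in X < _]product_measure1E// lte_mul_pinfty// ge0_fin_numE.
Qed.

HB.instance Definition _ := Measure_isSigmaFinite.Build _ _ _ sigma_finite_product
  sigma_finite_productP.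

End sigma_finite_product.

Section derive_measurable.
Context {R : realType} {N : nat} d (Y : measurableType d).

(** Limit of the difference quotients along the steps [harmonic n], which are nonzero and tend to
    0. *)
Lemma measurable_derive (g : 'cV[R]_N -> Y -> R) (v : 'cV[R]_N) :
  measurable_fun setT (fun u : 'cV[R]_N * Y => g u.1 u.2) ->
  (forall x y, derivable (g ^~ y) x v) ->
  measurable_fun setT (fun u : 'cV[R]_N * Y => 'D_v (g ^~ u.2) u.1).
Proof.
move=> mg dg.
pose q (n : nat) (u : 'cV[R]_N * Y) : R :=
  (harmonic n)^-1 * (g (harmonic n *: v + u.1) u.2 - g u.1 u.2).
apply: (@measurable_fun_cvg _ _ _ _ q) => [n|u _].
- apply: measurable_funM => //; apply: measurable_funB => //.
  have mh : measurable_fun setT (fun u : 'cV[R]_N * Y => (harmonic n *: v + u.1, u.2)).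
    by apply: measurable_fun_pair => //; exact: measurable_cV_add.
  exact: (measurableT_comp mg mh).
- have /cvg_ex[l hl] := dg u.1 u.2.
  have -> : 'D_v (g ^~ u.2) u.1 = l by exact: cvg_lim.
  have hd : (@harmonic R) n @[n --> \oo] --> (0 : R)^'.
    move=> A /= /nbhs_ballP[e e0 eA].
    have := @cvg_harmonic R => /cvgrPdist_lt/(_ _ e0).
    apply: filterS => n ne; apply: eA; first exact: ne.
    by rewrite /= invr_eq0 pnatr_eq0.
  have := cvg_comp _ _ hd hl; exact.
Qed.

End derive_measurable.

(** Weighted Cauchy-Schwarz: after symmetrising the double sum, each pair contributes the
    nonnegative gap [(w i * a j - w j * a i) ^+ 2 / (w i * w j)]. *)
Lemma sum_sqr_le_weighted (R : realFieldType) (I : finType) (a w : I -> R) :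
  (forall i, 0 < w i) ->
  (\sum_i a i) ^+ 2 <= (\sum_i w i) * \sum_i (a i ^+ 2 / w i).
Proof.
move=> w0.
have E1 : (\sum_i w i) * (\sum_i (a i ^+ 2 / w i)) = \sum_i \sum_j w i * (a j ^+ 2 / w j).
  by rewrite mulr_suml; apply: eq_bigr => i _; rewrite mulr_sumr.
have E2 : (\sum_i w i) * (\sum_i (a i ^+ 2 / w i)) = \sum_i \sum_j w j * (a i ^+ 2 / w i).
  by rewrite E1 exchange_big.
have E3 : (\sum_i a i) ^+ 2 = \sum_i \sum_j a i * a j.
  by rewrite expr2 mulr_suml; apply: eq_bigr => i _; rewrite mulr_sumr.
rewrite -(@ler_pM2l _ 2)// mulr2n !mulrDl !mul1r {1}E1 E2 -!big_split E3 /=.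
rewrite -big_split; apply: ler_sum => i _.
rewrite -!big_split; apply: ler_sum => j _ /=.
have wi := w0 i; have wj := w0 j.
rewrite -subr_ge0.
have -> : w i * (a j ^+ 2 / w j) + w j * (a i ^+ 2 / w i) - (a i * a j + a i * a j) =
    (w i * a j - w j * a i) ^+ 2 / (w i * w j) by field; rewrite !gt_eqF.
by rewrite divr_ge0 ?sqr_ge0// mulr_ge0 ?ltW.
Qed.

(** * The integrated squared bias *)

Section smoothing_bias_L2.
Context {R : realType} {N : nat}.
Variables (H : R) (c : 'I_N -> R).
Hypotheses (hH : 0 < H) (hc : forall i, 0 < c i).
Local Notation K := (gauss_kernel H c).
Local Notation leb := (lebesgue_cV N).
Local Notation e_ i := (delta_mx i ord0 : 'cV[R]_N).
Local Notation S := (\sum_i c i ^+ 2).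

Lemma gauss_kernel_enorm2 :
  (\int[leb]_z (K z * enorm z ^+ 2)%:E = (H * S)%:E)%E.
Proof.
under eq_integral do rewrite enorm_sqr mulr_sumr -sumEFin.
have E i z : (K z * z i ord0 ^+ 2)%:E = (z i ord0 ^+ 2 * K z)%:E by rewrite mulrC.
under eq_integral do under eq_bigr do rewrite E.
rewrite ge0_integral_sum//; last 2 first.
- move=> i; apply/measurable_EFinP; apply: measurable_funM; last exact: measurable_gauss_kernel.
  by apply: measurable_funX; exact: measurable_entry.
- by move=> i z _; rewrite lee_fin mulr_ge0 ?sqr_ge0 ?gauss_kernel_ge0.
by rewrite mulr_sumr -sumEFin; apply: eq_bigr => i _; rewrite gauss_kernel_moment2.
Qed.

Lemma gauss_kernel_enorm4 :
  (\int[leb]_z (K z * enorm z ^+ 4)%:E <= (3 * H ^+ 2 * S ^+ 2)%:E)%E.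
Proof.
have S0 : 0 <= S by apply: sumr_ge0 => i _; rewrite sqr_ge0.
(* Cauchy-Schwarz: (sum z_i^2)^2 <= (sum c_i^2) (sum z_i^4 / c_i^2) *)
have enorm4 (z : 'cV[R]_N) : enorm z ^+ 4 <= S * \sum_i z i ord0 ^+ 4 / c i ^+ 2.
  rewrite -[4%N]/(2 * 2)%N exprM enorm_sqr.
  apply: (le_trans (sum_sqr_le_weighted _ (w := fun i => c i ^+ 2) _)).
    by move=> i; rewrite exprn_gt0.
  by apply: ler_wpM2l => //; apply: ler_sum => i _; rewrite exprM.
have mt i : measurable_fun setT (fun z : 'cV[R]_N => ((z i ord0 ^+ 4 * K z))%:E).
  apply/measurable_EFinP; apply: measurable_funM; last exact: measurable_gauss_kernel.
  by apply: measurable_funX; exact: measurable_entry.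
apply: (@le_trans _ _ (\int[leb]_z \sum_i ((S / c i ^+ 2)%:E * (z i ord0 ^+ 4 * K z)%:E))%E).
  apply: ge0_le_integral => //.
  - by move=> z _; rewrite lee_fin mulr_ge0 ?gauss_kernel_ge0// exprn_ge0 ?enorm_ge0.
  - apply/measurable_EFinP; apply: measurable_funM; first exact: measurable_gauss_kernel.
    by apply: measurable_funX; exact: measurable_enorm.
  - apply: emeasurable_sum => i; exact: measurable_funeM.
  - move=> z _; rewrite sumEFin lee_fin.
    apply: (le_trans (ler_wpM2l (gauss_kernel_ge0 hH hc z) (enorm4 z))).
    rewrite mulr_sumr mulr_sumr; apply: ler_sum => i _.
    by rewrite le_eqVlt; apply/orP; left; apply/eqP; ring.
rewrite ge0_integral_sum//; last 2 first.
- by move=> i; exact: measurable_funeM.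
- move=> i z _; rewrite mule_ge0// lee_fin ?divr_ge0 ?sqr_ge0//.
  by rewrite mulr_ge0 ?gauss_kernel_ge0// exprn_even_ge0.
(* The fourth moment [3 * (H * c i ^+ 2) ^+ 2] divided by the weight [c i ^+ 2] leaves
   [3 * H ^+ 2 * c i ^+ 2]. *)
rewrite (eq_bigr (fun i => (3 * H ^+ 2 * S * c i ^+ 2)%:E)).
  by rewrite sumEFin -mulr_sumr lee_fin -[leLHS]mulrA.
move=> i _; rewrite ge0_integralZl//; last 2 first.
- by move=> z _; rewrite lee_fin mulr_ge0 ?gauss_kernel_ge0// exprn_even_ge0.
- by rewrite lee_fin divr_ge0 ?sqr_ge0.
rewrite gauss_kernel_moment4// -EFinM; congr EFin; field.
by rewrite gt_eqF.
Qed.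

Let mu3 : {sigma_finite_measure set ('cV[R]_N * measurableTypeR R)%type -> \bar R} :=
  sigma_finite_product leb (@lebesgue_measure R).

Lemma integral_gauss_taylor_weight (h : 'cV[R]_N -> R) :
  measurable_fun setT h -> (forall z, 0 <= h z) ->
  (\int[leb \x @lebesgue_measure R]_v (K v.1 * taylor_weight v.2 * h v.1)%:E =
   (6^-1)%:E * \int[leb]_z (K z * h z)%:E)%E.
Proof.
move=> mh h0.
have mKh : measurable_fun setT (fun z => (K z * h z)%:E).
  by apply/measurable_EFinP; apply: measurable_funM => //; exact: measurable_gauss_kernel.
have Kh0 z : (0 <= (K z * h z)%:E)%E by rewrite lee_fin mulr_ge0 ?gauss_kernel_ge0.
have mF : measurable_fun setT
    (fun v : 'cV[R]_N * R => (K v.1 * taylor_weight v.2 * h v.1)%:E).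
  apply/measurable_EFinP; apply: measurable_funM; last exact: (measurableT_comp mh measurable_fst).
  apply: measurable_funM.
    exact: (measurableT_comp (measurable_gauss_kernel hH hc) measurable_fst).
  exact: (measurableT_comp measurable_taylor_weight measurable_snd).
rewrite fubini_tonelli1//; last first.
  by move=> v; rewrite lee_fin mulr_ge0// mulr_ge0 ?taylor_weight_ge0 ?gauss_kernel_ge0.
rewrite -ge0_integralZl//.
apply: eq_integral => z _; rewrite /fubini_F/=.
under eq_integral do rewrite mulrAC EFinM.
rewrite ge0_integralZl//; last 2 first.
- by apply/measurable_EFinP; exact: measurable_taylor_weight.
- by move=> s _; rewrite lee_fin taylor_weight_ge0.
by rewrite integral_taylor_weight muleC.
Qed.

Context d (Y : measurableType d) (nu : {sigma_finite_measure set Y -> \bar R}).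
Variables p M : 'cV[R]_N -> Y -> R.
Hypothesis mp : measurable_fun setT (fun u : 'cV[R]_N * Y => p u.1 u.2).
Hypothesis p0 : forall x y, 0 <= p x y.
Hypothesis p3 : forall y, times_differentiable 3 (p ^~ y).
Hypothesis mM : measurable_fun setT (fun u : 'cV[R]_N * Y => M u.1 u.2).
Hypothesis pM : forall x y (v : 'cV[R]_N), enorm v <= 1 ->
  `|derive1n 3 (fun s : R => p (x + s *: v) y) 0| <= M x y.

Let M0 x y : 0 <= M x y.
Proof. by apply: le_trans (pM x y (v := 0) _); rewrite ?enorm0. Qed.

Let laplacian (u : 'cV[R]_N * Y) : R :=
  \sum_i c i ^+ 2 * 'D_(e_ i) ('D_(e_ i) (p ^~ u.2)) u.1.

Let measurable_laplacian : measurable_fun setT laplacian.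
Proof.
apply: measurable_sum => i; apply: measurable_funM => //.
apply: (@measurable_derive _ _ _ _ (fun x y => 'D_(e_ i) (p ^~ y) x)).
  apply: (@measurable_derive _ _ _ _ p) => // x y.
  by apply: diff_derivable; case: (p3 y).
by move=> x y; apply: diff_derivable; case: (p3 y) => _ /(_ (e_ i)) [].
Qed.

Let rem (u : 'cV[R]_N * Y) (v : 'cV[R]_N * measurableTypeR R) : R :=
  K v.1 * taylor_weight v.2 * (enorm v.1 ^+ 3 * M (u.1 + v.2 *: v.1) u.2).

Let rho u : \bar R := (\int[leb \x @lebesgue_measure R]_v (rem u v)%:E)%E.

Let W0 (v : 'cV[R]_N * measurableTypeR R) : 0 <= K v.1 * taylor_weight v.2.
Proof. by rewrite mulr_ge0 ?gauss_kernel_ge0 ?taylor_weight_ge0. Qed.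

Let mW : measurable_fun setT (fun v : 'cV[R]_N * measurableTypeR R => K v.1 * taylor_weight v.2).
Proof.
apply: measurable_funM.
  exact: (measurableT_comp (measurable_gauss_kernel hH hc) measurable_fst).
exact: (measurableT_comp measurable_taylor_weight measurable_snd).
Qed.

Let mMray : measurable_fun setT (fun t : ('cV[R]_N * Y) * ('cV[R]_N * measurableTypeR R) =>
  M (t.1.1 + t.2.2 *: t.2.1) t.1.2).
Proof.
have mh : measurable_fun setT (fun t : ('cV[R]_N * Y) * ('cV[R]_N * measurableTypeR R) =>
    (t.1.1 + t.2.2 *: t.2.1, t.1.2)).
  apply: measurable_fun_pair; last exact: (measurableT_comp measurable_snd measurable_fst).
  apply: measurable_ray.
  - exact: (measurableT_comp measurable_fst measurable_fst).
  - exact: (measurableT_comp measurable_fst measurable_snd).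
  - exact: (measurableT_comp measurable_snd measurable_snd).
exact: (measurableT_comp mM mh).
Qed.

Let mW2 : measurable_fun setT
  (fun t : ('cV[R]_N * Y) * ('cV[R]_N * measurableTypeR R) => K t.2.1 * taylor_weight t.2.2).
Proof. exact: (measurableT_comp mW measurable_snd). Qed.

Let menorm2 k : measurable_fun setT
  (fun t : ('cV[R]_N * Y) * ('cV[R]_N * measurableTypeR R) => enorm t.2.1 ^+ k).
Proof.
apply: measurable_funX; apply: (measurableT_comp (@measurable_enorm R N)).
exact: (measurableT_comp measurable_fst measurable_snd).
Qed.

Let mrem : measurable_fun setT
  (fun t : ('cV[R]_N * Y) * ('cV[R]_N * measurableTypeR R) => (rem t.1 t.2)%:E).
Proof.
apply/measurable_EFinP; apply: measurable_funM; first exact: mW2.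
by apply: measurable_funM; [exact: menorm2|exact: mMray].
Qed.

Let rem0 u v : (0 <= (rem u v)%:E)%E.
Proof. by rewrite lee_fin mulr_ge0// mulr_ge0 ?exprn_ge0 ?enorm_ge0. Qed.

Let mrho : measurable_fun setT rho.
Proof.
exact: (measurable_fun_fubini_tonelli_F (m2 := mu3)
  (fun t : ('cV[R]_N * Y) * ('cV[R]_N * measurableTypeR R) => (rem t.1 t.2)%:E) mrem
  (fun t => rem0 t.1 t.2)).
Qed.

Let rho0 u : (0 <= rho u)%E. Proof. exact: integral_ge0. Qed.

Let second_moment u : \bar R := (\int[leb \x @lebesgue_measure R]_v
  (K v.1 * taylor_weight v.2 * (enorm v.1 ^+ 4 * M (u.1 + v.2 *: v.1) u.2 ^+ 2))%:E)%E.

(* Cauchy-Schwarz with [|z|^3 M = |z| * (|z|^2 M)]. *)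
Let rho_sqr_le u : (rho u * rho u <= (H * S / 6)%:E * second_moment u)%E.
Proof.
pose f (v : 'cV[R]_N * measurableTypeR R) := Num.sqrt (K v.1 * taylor_weight v.2) * enorm v.1.
pose g (v : 'cV[R]_N * measurableTypeR R) := Num.sqrt (K v.1 * taylor_weight v.2) *
  (enorm v.1 ^+ 2 * M (u.1 + v.2 *: v.1) u.2).
have msW : measurable_fun setT (fun v : 'cV[R]_N * measurableTypeR R => Num.sqrt (K v.1 * taylor_weight v.2)).
  have ms : measurable_fun setT (@Num.sqrt R).
    by apply: continuous_measurable_fun; exact: sqrt_continuous.
  exact: (measurableT_comp ms mW).
have men : measurable_fun setT (fun v : 'cV[R]_N * measurableTypeR R => enorm v.1).
  exact: (measurableT_comp (@measurable_enorm R N) measurable_fst).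
have mf : measurable_fun setT f by exact: measurable_funM.
have mg : measurable_fun setT g.
  apply: measurable_funM => //; apply: measurable_funM; first exact: measurable_funX.
  exact: (measurableT_comp mMray (pair1_measurable u)).
have f0 v : 0 <= f v by rewrite mulr_ge0 ?sqrtr_ge0 ?enorm_ge0.
have g0 v : 0 <= g v by rewrite mulr_ge0 ?sqrtr_ge0// mulr_ge0 ?exprn_ge0 ?enorm_ge0.
have := cauchy_schwarz_integral (leb \x @lebesgue_measure R)%E mf mg f0 g0.
have -> : (\int[leb \x @lebesgue_measure R]_v (f v * g v)%:E = rho u)%E.
  apply: eq_integral => v _; congr EFin; rewrite /rem -[in RHS](sqr_sqrtr (W0 v)) /f /g.
  by ring.
have -> : (\int[leb \x @lebesgue_measure R]_v ((f v) ^+ 2)%:E = (H * S / 6)%:E)%E.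
  transitivity (\int[leb \x @lebesgue_measure R]_v
      (K v.1 * taylor_weight v.2 * enorm v.1 ^+ 2)%:E)%E.
    by apply: eq_integral => v _; rewrite /f exprMn sqr_sqrtr.
  rewrite (integral_gauss_taylor_weight (h := fun z => enorm z ^+ 2)).
  - by rewrite gauss_kernel_enorm2 -EFinM mulrC.
  - by apply: measurable_funX; exact: measurable_enorm.
  - by move=> z; rewrite sqr_ge0.
have -> // : (\int[leb \x @lebesgue_measure R]_v ((g v) ^+ 2)%:E = second_moment u)%E.
apply: eq_integral => v _; congr EFin; rewrite /g exprMn sqr_sqrtr//.
by ring.
Qed.

Let M2 : \bar R := (\int[leb \x nu]_u ((M u.1 u.2) ^+ 2)%:E)%E.

Let M20 : (0 <= M2)%E.
Proof. by apply: integral_ge0 => u _; rewrite lee_fin sqr_ge0. Qed.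

Let integral_shift_M (a : 'cV[R]_N) :
  (\int[leb \x nu]_u ((M (u.1 + a)%R u.2) ^+ 2)%:E = M2)%E.
Proof.
have mM2 : measurable_fun setT (fun u : 'cV[R]_N * Y => ((M u.1 u.2) ^+ 2)%:E).
  by apply/measurable_EFinP; exact: measurable_funX.
have mh : measurable_fun setT (fun u : 'cV[R]_N * Y => (u.1 + a, u.2)).
  by apply: measurable_fun_pair => //; exact: measurable_cV_add.
have sq0 (b : R) : (0 <= (b ^+ 2)%:E)%E by rewrite lee_fin sqr_ge0.
have mF : measurable_fun setT (fun u : 'cV[R]_N * Y => ((M (u.1 + a)%R u.2) ^+ 2)%:E).
  exact: (measurableT_comp mM2 mh).
have sq0' (u : 'cV[R]_N * Y) : (0 <= ((M (u.1 + a)%R u.2) ^+ 2)%:E)%E by exact: sq0.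
have sq0'' (u : 'cV[R]_N * Y) : (0 <= ((M u.1 u.2) ^+ 2)%:E)%E by exact: sq0.
rewrite /M2 (fubini_tonelli1 _ mF sq0') (fubini_tonelli1 _ mM2 sq0'').
rewrite (fubini_tonelli _ mF sq0') (fubini_tonelli _ mM2 sq0'').
apply: eq_integral => y _ /=.
rewrite (ge0_integral_cV_shift a (f := fun x => ((M x y) ^+ 2)%:E))//.
exact: (measurableT_comp mM2 (pair2_measurable y)).
Qed.

Let second_moment_fun (t : ('cV[R]_N * Y) * ('cV[R]_N * measurableTypeR R)) : \bar R :=
  (K t.2.1 * taylor_weight t.2.2 *
    (enorm t.2.1 ^+ 4 * M (t.1.1 + t.2.2 *: t.2.1) t.1.2 ^+ 2))%:E.

Let measurable_second_moment_fun : measurable_fun setT second_moment_fun.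
Proof.
apply/measurable_EFinP; apply: measurable_funM; first exact: mW2.
by apply: measurable_funM; [exact: menorm2|exact: measurable_funX].
Qed.

Let second_moment_fun0 t : (0 <= second_moment_fun t)%E.
Proof. by rewrite lee_fin mulr_ge0// mulr_ge0 ?sqr_ge0// exprn_ge0 ?enorm_ge0. Qed.

Let measurable_second_moment : measurable_fun setT second_moment.
Proof.
exact: (measurable_fun_fubini_tonelli_F (m2 := mu3) _ measurable_second_moment_fun
  second_moment_fun0).
Qed.

(** After exchanging the integrals, translation invariance gives the same value [M2] for every fixed
    [v]. The weight then factors out with integral at most [6^-1 * (3 * H ^+ 2 * S ^+ 2)]. *)
Let integral_second_moment_le :
  (\int[leb \x nu]_u second_moment u <= (H ^+ 2 * S ^+ 2 / 2)%:E * M2)%E.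
Proof.
rewrite (fubini_tonelli (m1 := sigma_finite_product leb nu) (m2 := mu3)
  _ measurable_second_moment_fun second_moment_fun0 :
  (\int[leb \x nu]_u second_moment u = _)%E).
rewrite (eq_integral (fun v : 'cV[R]_N * measurableTypeR R =>
    (K v.1 * taylor_weight v.2 * enorm v.1 ^+ 4)%:E * M2)%E); last first.
  move=> v _; rewrite -(integral_shift_M (v.2 *: v.1)).
  rewrite -ge0_integralZl//; last 3 first.
  - apply/measurable_EFinP; apply: measurable_funX.
    exact: (measurableT_comp mMray (pair2_measurable v)).
  - by move=> u _; rewrite lee_fin sqr_ge0.
  - by rewrite lee_fin mulr_ge0// exprn_ge0 ?enorm_ge0.
  by apply: eq_integral => u _; rewrite /second_moment_fun /= mulrA EFinM.
rewrite ge0_integralZr//; last 2 first.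
- apply/measurable_EFinP; apply: measurable_funM => //.
  by apply: measurable_funX; exact: (measurableT_comp (@measurable_enorm R N) measurable_fst).
- by move=> v _; rewrite lee_fin mulr_ge0// exprn_ge0 ?enorm_ge0.
apply: lee_wpmul2r => //.
rewrite (integral_gauss_taylor_weight (h := fun z => enorm z ^+ 4)); last 2 first.
- by apply: measurable_funX; exact: measurable_enorm.
- by move=> z; rewrite exprn_ge0 ?enorm_ge0.
apply: (@le_trans _ _ ((6^-1)%:E * (3 * H ^+ 2 * S ^+ 2)%:E)%E).
  by apply: lee_wpmul2l; [rewrite lee_fin|exact: gauss_kernel_enorm4].
by rewrite -EFinM lee_fin le_eqVlt; apply/orP; left; apply/eqP; field.
Qed.

Lemma smoothing_bias_L2 (pbar : 'cV[R]_N -> Y -> R) (delta : R) :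
  measurable_fun setT (fun u : 'cV[R]_N * Y => pbar u.1 u.2) ->
  {ae (leb \x nu)%E, forall u : 'cV[R]_N * Y,
    (\int[leb]_z (K z * p (u.1 + z)%R u.2)%:E < +oo)%E /\
    pbar u.1 u.2 = fine (\int[leb]_z (K z * p (u.1 + z)%R u.2)%:E)} ->
  0 < delta ->
  (\int[leb \x nu]_u ((p u.1 u.2 - pbar u.1 u.2) ^+ 2)%:E <=
   ((1 + delta) / 4 * H ^+ 2)%:E * \int[leb \x nu]_u ((\sum_i c i ^+ 2 *
      'D_(e_ i) ('D_(e_ i) (p ^~ u.2)) u.1) ^+ 2)%:E +
   ((1 + delta^-1) / 2 * H ^+ 3 * S ^+ 3)%:E *
      \int[leb \x nu]_u ((M u.1 u.2) ^+ 2)%:E)%E.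
Proof.
move=> mpbar hpbar delta0.
have dV0 : 0 < delta^-1 by rewrite invr_gt0.
have S0 : 0 <= S by apply: sumr_ge0 => i _; rewrite sqr_ge0.
rewrite -/M2.
have mL2 : measurable_fun setT (fun u => ((laplacian u) ^+ 2)%:E).
  by apply/measurable_EFinP; exact: measurable_funX.
have L20 u : (0 <= ((laplacian u) ^+ 2)%:E)%E by rewrite lee_fin sqr_ge0.
have mrho2 : measurable_fun setT (fun u => (rho u * rho u)%E) by exact: emeasurable_funM.
have rho20 u : (0 <= rho u * rho u)%E by exact: mule_ge0.
have k10 : (0 <= ((1 + delta) / 4 * H ^+ 2)%:E)%E.
  by rewrite lee_fin mulr_ge0 ?sqr_ge0// divr_ge0// addr_ge0// ltW.
have k20 : (0 <= (1 + delta^-1)%:E)%E by rewrite lee_fin addr_ge0// ltW.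
apply: (@le_trans _ _ (\int[leb \x nu]_u
    (((1 + delta) / 4 * H ^+ 2)%:E * ((laplacian u) ^+ 2)%:E +
     (1 + delta^-1)%:E * (rho u * rho u)))%E).
  apply: ae_ge0_le_integral => //.
  - by move=> u _; rewrite lee_fin sqr_ge0.
  - by apply/measurable_EFinP; apply: measurable_funX; exact: measurable_funB.
  - by move=> u _; rewrite adde_ge0// mule_ge0.
  - by apply: emeasurable_funD; exact: measurable_funeM.
  apply: filterS hpbar => u [qfin pbarE] _.
  have mpx : measurable_fun setT (p ^~ u.2) by exact: (measurableT_comp mp (pair2_measurable u.2)).
  have mMx : measurable_fun setT (M ^~ u.2) by exact: (measurableT_comp mM (pair2_measurable u.2)).
  have := smoothing_bias_le hH hc mpx (fun x => p0 x u.2) (p3 u.2) mMx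
    (fun x => pM x u.2) qfin.
  rewrite -pbarE -/(laplacian u) -/(rho u).
  set a : R := p u.1 u.2 - pbar u.1 u.2; move: (rho0 u); case: (rho u) => [r| |]//.
    rewrite lee_fin => r0; rewrite -EFinD lee_fin => ar.
    rewrite -!EFinM -EFinD lee_fin -(real_normK (num_real a)) -(real_normK (num_real (laplacian u))).
    set l := `|laplacian u| in ar *; have l0 : 0 <= l by exact: normr_ge0.
    have hl0 : 0 <= H / 2 * l by rewrite mulr_ge0// divr_ge0// ltW.
    apply: (@le_trans _ _ ((H / 2 * l + r) ^+ 2)).
      by rewrite ler_pXn2r// nnegrE ?normr_ge0// addr_ge0.
    (* Weighted form of [(a + r) ^+ 2 <= (1 + delta) * a ^+ 2 + (1 + delta^-1) * r ^+ 2] with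
       [a = H / 2 * l]; the gap is [(delta * a - r) ^+ 2 / delta]. *)
    rewrite -subr_ge0.
    have -> : (1 + delta) / 4 * H ^+ 2 * l ^+ 2 + (1 + delta^-1) * (r * r) - (H / 2 * l + r) ^+ 2 =
        (delta * (H / 2 * l) - r) ^+ 2 / delta by field; rewrite gt_eqF.
    by rewrite divr_ge0 ?sqr_ge0// ltW.
  (* An infinite remainder makes the right-hand side infinite. *)
  move=> _ _; rewrite mulyy gt0_muley ?addey ?leey//.
  by rewrite lte_fin addr_gt0.
rewrite ge0_integralD//; last 4 first.
- by move=> u _; exact: mule_ge0.
- exact: measurable_funeM.
- by move=> u _; exact: mule_ge0.
- exact: measurable_funeM.
rewrite ge0_integralZl// ge0_integralZl//; apply: leeD => //.
apply: (@le_trans _ _ ((1 + delta^-1)%:E *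
    ((H * S / 6)%:E * ((H ^+ 2 * S ^+ 2 / 2)%:E * M2)))%E).
  apply: lee_wpmul2l => //.
  have c0 : (0 <= (H * S / 6)%:E)%E by rewrite lee_fin divr_ge0// mulr_ge0// ltW.
  have sm0 u : (0 <= second_moment u)%E.
    apply: integral_ge0 => v _.
    by rewrite lee_fin mulr_ge0// mulr_ge0 ?sqr_ge0// exprn_ge0 ?enorm_ge0.
  apply: (@le_trans _ _ (\int[leb \x nu]_u ((H * S / 6)%:E * second_moment u))%E).
    apply: ge0_le_integral => //.
    by apply: measurable_funeM; exact: measurable_second_moment.
  rewrite ge0_integralZl//.
  by apply: lee_wpmul2l.
rewrite !muleA -!EFinM; apply: lee_wpmul2r => //; rewrite lee_fin.
have HS0 : 0 <= H ^+ 3 * S ^+ 3 by rewrite mulr_ge0// exprn_ge0// ltW.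
have d10 : 0 <= 1 + delta^-1 by rewrite addr_ge0// ltW.
(* The two moment factors give the constant [1 / 12], well below the stated [1 / 2]. *)
have -> : (1 + delta^-1) * (H * S / 6) * (H ^+ 2 * S ^+ 2 / 2) =
    (1 + delta^-1) * (H ^+ 3 * S ^+ 3) / 12 by field; rewrite gt_eqF.
have -> : (1 + delta^-1) / 2 * H ^+ 3 * S ^+ 3 = (1 + delta^-1) * (H ^+ 3 * S ^+ 3) / 2.
  by field; rewrite gt_eqF.
have := mulr_ge0 d10 HS0; lra.
Qed.

End smoothing_bias_L2.

(** * Mean squared error of independent samples *)

Section squared_error.
Local Open Scope ereal_scope.
Context d (T : measurableType d) (R : realType) (P : probability T R).

(** Since [f] is only integrable, its square may have infinite integral, and the expanded square
    cannot be integrated term by term. The cross term [V] has mean 0, so its positive and negative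
    parts have the same finite integral. Putting twice [Vp] on the left and twice [Vn] on the right
    leaves only nonnegative functions to add; the common finite value is then cancelled. *)
Lemma bias_variance_decomposition (f : T -> R) (a : R) :
  P.-integrable setT (EFin \o f) ->
  let m := Rintegral P setT f in
  \int[P]_w ((a - f w) ^+ 2)%:E =
  \int[P]_w ((f w - m) ^+ 2)%:E + ((a - m) ^+ 2)%:E.
Proof.
move=> fi m.
have mf : measurable_fun setT f by apply/measurable_EFinP; case/integrableP : fi.
have cstE (r : R) : \int[P]_x (cst r%:E) x = r%:E.
  by rewrite integral_cst//= probability_setT mule1.
have fmi : P.-integrable setT (fun w => (f w - m)%:E).
  rewrite (_ : (fun _ => _) = (EFin \o f) \- cst m%:E)//.
  by apply: integrableB => //; exact: finite_measure_integrable_cst.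
pose V (w : T) : R := ((a - m) * (f w - m))%R.
have Vi : P.-integrable setT (EFin \o V).
  have -> : EFin \o V = (fun w => (a - m)%:E * (f w - m)%:E).
    by apply/funext => w; rewrite /V/= EFinM.
  exact: integrableZl.
have V0 : \int[P]_w (V w)%:E = 0.
  under eq_integral do rewrite EFinM.
  rewrite integralZl//.
  under eq_integral do rewrite EFinB.
  rewrite integralB//; last exact: finite_measure_integrable_cst.
  rewrite [X in _ * (_ - X)]cstE.
  have ffin : \int[P]_w (f w)%:E \is a fin_num by exact: integrable_fin_num.
  by rewrite /m /Rintegral fineK// subee// mule0.
pose Vp w : R := Num.max (V w) 0%R; pose Vn w : R := Num.max (- V w)%R 0%R.
have mV : measurable_fun setT V by apply/measurable_EFinP; case/integrableP : Vi.
have mVp : measurable_fun setT Vp by exact: measurable_maxr.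
have mVn : measurable_fun setT Vn by apply: measurable_maxr => //; exact: measurableT_comp.
have Vp0 w : (0 <= Vp w)%R by rewrite le_max lexx orbT.
have Vn0 w : (0 <= Vn w)%R by rewrite le_max lexx orbT.
have VpE w : (Vp w - Vn w = V w)%R.
  by rewrite /Vp /Vn; case: (leP 0%R (V w)) => h;
    [rewrite max_r ?oppr_le0// subr0|rewrite max_l ?oppr_ge0 1?ltW// sub0r opprK].
have Vle (g : T -> R) : measurable_fun setT g -> (forall w, (0 <= g w)%R) ->
    (forall w, (g w <= `|V w|)%R) ->
    \int[P]_w (g w)%:E \is a fin_num.
  move=> mg g0 gV; apply: integrable_fin_num => //.
  apply: (le_integrable measurableT _ _ Vi); first exact/measurable_EFinP.
  by move=> w _ /=; rewrite lee_fin ger0_norm.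
have Vpfin : \int[P]_w (Vp w)%:E \is a fin_num.
  by apply: Vle => // w; rewrite /Vp ge_max ler_norm normr_ge0.
have Vnfin : \int[P]_w (Vn w)%:E \is a fin_num.
  by apply: Vle => // w; rewrite /Vn ge_max normr_ge0 andbT -normrN ler_norm.
have VpVn : \int[P]_w (Vp w)%:E = \int[P]_w (Vn w)%:E.
  have : \int[P]_w (Vp w)%:E - \int[P]_w (Vn w)%:E = 0.
    rewrite -integralB//; last 2 first.
    - apply/integrableP; split; first exact/measurable_EFinP.
      under eq_integral do rewrite /= ger0_norm//.
      by rewrite ltey_eq Vpfin.
    - apply/integrableP; split; first exact/measurable_EFinP.
      under eq_integral do rewrite /= ger0_norm//.
      by rewrite ltey_eq Vnfin.
    by rewrite -V0; apply: eq_integral => w _; rewrite -EFinB VpE.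
  by move/eqP; rewrite sube_eq ?add0e// ?fin_num_adde_defl// => /eqP.
have msq (g : T -> R) : measurable_fun setT g -> measurable_fun setT (fun w => (g w ^+ 2)%:E).
  by move=> mg; apply/measurable_EFinP; exact: measurable_funX.
have maf : measurable_fun setT (fun w => (a - f w)%R) by exact: measurable_funB.
have mfm : measurable_fun setT (fun w => (f w - m)%R) by exact: measurable_funB.
have key : \int[P]_w ((a - f w) ^+ 2)%:E + (\int[P]_w (Vp w)%:E + \int[P]_w (Vp w)%:E) =
    \int[P]_w ((f w - m) ^+ 2)%:E + ((a - m) ^+ 2)%:E + (\int[P]_w (Vn w)%:E + \int[P]_w (Vn w)%:E).
  have -> : ((a - m) ^+ 2)%:E = \int[P]_w ((a - m) ^+ 2)%:E.
    by rewrite [RHS]cstE.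
  rewrite -!ge0_integralD//; try (by move=> w _; rewrite ?adde_ge0// lee_fin ?sqr_ge0//);
    try (exact: msq); try (exact/measurable_EFinP);
    try (by apply: emeasurable_funD; exact/measurable_EFinP).
  - apply: eq_integral => w _; rewrite -!EFinD; congr EFin.
    have -> : Vp w = (Vn w + (a - m) * (f w - m))%R by rewrite -/(V w) -VpE; ring.
    by ring.
  - by apply: emeasurable_funD; [exact: msq|].
set c := \int[P]_w (Vn w)%:E + _ in key.
have cfin : c \is a fin_num by rewrite fin_numD Vnfin.
by move: key; rewrite VpVn => /(congr1 (fun u => u - c)); rewrite !addeK.
Qed.

(** Tonelli puts the integral over [z] outside, where the decomposition at almost every point
    applies. *)
Lemma mise_decomposition dZ (Z : measurableType dZ)
    (nu : {sigma_finite_measure set Z -> \bar R}) (f : T * Z -> R) (p : Z -> R) :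
  measurable_fun setT f -> (forall u, (0 <= f u)%R) -> measurable_fun setT p ->
  {ae nu, forall z, P.-integrable setT (fun w => (f (w, z))%:E)} ->
  let m z := Rintegral P setT (fun w => f (w, z)) in
  \int[P]_w \int[nu]_z ((p z - f (w, z)) ^+ 2)%:E =
  \int[P]_w \int[nu]_z ((f (w, z) - m z) ^+ 2)%:E +
    \int[nu]_z ((p z - m z) ^+ 2)%:E.
Proof.
move=> mf f0 mp fi m.
have mm : measurable_fun setT m.
  apply: (measurableT_comp (fine_measurable measurableT)).
  apply: (measurable_fun_fubini_tonelli_G (fun u => (f u)%:E)) => [|u].
  - exact/measurable_EFinP.
  - by rewrite lee_fin.
have mpf : measurable_fun setT (fun u : T * Z => ((p u.2 - f (u.1, u.2)) ^+ 2)%:E).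
  apply/measurable_EFinP; apply: measurable_funX; apply: measurable_funB.
    exact: measurableT_comp.
  by under eq_fun do rewrite -surjective_pairing.
have mfm : measurable_fun setT (fun u : T * Z => ((f (u.1, u.2) - m u.2) ^+ 2)%:E).
  apply/measurable_EFinP; apply: measurable_funX; apply: measurable_funB.
    by under eq_fun do rewrite -surjective_pairing.
  exact: measurableT_comp.
rewrite (fubini_tonelli (fun u : T * Z => ((p u.2 - f (u.1, u.2)) ^+ 2)%:E))//; last first.
  by move=> u; rewrite lee_fin sqr_ge0.
rewrite (fubini_tonelli (fun u : T * Z => ((f (u.1, u.2) - m u.2) ^+ 2)%:E))//; last first.
  by move=> u; rewrite lee_fin sqr_ge0.
have mG1 := measurable_fun_fubini_tonelli_G (m1 := P) _ mpf.
have mG2 := measurable_fun_fubini_tonelli_G (m1 := P) _ mfm.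
have sq0 (g : T * Z -> R) u : 0 <= ((g u) ^+ 2)%:E by rewrite lee_fin sqr_ge0.
have mpm : measurable_fun setT (fun z => ((p z - m z) ^+ 2)%:E).
  by apply/measurable_EFinP; apply: measurable_funX; exact: measurable_funB.
rewrite -ge0_integralD//; last 3 first.
- by move=> z _; apply: integral_ge0 => w _; rewrite lee_fin sqr_ge0.
- by apply: mG2 => u; rewrite lee_fin sqr_ge0.
- by move=> z _; rewrite lee_fin sqr_ge0.
apply: ge0_ae_eq_integral => //.
- by apply: mG1 => u; rewrite lee_fin sqr_ge0.
- by apply: emeasurable_funD => //; apply: mG2 => u; rewrite lee_fin sqr_ge0.
- by move=> z _; apply: integral_ge0 => w _; rewrite lee_fin sqr_ge0.
- move=> z _; rewrite adde_ge0 ?lee_fin ?sqr_ge0//.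
  by apply: integral_ge0 => w _; rewrite lee_fin sqr_ge0.
- apply: filterS fi => z zi _.
  exact: (bias_variance_decomposition (p z) zi).
Qed.

(** Independence identifies the joint law with the product of the laws, by uniqueness on rectangles;
    Tonelli does the rest. *)
Lemma integral_mul_independent (X Y : T -> R) :
  measurable_fun setT X -> measurable_fun setT Y ->
  (forall w, (0 <= X w)%R) -> (forall w, (0 <= Y w)%R) ->
  (forall A B : set R, measurable A -> measurable B ->
    P ((X @^-1` A) `&` (Y @^-1` B)) = P (X @^-1` A) * P (Y @^-1` B)) ->
  \int[P]_w (X w * Y w)%:E = \int[P]_w (X w)%:E * \int[P]_w (Y w)%:E.
Proof.
move=> mX mY X0 Y0 XY.
pose X' : {RV P >-> R} := HB.pack X (isMeasurableFun.Build _ _ _ _ _ mX).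
pose Y' : {RV P >-> R} := HB.pack Y (isMeasurableFun.Build _ _ _ _ _ mY).
have mXY : measurable_fun setT (fun w => (X w, Y w)) by exact: measurable_fun_pair.
pose nu : {measure set (R * R) -> \bar R} := (distribution P X' \x distribution P Y')%E.
have nuE C : measurable C ->
    nu C = \int[P]_(x in (fun w => (X w, Y w)) @^-1` C) (cst 1%R x)%:E.
  move=> mC; rewrite [RHS](_ : _ = density_measure P (fun w => (X w, Y w)) (cst 1%R) C)//.
  apply: product_measure_unique => // A B mA mB.
  transitivity (\int[P]_(x in (fun w => (X w, Y w)) @^-1` (A `*` B)) cst 1%E x) => //.
  rewrite integral_cst; last first.
    by rewrite -(setTI (_ @^-1` _)); apply: mXY => //; exact: measurableX.
  by rewrite mul1e; exact: XY.
(* Absolute values keep the integrand nonnegative on all of [R * R]; on the values of [(X, Y)] they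
   change nothing. *)
have mabs : measurable_fun setT (fun u : R * R => (`|u.1| * `|u.2|)%:E).
  by apply/measurable_EFinP; apply: measurable_funM; apply: measurableT_comp.
have mn : measurable_fun setT (fun y : R => (`|y|)%:E).
  by apply/measurable_EFinP; exact: normr_measurable.
have pushE (X1 : {RV P >-> R}) : (forall w, (0 <= X1 w)%R) ->
    \int[distribution P X1]_x (`|x|)%:E = \int[P]_w (X1 w)%:E.
  move=> X10; rewrite ge0_integral_pushforward//=.
  by apply: eq_integral => w _; rewrite /= ger0_norm.
have E : \int[nu]_u (`|u.1| * `|u.2|)%:E = \int[P]_w (X w * Y w)%:E.
  rewrite (ge0_integral_density mXY (measurable_cst (1%R : R)) (fun=> ler01) nuE mabs).
    by apply: eq_integral => w _; rewrite /= mule1 !ger0_norm.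
  by move=> u; rewrite lee_fin mulr_ge0.
rewrite -E fubini_tonelli1//.
rewrite /fubini_F/=; under eq_integral.
  move=> x _; under eq_integral do rewrite EFinM.
  rewrite ge0_integralZl//; over.
rewrite ge0_integralZr//; last by apply: integral_ge0 => y _; rewrite lee_fin.
by rewrite !pushE.
Qed.

(** The common second moment [s] may be infinite. The decomposition around 0 turns the variance into
    the second moment of [f] minus the finite [e ^+ 2], so it suffices to bound that second moment
    by [s / L + e ^+ 2]. *)
Lemma variance_average (L : nat) (X : 'I_L -> T -> R) (f : T -> R) (e : R) (s : \bar R) :
  (0 < L)%N -> (forall i, measurable_fun setT (X i)) ->
  (forall i w, (0 <= X i w)%R) ->
  (forall i, \int[P]_w (X i w)%:E = e%:E) ->
  (forall i, \int[P]_w ((X i w) ^+ 2)%:E = s) ->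
  (forall i j, i != j ->
    \int[P]_w (X i w * X j w)%:E = \int[P]_w (X i w)%:E * \int[P]_w (X j w)%:E) ->
  (forall w, f w = (L%:R^-1 * \sum_(i < L) X i w)%R) ->
  \int[P]_w ((f w - Rintegral P setT f) ^+ 2)%:E <= (L%:R^-1)%:E * s.
Proof.
move=> L0 mX X0 Xe Xs Xij fX.
have L1 : (L%:R : R) != 0%R by rewrite pnatr_eq0 -lt0n.
have LV0 : (0 <= L%:R^-1 :> R)%R by rewrite invr_ge0.
have mf : measurable_fun setT f.
  have -> : f = (fun w => L%:R^-1 * \sum_(i < L) X i w)%R by exact/funext/fX.
  by apply: measurable_funM => //; exact: measurable_sum.
have fE : \int[P]_w (f w)%:E = e%:E.
  under eq_integral do rewrite fX EFinM -sumEFin.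
  rewrite ge0_integralZl//; last 2 first.
  - by apply: emeasurable_sum => i; exact/measurable_EFinP.
  - by move=> w _; apply: sume_ge0 => i _; rewrite lee_fin.
  rewrite ge0_integral_sum//; last 2 first.
  - by move=> i; exact/measurable_EFinP.
  - by move=> i w _; rewrite lee_fin.
  under eq_bigr do rewrite Xe.
  rewrite sumEFin sumr_const card_ord -EFinM; congr EFin.
  by rewrite -[(e *+ L)%R]mulr_natl mulrA mulVf// mul1r.
have f0 w : (0 <= f w)%R by rewrite fX mulr_ge0// sumr_ge0.
have fi : P.-integrable setT (EFin \o f).
  apply/integrableP; split; first exact/measurable_EFinP.
  by under eq_integral do rewrite /= ger0_norm//; rewrite fE ltry.
have mE : Rintegral P setT f = e by rewrite /Rintegral fE.
have e0 : (0 <= e)%R.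
  by rewrite -lee_fin -fE; apply: integral_ge0 => w _; rewrite lee_fin.
have s0 : 0 <= s.
  by rewrite -(Xs (Ordinal L0)); apply: integral_ge0 => w _; rewrite lee_fin sqr_ge0.
have := bias_variance_decomposition 0 fi.
rewrite mE /=; under eq_integral do rewrite sub0r sqrrN.
rewrite sub0r sqrrN => dec.
rewrite -(@leeD2rE _ (e ^+ 2)%:E)// -dec.
have f2 w : ((f w) ^+ 2)%:E =
    ((L%:R^-1) ^+ 2)%:E * \sum_(i < L) \sum_(j < L) (X i w * X j w)%:E.
  rewrite fX exprMn EFinM; congr (_ * _); rewrite expr2 mulr_suml -sumEFin.
  by apply: eq_bigr => i _; rewrite mulr_sumr sumEFin.
under eq_integral do rewrite f2.
rewrite ge0_integralZl//; last 2 first.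
- apply: emeasurable_sum => i; apply: emeasurable_sum => j.
  by apply/measurable_EFinP; exact: measurable_funM.
- by move=> w _; do 2 (apply: sume_ge0 => ? _); rewrite lee_fin mulr_ge0.
rewrite ge0_integral_sum//; last 2 first.
- move=> i; apply: emeasurable_sum => j.
  by apply/measurable_EFinP; exact: measurable_funM.
- by move=> i w _; apply: sume_ge0 => ? _; rewrite lee_fin mulr_ge0.
apply: (@le_trans _ _ (((L%:R^-1) ^+ 2)%:E * \sum_(i < L) (s + (L%:R * e ^+ 2)%:E))).
  apply: lee_wpmul2l; first by rewrite lee_fin sqr_ge0.
  apply: lee_sum => i _.
  rewrite ge0_integral_sum//; last 2 first.
  - by move=> j; apply/measurable_EFinP; exact: measurable_funM.
  - by move=> j w _; rewrite lee_fin mulr_ge0.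
  rewrite (bigD1 i)//= -(Xs i); apply: leeD => //.
  rewrite (eq_bigr (fun=> (e ^+ 2)%:E)); last first.
    by move=> j ji; rewrite Xij 1?eq_sym// !Xe -EFinM.
  (* Adding the missing diagonal index gives [L * e ^+ 2] per row, which after scaling by [L ^- 2]
     sums to exactly [e ^+ 2]. *)
  apply: (@le_trans _ _ (\sum_(j < L) (e ^+ 2)%:E)).
    by rewrite [leRHS](bigD1 i)//= leeDr// lee_fin sqr_ge0.
  by rewrite sumEFin sumr_const card_ord lee_fin -[leLHS]mulr_natl.
have -> : \sum_(i < L) (s + (L%:R * e ^+ 2)%:E) = L%:R%:E * (s + (L%:R * e ^+ 2)%:E).
  rewrite mule_natl big_const_ord; set x := _ + _; elim: (L) => [|n]; first by rewrite mule0n.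
  by rewrite muleS /= => ->.
rewrite muleA -EFinM (_ : (L%:R^-1 ^+ 2 * L%:R = L%:R^-1 :> R)%R); last by field.
rewrite ge0_muleDr ?lee_fin ?mulr_ge0 ?sqr_ge0//.
by rewrite -EFinM mulrA mulVf// mul1r.
Qed.
End squared_error.

(** * Integration against a conditional density *)

Section conditional_density.
Local Open Scope ereal_scope.
Context dO (Om : measurableType dO) dY (Y : measurableType dY)
  d (T : measurableType d) (R : realType).
Variables (P : probability T R) (nu : {sigma_finite_measure set Y -> \bar R}).
Variables (U : T -> Om) (V : T -> Y) (g : Om -> Y -> R).
Hypotheses (mU : measurable_fun setT U) (mV : measurable_fun setT V).
Hypothesis mg : measurable_fun setT (fun u : Om * Y => g u.1 u.2).
Hypothesis g0 : forall o y, (0 <= g o y)%R.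
Hypothesis cond_law : forall A B, measurable A -> measurable B ->
  P ((U @^-1` A) `&` (V @^-1` B)) =
  \int[P]_(w in U @^-1` A) \int[nu]_(y in B) (g (U w) y)%:E.

Let mgU : measurable_fun setT (fun z : T * Y => g (U z.1) z.2).
Proof.
have mh : measurable_fun setT (fun z : T * Y => (U z.1, z.2)).
  by apply: measurable_fun_pair => //; exact: measurableT_comp.
exact: (measurableT_comp mg mh).
Qed.

Let mUV : measurable_fun setT (fun w => (U w, V w)).
Proof. exact: measurable_fun_pair. Qed.

Let mU1 : measurable_fun setT (fun z : T * Y => (U z.1, z.2)).
Proof. by apply: measurable_fun_pair => //; exact: measurableT_comp. Qed.

Let gU0 (z : T * Y) : (0 <= g (U z.1) z.2)%R. Proof. exact: g0. Qed.

Let cst1 := measurable_cst (1%R : R) : measurable_fun setT (cst (1%R : R) : T -> R).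

(** Joint law of [(U, V)]. *)
Let mu1 : {measure set (Om * Y) -> \bar R} :=
  measure_of_density P mUV cst1 (fun=> ler01).

Let mu1E C : measurable C -> mu1 C = P ((fun w => (U w, V w)) @^-1` C).
Proof.
move=> mC.
transitivity (\int[P]_(x in (fun w => (U w, V w)) @^-1` C) cst 1%E x) => //.
rewrite integral_cst ?mul1e//.
by rewrite -(setTI (_ @^-1` _)); exact: mUV.
Qed.

Let mu1_rect A B : measurable A -> measurable B ->
  mu1 (A `*` B) = \int[P \x nu]_(z in (fun z => (U z.1, z.2)) @^-1` (A `*` B))
    (g (U z.1) z.2)%:E.
Proof.
move=> mA mB; rewrite mu1E; last exact: measurableX.
have mUA : measurable (U @^-1` A) by rewrite -(setTI (_ @^-1` _)); exact: mU.
transitivity (\int[P]_(w in U @^-1` A) \int[nu]_(y in B) (g (U w) y)%:E).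
  exact: cond_law.
have -> : (fun z : T * Y => (U z.1, z.2)) @^-1` (A `*` B) = U @^-1` A `*` B by [].
rewrite [RHS]integral_mkcond.
have mF : measurable_fun setT ((fun z : T * Y => (g (U z.1) z.2)%:E) \_ (U @^-1` A `*` B)).
  apply/(measurable_restrictT _ _).1; first exact: measurableX.
  by apply: measurable_funTS; exact/measurable_EFinP.
have F0 z : 0 <= ((fun z : T * Y => (g (U z.1) z.2)%:E) \_ (U @^-1` A `*` B)) z.
  by rewrite patchE; case: ifPn => // _; rewrite lee_fin.
rewrite (fubini_tonelli1 _ mF F0) integral_mkcond.
apply: eq_integral => w _; rewrite /fubini_F patchE; case: ifPn => wA.
  rewrite [LHS]integral_mkcond; apply: eq_integral => y _; rewrite !patchE in_setX/=.
  by rewrite wA.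
rewrite [RHS]integral0_eq// => y _; rewrite patchE in_setX /=.
by rewrite (negbTE wA).
Qed.

(** The hypothesis [cond_law] determines the joint law on rectangles; these are stable under
    intersection and the law is finite, so it is determined everywhere. *)
Lemma ge0_integral_conditional_density (f : Om -> Y -> \bar R) :
  measurable_fun setT (fun u : Om * Y => f u.1 u.2) -> (forall o y, 0 <= f o y) ->
  \int[P]_w f (U w) (V w) = \int[P]_w \int[nu]_y (f (U w) y * (g (U w) y)%:E).
Proof.
move=> mf f0.
have mu1_density C : measurable C ->
    mu1 C = \int[P \x nu]_(z in (fun z => (U z.1, z.2)) @^-1` C) (g (U z.1) z.2)%:E.
  pose mu2 := measure_of_density (P \x nu)%E mU1 mgU gU0.
  pose G : set (set (Om * Y)) :=
    [set C | exists A, measurable A /\ exists B, measurable B /\ C = A `*` B].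
  move=> mC; apply: (measure_unique G (fun=> setT) _ _ _ _ mu1 mu2) => //.
  - rewrite measurable_prod_measurableType //; congr (<<s _ >>).
    rewrite predeqE; split => [[A mA [B mB <-]]|[A [mA [B [mB ->]]]]].
      by exists A; split => //; exists B.
    by exists A => //; exists B.
  - move=> /= _ _ [X1 [mX1 [X2 [mX2 ->]]]] [Y1 [mY1 [Y2 [mY2 ->]]]].
    rewrite -setXI; exists (X1 `&` Y1); split; first exact: measurableI.
    by exists (X2 `&` Y2); split => //; exact: measurableI.
  - by move=> _; exists setT; split => //; exists setT; split => //; rewrite setXTT.
  - by apply/seteqP; split => // z _; exists 0%N.
  - by move=> _ [A [mA [B [mB ->]]]]; exact: mu1_rect.
  - by move=> _; rewrite mu1E// preimage_setT probability_setT ltry.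
rewrite (_ : \int[P]_w f (U w) (V w) = \int[mu1]_u f u.1 u.2); last first.
  rewrite (ge0_integral_density (mu := P) mUV cst1 (fun=> ler01) (nu := mu1) (fun _ _ => erefl) mf)//.
  by apply: eq_integral => w _; rewrite /= mule1.
rewrite (ge0_integral_density mU1 mgU gU0 mu1_density mf)//.
rewrite fubini_tonelli1//.
- apply: emeasurable_funM; last exact/measurable_EFinP.
  exact: (measurableT_comp mf mU1).
- by move=> z; rewrite mule_ge0// lee_fin.
Qed.

(** A test function that ignores the second variable shows that, under [P], the mass of [g (U w)]
    may be inserted or removed as if it were 1. *)
Lemma ge0_integral_conditional_mass (f : Om -> \bar R) :
  measurable_fun setT f -> (forall o, 0 <= f o) ->
  \int[P]_w (f (U w) * \int[nu]_y (g (U w) y)%:E) = \int[P]_w f (U w).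
Proof.
move=> mf f0.
rewrite (@ge0_integral_conditional_density (fun o _ => f o))//; last first.
  exact: (measurableT_comp mf measurable_fst).
apply: eq_integral => w _; rewrite ge0_integralZl//.
- exact/measurable_EFinP/(measurableT_comp mg (pair1_measurable (U w))).
- by move=> y _; rewrite lee_fin.
Qed.

End conditional_density.

Section laws.
Local Open Scope ereal_scope.
Context {R : realType} d (T : measurableType d) dS (S : measurableType dS).

Lemma ge0_integral_law_density (P : probability T R) (m : {measure set S -> \bar R})
    (Z : T -> S) (p : S -> R) (f : S -> \bar R) :
  measurable_fun setT Z -> measurable_fun setT p -> (forall z, (0 <= p z)%R) ->
  (forall C, measurable C -> P (Z @^-1` C) = \int[m]_(z in C) (p z)%:E) ->
  measurable_fun setT f -> (forall z, 0 <= f z) ->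
  \int[P]_w f (Z w) = \int[m]_z (f z * (p z)%:E).
Proof.
move=> mZ mp p0 PE mf f0.
pose nu1 := measure_of_density m (@measurable_id _ S setT) mp p0.
rewrite -[RHS](ge0_integral_density (@measurable_id _ S setT) mp p0 (nu := nu1)
  (fun _ _ => erefl) mf f0).
rewrite (ge0_integral_density (mu := P) mZ (measurable_cst (1%R : R)) (fun=> ler01) (nu := nu1)
  _ mf f0); first by apply: eq_integral => w _; rewrite /= mule1.
move=> C mC; rewrite [RHS](_ : _ = \int[P]_(x in Z @^-1` C) cst 1%E x)//.
rewrite integral_cst; last by rewrite -(setTI (_ @^-1` _)); exact: (mZ measurableT).
by rewrite [RHS]mul1e; exact/esym/PE.
Qed.

Lemma ge0_integral_eq_law d' (T' : measurableType d') (P : probability T R)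
    (P' : probability T' R) (Z : T -> S) (Z' : T' -> S) (f : S -> \bar R) :
  measurable_fun setT Z -> measurable_fun setT Z' ->
  (forall A, measurable A -> P' (Z' @^-1` A) = P (Z @^-1` A)) ->
  measurable_fun setT f -> (forall z, 0 <= f z) ->
  \int[P']_w f (Z' w) = \int[P]_w f (Z w).
Proof.
move=> mZ mZ' PE mf f0.
pose nu1 := measure_of_density P mZ (measurable_cst (1%R : R)) (fun=> ler01).
transitivity (\int[nu1]_z f z).
  rewrite (ge0_integral_density (mu := P') mZ' (measurable_cst (1%R : R)) (fun=> ler01)
    (nu := nu1) _ mf f0); first by apply: eq_integral => w _; rewrite /= mule1.
  move=> C mC; rewrite [LHS](_ : _ = \int[P]_(x in Z @^-1` C) cst 1%E x)//.
  rewrite [RHS](_ : _ = \int[P']_(x in Z' @^-1` C) cst 1%E x)//.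
  rewrite integral_cst; last by rewrite -(setTI (_ @^-1` _)); exact: (mZ measurableT).
  rewrite integral_cst; last by rewrite -(setTI (_ @^-1` _)); exact: mZ'.
  by congr (1 * _); exact/esym/PE.
rewrite (ge0_integral_density (mu := P) mZ (measurable_cst (1%R : R)) (fun=> ler01)
    (nu := nu1) (fun _ _ => erefl) mf f0).
by apply: eq_integral => w _; rewrite /= mule1.
Qed.

(** The product measure of the exceptional set is the integral of the measures of its sections, all
    of which vanish. *)
Lemma ae_product (m1 : {measure set T -> \bar R}) (m2 : {sigma_finite_measure set S -> \bar R})
    (A : set (T * S)) :
  measurable A -> (forall x, {ae m2, forall y, A (x, y)}) ->
  {ae (m1 \x m2), forall z, A z}.
Proof.
move=> mA A_ae.
apply/negligibleP; first exact: measurableC.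
rewrite [LHS](_ : _ = \int[m1]_x m2 (xsection (~` A) x))//.
apply: integral0_eq => x _.
have mx : measurable (xsection (~` A) x) by apply: measurable_xsection; exact: measurableC.
apply/negligibleP => //; apply: negligibleS (A_ae x).
by move=> y; rewrite /xsection /= inE.
Qed.

End laws.

(** * The hybrid estimator for an abstract observation *)

Section hybrid_estimator.
Local Open Scope ereal_scope.
Context {R : realType} {N : nat} (H : R) (c : 'I_N -> R).
Hypotheses (hH : (0 < H)%R) (hc : forall i, (0 < c i)%R).
Context dO (Om : measurableType dO) dY (Y : measurableType dY) d (T : measurableType d).
Variables (P : probability T R) (nu : {sigma_finite_measure set Y -> \bar R}).
Variables (X : Om -> 'cV[R]_N) (g : Om -> Y -> R) (U : T -> Om) (V : T -> Y).
Variable p : 'cV[R]_N -> Y -> R.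
Hypotheses (mX : measurable_fun setT X) (mU : measurable_fun setT U)
  (mV : measurable_fun setT V).
Hypothesis mg : measurable_fun setT (fun u : Om * Y => g u.1 u.2).
Hypothesis g0 : forall o y, (0 <= g o y)%R.
Hypothesis mp : measurable_fun setT (fun z : 'cV[R]_N * Y => p z.1 z.2).
Hypothesis p0 : forall x y, (0 <= p x y)%R.
Hypothesis cond_law : forall A B, measurable A -> measurable B ->
  P ((U @^-1` A) `&` (V @^-1` B)) =
  \int[P]_(w in U @^-1` A) \int[nu]_(y in B) (g (U w) y)%:E.
Hypothesis joint_law : forall C, measurable C ->
  P ((fun w => (X (U w), V w)) @^-1` C) =
  \int[lebesgue_cV N \x nu]_(z in C) (p z.1 z.2)%:E.

Local Notation leb := (lebesgue_cV N).
Local Notation K := (gauss_kernel H c).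

Let kernel_term (u : 'cV[R]_N * Y) (o : Om) : R := (K (u.1 - X o) * g o u.2)%R.

Let K0 x : (0 <= K x)%R. Proof. exact: gauss_kernel_ge0. Qed.

Let mK d1 (T1 : measurableType d1) (a b : T1 -> 'cV[R]_N) :
  measurable_fun setT a -> measurable_fun setT b ->
  measurable_fun setT (fun t => K (a t - b t)).
Proof.
move=> ma mb; apply: (measurableT_comp (measurable_gauss_kernel hH hc)).
apply: measurable_fun_matrix => i j; under eq_fun do rewrite !mxE.
by apply: measurable_funB; apply: (measurableT_comp (measurable_entry i j)).
Qed.

Let kernel_term0 u o : (0 <= kernel_term u o)%R.
Proof. by rewrite mulr_ge0. Qed.

Let measurable_kernel_term :
  measurable_fun setT (fun t : ('cV[R]_N * Y) * Om => kernel_term t.1 t.2).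
Proof.
apply: measurable_funM.
  apply: (mK (a := fun t : ('cV[R]_N * Y) * Om => t.1.1) (b := fun t => X t.2)).
    exact: (measurableT_comp measurable_fst measurable_fst).
  exact: (measurableT_comp mX measurable_snd).
have mh : measurable_fun setT (fun t : ('cV[R]_N * Y) * Om => (t.2, t.1.2)).
  by apply: measurable_fun_pair => //; exact: (measurableT_comp measurable_snd measurable_fst).
exact: (measurableT_comp mg mh).
Qed.

(** Mean of one summand of the estimator at [u], to be identified almost everywhere with the
    smoothed joint density [q']. Both are extended real valued, as neither need be finite at every
    point. *)
Let q (u : 'cV[R]_N * Y) : \bar R := \int[P]_w (kernel_term u (U w))%:E.

Let q' (u : 'cV[R]_N * Y) : \bar R := \int[leb]_z (K z * p (u.1 + z)%R u.2)%:E.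

Let mq : measurable_fun setT q.
Proof.
have mh : measurable_fun setT (fun t : ('cV[R]_N * Y) * T => (t.1, U t.2)).
  by apply: measurable_fun_pair => //; exact: (measurableT_comp mU measurable_snd).
have mF : measurable_fun setT (fun t : ('cV[R]_N * Y) * T => (kernel_term t.1 (U t.2))%:E).
  apply/measurable_EFinP; exact: (measurableT_comp measurable_kernel_term mh).
have F0 (t : ('cV[R]_N * Y) * T) : 0 <= (kernel_term t.1 (U t.2))%:E by rewrite lee_fin.
exact: (measurable_fun_fubini_tonelli_F (m2 := P)
  (fun t : ('cV[R]_N * Y) * T => (kernel_term t.1 (U t.2))%:E) mF F0).
Qed.

Let mq' : measurable_fun setT q'.
Proof.
have mh : measurable_fun setT (fun t : ('cV[R]_N * Y) * 'cV[R]_N => ((t.1.1 + t.2)%R, t.1.2)).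
  apply: measurable_fun_pair => /=; last exact: (measurableT_comp measurable_snd measurable_fst).
  apply: measurable_fun_matrix => i j; under eq_fun do rewrite !mxE.
  apply: measurable_funD; apply: (measurableT_comp (measurable_entry i j)) => //.
  exact: (measurableT_comp measurable_fst measurable_fst).
have mF : measurable_fun setT
    (fun t : ('cV[R]_N * Y) * 'cV[R]_N => (K t.2 * p (t.1.1 + t.2)%R t.1.2)%:E).
  apply/measurable_EFinP; apply: measurable_funM; last exact: (measurableT_comp mp mh).
  exact: (measurableT_comp (measurable_gauss_kernel hH hc) measurable_snd).
have F0 (t : ('cV[R]_N * Y) * 'cV[R]_N) : 0 <= (K t.2 * p (t.1.1 + t.2)%R t.1.2)%:E.
  by rewrite lee_fin mulr_ge0.
exact: (measurable_fun_fubini_tonelli_F (m2 := leb)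
  (fun t : ('cV[R]_N * Y) * 'cV[R]_N => (K t.2 * p (t.1.1 + t.2)%R t.1.2)%:E) mF F0).
Qed.

Let integral_q x B : measurable B ->
  \int[nu]_(y in B) q (x, y) = \int[P]_w (K (x - X (U w)) * \1_B (V w))%:E.
Proof.
move=> mB.
rewrite (@ge0_integral_conditional_density _ Om _ Y _ T R P nu U V g mU mV mg g0 cond_law
  (fun o y => (K (x - X o) * \1_B y)%:E)); last 2 first.
- apply/measurable_EFinP; apply: measurable_funM; last exact: measurableT_comp.
  apply: mK; [exact: measurable_cst|exact: (measurableT_comp mX measurable_fst)].
- by move=> o y; rewrite lee_fin mulr_ge0.
rewrite integral_mkcond epatch_indic.
pose F (t : T * Y) := (kernel_term (x, t.2) (U t.1) * \1_B t.2)%:E.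
have mh : measurable_fun setT (fun t : T * Y => ((x, t.2), U t.1)).
  apply: measurable_fun_pair; last exact: (measurableT_comp mU measurable_fst).
  exact: measurable_fun_pair.
have mkt : measurable_fun setT (fun t : T * Y => kernel_term (x, t.2) (U t.1)).
  exact: (measurableT_comp measurable_kernel_term mh).
have mF : measurable_fun setT F.
  apply/measurable_EFinP; apply: measurable_funM; first exact: mkt.
  exact: measurableT_comp.
have F0 t : 0 <= F t by rewrite lee_fin mulr_ge0.
transitivity (\int[nu]_y \int[P]_w F (w, y)).
  apply: eq_integral => y _; rewrite /q -ge0_integralZr ?lee_fin//.
    apply/measurable_EFinP; exact: (measurableT_comp mkt (pair2_measurable y)).
  by move=> w _; rewrite lee_fin.
rewrite -(fubini_tonelli (m1 := P) (m2 := nu) F mF F0).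
apply: eq_integral => w _; apply: eq_integral => y _.
by rewrite /F -EFinM /kernel_term/= mulrAC.
Qed.

Let integral_q' x B : measurable B ->
  \int[nu]_(y in B) q' (x, y) = \int[P]_w (K (x - X (U w)) * \1_B (V w))%:E.
Proof.
move=> mB.
pose f (z : 'cV[R]_N * Y) := (K (x - z.1) * \1_B z.2)%:E.
have mf : measurable_fun setT f.
  apply/measurable_EFinP; apply: measurable_funM; last exact: measurableT_comp.
  by apply: mK => //; exact: measurable_cst.
have f0 z : 0 <= f z by rewrite lee_fin mulr_ge0.
have mXU : measurable_fun setT (fun w => (X (U w), V w)).
  by apply: measurable_fun_pair => //; exact: measurableT_comp.
rewrite (ge0_integral_law_density (m := (leb \x nu)%E) mXU mp (fun z => p0 z.1 z.2)
  joint_law mf f0).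
have mfp : measurable_fun setT (fun z : 'cV[R]_N * Y => f z * (p z.1 z.2)%:E).
  by apply: emeasurable_funM => //; exact/measurable_EFinP.
have fp0 (z : 'cV[R]_N * Y) : 0 <= f z * (p z.1 z.2)%:E by rewrite mule_ge0// lee_fin.
rewrite (fubini_tonelli2 _ mfp fp0) integral_mkcond epatch_indic.
apply: eq_integral => y _; rewrite /fubini_G /q' /=.
have mpy : measurable_fun setT (p ^~ y) := measurableT_comp mp (pair2_measurable y).
rewrite -(ge0_integral_cV_shift x (f := fun z => f (z, y) * (p z y)%:E)); last 2 first.
- exact: (measurableT_comp mfp (pair2_measurable y)).
- by move=> z; exact: (fp0 (z, y)).
rewrite -ge0_integralZr ?lee_fin//; last 2 first.
- apply/measurable_EFinP; apply: measurable_funM; first exact: measurable_gauss_kernel.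
  under eq_fun do rewrite addrC.
  by apply: (measurableT_comp mpy); exact: measurable_cV_add.
- by move=> z _; rewrite lee_fin mulr_ge0.
apply: eq_integral => z _; rewrite /f /= -!EFinM; congr EFin.
by rewrite opprD addrCA subrr addr0 gauss_kernelN [(z + x)%R]addrC mulrAC.
Qed.

(* For fixed [x] both sides have the same integral over every measurable set of
   [y], by the conditional law on the left and the joint density on the right. *)
Let mean_kernel_ae : {ae (leb \x nu), forall u, q u = q' u /\ q' u < +oo}.
Proof.
(* Equality and finiteness are gathered into one measurable set, so that null sections in [y] yield
   a null set in the product. *)
pose A := ~` [set u | q u != q' u] `&` ~` (q' @^-1` [set +oo]).
have mA : measurable A.
  apply: measurableI; apply: measurableC.
    by rewrite -[X in measurable X]setTI; exact: measurable_neqe.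
  by rewrite -[X in measurable X]setTI; exact: mq'.
suff A_ae x : {ae nu, forall y, A (x, y)}.
  apply: filterS (ae_product leb mA A_ae) => u [/= /negP].
  by rewrite negbK => /eqP-> /eqP qy; rewrite ltey.
have mqx : measurable_fun setT (fun y => q (x, y)) := measurableT_comp mq (pair1_measurable x).
have mqx' : measurable_fun setT (fun y => q' (x, y)) := measurableT_comp mq' (pair1_measurable x).
have q'0 y : 0 <= q' (x, y) by apply: integral_ge0 => z _; rewrite lee_fin mulr_ge0.
(* Equal integrals over all measurable sets force equality almost everywhere for an integrable
   function. Here the integral is at most the maximum of the kernel, since [P] has mass 1;
   finiteness almost everywhere comes along. *)
have q'i : nu.-integrable setT (fun y => q' (x, y)).
  apply/integrableP; split => //; under eq_integral do rewrite gee0_abs//.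
  rewrite integral_q'//.
  apply: (@le_lt_trans _ _ (\int[P]_w (cst ((\prod_i (pi * H * c i ^+ 2)) `^ (- 2^-1))%R%:E w))).
    apply: ge0_le_integral => //.
    - by move=> w _; rewrite lee_fin mulr_ge0.
    - apply/measurable_EFinP; apply: measurable_funM; last exact: measurableT_comp.
      by apply: mK; [exact: measurable_cst|exact: measurableT_comp].
    - move=> w _; rewrite lee_fin indicT/= mulr1; exact: gauss_kernel_le.
  by rewrite integral_cst//= probability_setT mule1 ltry.
have qE : ae_eq nu setT (fun y => q' (x, y)) (fun y => q (x, y)).
  by apply: integral_ae_eq => // E _ mE; rewrite integral_q// integral_q'.
apply: filterS2 qE (integrable_ae measurableT q'i) => y /(_ I) qyE /(_ I) fy.
split; first by rewrite /= qyE eqxx.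
by move=> /= qu; rewrite qu in fy.
Qed.

Context d' (T' : measurableType d') (P' : probability T' R) (L : nat).
Variables (Yi : 'I_L -> T' -> Om) (gb : Om -> R).
Hypothesis L0 : (0 < L)%N.
Hypothesis mYi : forall i, measurable_fun setT (Yi i).
Hypothesis sample_law : forall i A, measurable A -> P' (Yi i @^-1` A) = P (U @^-1` A).
Hypothesis sample_indep : forall i j, i != j -> forall A B, measurable A -> measurable B ->
  P' ((Yi i @^-1` A) `&` (Yi j @^-1` B)) = P' (Yi i @^-1` A) * P' (Yi j @^-1` B).
Hypothesis mgb : measurable_fun setT gb.
Hypothesis gb0 : forall o, (0 <= gb o)%R.
Hypothesis g_le : {ae P, forall w, forall y, (g (U w) y <= gb (U w))%R}.

Let phat (w : T') (u : 'cV[R]_N * Y) : R :=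
  (L%:R^-1 * \sum_(i < L) kernel_term u (Yi i w))%R.

Let pbar (u : 'cV[R]_N * Y) : R := Rintegral P' setT (fun w => phat w u).

Let mkY i u : measurable_fun setT (fun w => kernel_term u (Yi i w)).
Proof.
exact: (measurableT_comp (measurableT_comp measurable_kernel_term (pair1_measurable u)) (mYi i)).
Qed.

Let mphat : measurable_fun setT (fun v : T' * ('cV[R]_N * Y) => phat v.1 v.2).
Proof.
apply: measurable_funM => //; apply: measurable_sum => i.
have mh : measurable_fun setT (fun v : T' * ('cV[R]_N * Y) => (v.2, Yi i v.1)).
  by apply: measurable_fun_pair => //; exact: (measurableT_comp (mYi i) measurable_fst).
exact: (measurableT_comp measurable_kernel_term mh).
Qed.

Let phat0 w u : (0 <= phat w u)%R.
Proof. by rewrite mulr_ge0 ?invr_ge0 ?sumr_ge0. Qed.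

Let mpbar : measurable_fun setT pbar.
Proof.
apply: (measurableT_comp (fine_measurable measurableT)).
apply: (measurable_fun_fubini_tonelli_G (m1 := P')
  (fun v : T' * ('cV[R]_N * Y) => (phat v.1 v.2)%:E)) => [|v].
- exact/measurable_EFinP.
- by rewrite lee_fin.
Qed.

(** The summands are transferred to a single copy [U] of the observation; the identity for [h] gives
    their means, the square their second moments. *)
Let integral_sample i u (h : R -> R) : measurable_fun setT h -> (forall r, (0 <= r)%R -> (0 <= h r)%R) ->
  \int[P']_w (h (kernel_term u (Yi i w)))%:E = \int[P]_w (h (kernel_term u (U w)))%:E.
Proof.
move=> mh h0; apply: (ge0_integral_eq_law (f := fun o => (h (kernel_term u o))%:E) mU (mYi i)).
- exact: sample_law.
- apply/measurable_EFinP; apply: (measurableT_comp mh).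
  exact: (measurableT_comp measurable_kernel_term (pair1_measurable u)).
- by move=> o; rewrite lee_fin h0.
Qed.

Let integral_sample1 i u : \int[P']_w (kernel_term u (Yi i w))%:E = q u.
Proof.
exact: (integral_sample i u (h := id)).
Qed.

Let integral_phat u : q u < +oo -> \int[P']_w (phat w u)%:E = q u.
Proof.
move=> qfin.
under eq_integral do rewrite EFinM -sumEFin.
rewrite ge0_integralZl//; last 2 first.
- by apply: emeasurable_sum => i; exact/measurable_EFinP.
- by move=> w _; apply: sume_ge0 => i _; rewrite lee_fin.
rewrite ge0_integral_sum//; last 2 first.
- by move=> i; exact/measurable_EFinP.
- by move=> i w _; rewrite lee_fin.
under eq_bigr do rewrite integral_sample1.
have q0 : 0 <= q u by apply: integral_ge0 => w _; rewrite lee_fin.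
rewrite -(@fineK _ (q u)) ?ge0_fin_numE// sumEFin sumr_const card_ord -EFinM; congr EFin.
by rewrite -[(fine (q u) *+ L)%R]mulr_natl mulrA mulVf ?mul1r// pnatr_eq0 -lt0n.
Qed.

Let phat_integrable u : q u < +oo -> P'.-integrable setT (fun w => (phat w u)%:E).
Proof.
move=> qfin; apply/integrableP; split.
  apply/measurable_EFinP.
  exact: (measurableT_comp mphat (pair2_measurable u)).
by under eq_integral do rewrite /= ger0_norm//; rewrite integral_phat.
Qed.

Lemma hybrid_mise :
  \int[P']_w \int[leb \x nu]_u ((p u.1 u.2 - phat w u) ^+ 2)%:E =
  \int[P']_w \int[leb \x nu]_u ((phat w u - pbar u) ^+ 2)%:E +
    \int[leb \x nu]_u ((p u.1 u.2 - pbar u) ^+ 2)%:E.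
Proof.
have := mise_decomposition (P := P') (nu := sigma_finite_product leb nu)
  (f := fun v : T' * ('cV[R]_N * Y) => phat v.1 v.2) (p := fun u => p u.1 u.2).
apply => //.
apply: filterS mean_kernel_ae => u [qE q'fin].
by apply: phat_integrable; rewrite qE.
Qed.

Let variance_pointwise u : q u < +oo ->
  \int[P']_w ((phat w u - pbar u) ^+ 2)%:E <=
  (L%:R^-1)%:E * \int[P]_w ((kernel_term u (U w)) ^+ 2)%:E.
Proof.
move=> qfin.
have q0 : 0 <= q u by apply: integral_ge0 => w _; rewrite lee_fin.
apply: (variance_average (X := fun i w => kernel_term u (Yi i w)) (e := fine (q u))) => //.
- by move=> i; rewrite integral_sample1 fineK// ge0_fin_numE.
- move=> i; apply: (integral_sample i u (h := fun r => (r ^+ 2)%R)).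
    exact: measurable_funX.
  by move=> r _; rewrite sqr_ge0.
- move=> i j ij; apply: integral_mul_independent => // A B mA mB.
  have mk : measurable_fun setT (kernel_term u).
    exact: (measurableT_comp measurable_kernel_term (pair1_measurable u)).
  apply: (sample_indep ij (A := kernel_term u @^-1` A) (B := kernel_term u @^-1` B)).
  - by rewrite -(setTI (_ @^-1` _)); exact: mk.
  - by rewrite -(setTI (_ @^-1` _)); exact: mk.
Qed.

Let kb : R := ((\prod_i (pi * H * c i ^+ 2)) `^ (- 2^-1))%R.

(** The supremum [kb * gb (U w)] is taken out of one factor. The mass of [g (U w)] is left standing,
    because the conditional law evaluates it only under the integral over [P]. *)
Let integral_kernel_term_sqr w : (forall y, (g (U w) y <= gb (U w))%R) ->
  \int[leb \x nu]_u ((kernel_term u (U w)) ^+ 2)%:E <=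
  (kb * gb (U w))%:E * \int[nu]_y (g (U w) y)%:E.
Proof.
move=> gle; have kb0 : (0 <= kb)%R by exact: powR_ge0.
have mgw : measurable_fun setT (g (U w)) := measurableT_comp mg (pair1_measurable (U w)).
have mk : measurable_fun setT (fun u => kernel_term u (U w)).
  exact: (measurableT_comp measurable_kernel_term (pair2_measurable (U w))).
have mKw : measurable_fun setT (fun x : 'cV[R]_N => K (x - X (U w))%R).
  by apply: mK => //; exact: measurable_cst.
apply: (@le_trans _ _ (\int[leb \x nu]_u
    ((kb * gb (U w))%:E * (kernel_term u (U w))%:E))).
  apply: ge0_le_integral => //.
  - by move=> u _; rewrite lee_fin sqr_ge0.
  - by apply/measurable_EFinP; exact: measurable_funX.
  - by apply: measurable_funeM; exact/measurable_EFinP.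
  - move=> u _; rewrite -EFinM lee_fin expr2 ler_wpM2r//.
    by apply: ler_pM => //; exact: gauss_kernel_le.
rewrite ge0_integralZl//; last 3 first.
- exact/measurable_EFinP.
- by move=> u _; rewrite lee_fin.
- by rewrite lee_fin mulr_ge0.
rewrite lee_wpmul2l ?lee_fin ?mulr_ge0//.
have mF : measurable_fun setT (fun u => (kernel_term u (U w))%:E) by exact/measurable_EFinP.
have F0 u : 0 <= (kernel_term u (U w))%:E by rewrite lee_fin.
rewrite (fubini_tonelli2 _ mF F0) le_eqVlt; apply/orP; left; apply/eqP.
apply: eq_integral => y _; rewrite /fubini_G /kernel_term /=.
under eq_integral do rewrite EFinM.
rewrite ge0_integralZr ?lee_fin//; last 2 first.
- exact/measurable_EFinP.
- by move=> x _; rewrite lee_fin.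
rewrite (ge0_integral_cV_shift (- X (U w)) (f := fun x => (K x)%:E)).
- by rewrite integral_gauss_kernel ?mul1e.
- by apply/measurable_EFinP; exact: measurable_gauss_kernel.
- by move=> x; rewrite lee_fin.
Qed.

Lemma hybrid_variance_le :
  \int[P']_w \int[leb \x nu]_u ((phat w u - pbar u) ^+ 2)%:E <=
  (L%:R^-1)%:E * \int[P]_w (kb * gb (U w))%:E.
Proof.
have kb0 : (0 <= kb)%R by exact: powR_ge0.
have L1 : 0 <= (L%:R^-1)%:E :> \bar R by rewrite lee_fin invr_ge0.
pose F (v : T' * ('cV[R]_N * Y)) : \bar R := ((phat v.1 v.2 - pbar v.2) ^+ 2)%:E.
have mF : measurable_fun setT F.
  apply/measurable_EFinP; apply: measurable_funX; apply: measurable_funB => //.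
  exact: (measurableT_comp mpbar measurable_snd).
have F0 v : 0 <= F v by rewrite lee_fin sqr_ge0.
pose G (v : T * ('cV[R]_N * Y)) : \bar R := ((kernel_term v.2 (U v.1)) ^+ 2)%:E.
have mG : measurable_fun setT G.
  apply/measurable_EFinP; apply: measurable_funX.
  have mh : measurable_fun setT (fun v : T * ('cV[R]_N * Y) => (v.2, U v.1)).
    by apply: measurable_fun_pair => //; exact: (measurableT_comp mU measurable_fst).
  exact: (measurableT_comp measurable_kernel_term mh).
have G0 v : 0 <= G v by rewrite lee_fin sqr_ge0.
rewrite (fubini_tonelli (m1 := P') (m2 := sigma_finite_product leb nu) F mF F0 :
  \int[P']_w \int[leb \x nu]_u F (w, u) = _).
apply: (@le_trans _ _ (\int[leb \x nu]_u ((L%:R^-1)%:E * \int[P]_w G (w, u)))).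
  apply: ae_ge0_le_integral => //.
  - by move=> u _; exact: integral_ge0.
  - exact: (measurable_fun_fubini_tonelli_G (m1 := P') F mF F0).
  - by move=> u _; rewrite mule_ge0//; exact: integral_ge0.
  - apply: measurable_funeM.
    exact: (measurable_fun_fubini_tonelli_G (m1 := P) G mG G0).
  - apply: filterS mean_kernel_ae => u [qE q'fin] _.
    by apply: variance_pointwise; rewrite qE.
rewrite ge0_integralZl//; last 2 first.
- exact: (measurable_fun_fubini_tonelli_G (m1 := P) G mG G0).
- by move=> u _; exact: integral_ge0.
apply: lee_wpmul2l => //.
rewrite -(fubini_tonelli (m1 := P) (m2 := sigma_finite_product leb nu) G mG G0 :
  \int[P]_w \int[leb \x nu]_u G (w, u) = _).
have mgbE : measurable_fun setT (fun o => (kb * gb o)%:E).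
  by apply/measurable_EFinP; exact: measurable_funM.
have gbE0 o : 0 <= (kb * gb o)%:E by rewrite lee_fin mulr_ge0.
(* The mass of the conditional density is inserted on the right, to match the spatial bound for each
   [w]. *)
rewrite -(@ge0_integral_conditional_mass _ Om _ Y _ T R P nu U V g mU mV mg g0 cond_law
  (fun o => (kb * gb o)%:E) mgbE gbE0).
apply: ae_ge0_le_integral => //.
- by move=> w _; exact: integral_ge0.
- exact: (measurable_fun_fubini_tonelli_F (m2 := sigma_finite_product leb nu) G mG G0).
- by move=> w _; rewrite mule_ge0//; apply: integral_ge0 => y _; rewrite lee_fin.
- apply: emeasurable_funM; first exact: (measurableT_comp mgbE mU).
  have mh : measurable_fun setT (fun t : T * Y => (U t.1, t.2)).
    by apply: measurable_fun_pair => //; exact: (measurableT_comp mU measurable_fst).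
  apply: (measurable_fun_fubini_tonelli_F (m2 := nu) (fun t : T * Y => (g (U t.1) t.2)%:E)).
    by apply/measurable_EFinP; exact: (measurableT_comp mg mh).
  by move=> t; rewrite lee_fin.
- by apply: filterS g_le => w gw _; exact: integral_kernel_term_sqr.
Qed.

Lemma hybrid_bias_le (M : 'cV[R]_N -> Y -> R) (delta : R) :
  (forall y, times_differentiable 3 (p ^~ y)) ->
  measurable_fun setT (fun u : 'cV[R]_N * Y => M u.1 u.2) ->
  (forall x y (v : 'cV[R]_N), (enorm v <= 1)%R ->
    (`|derive1n 3 (fun s : R => p (x + s *: v) y) 0| <= M x y)%R) ->
  (0 < delta)%R ->
  \int[leb \x nu]_u ((p u.1 u.2 - pbar u) ^+ 2)%:E <=
   ((1 + delta) / 4 * H ^+ 2)%:E * \int[leb \x nu]_u ((\sum_i c i ^+ 2 *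
      'D_(delta_mx i ord0) ('D_(delta_mx i ord0) (p ^~ u.2)) u.1) ^+ 2)%:E +
   ((1 + delta^-1) / 2 * H ^+ 3 * (\sum_i c i ^+ 2) ^+ 3)%:E *
      \int[leb \x nu]_u ((M u.1 u.2) ^+ 2)%:E.
Proof.
move=> p3 mM pM delta0.
have mpb : measurable_fun setT (fun u : 'cV[R]_N * Y => pbar (u.1, u.2)).
  by under eq_fun do rewrite -surjective_pairing.
have := smoothing_bias_L2 hH hc (nu := nu) mp p0 p3 mM pM (pbar := fun x y => pbar (x, y)) mpb
  (delta := delta) _ delta0.
under eq_integral do rewrite -surjective_pairing.
apply; apply: filterS mean_kernel_ae => u [qE q'fin].
split; first exact: q'fin.
by rewrite -surjective_pairing /pbar /Rintegral integral_phat qE.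
Qed.

End hybrid_estimator.

(** * The conditional Gaussian filter *)

Section positive_definite.
Context {R : realType} {n : nat}.

Let quad0 (v : 'cV[R]_n) : 0 <= (v^T *m v) ord0 ord0.
Proof. by rewrite mxE sumr_ge0// => i _; rewrite mxE -expr2 sqr_ge0. Qed.

Let quad_gt0 (v : 'cV[R]_n) : v != 0 -> 0 < (v^T *m v) ord0 ord0.
Proof.
move=> v0; rewrite lt_def quad0 andbT; apply: contra v0.
rewrite mxE psumr_eq0 => [/allP h|i _]; last by rewrite mxE -expr2 sqr_ge0.
apply/eqP/colP => i; rewrite mxE; apply/eqP.
by have := h i (mem_index_enum i); rewrite mxE mulf_eq0 orbb.
Qed.

Lemma posdef_unitmx (S : 'M[R]_n) : posdef S -> S \in unitmx.
Proof.
move=> [_ Spos]; rewrite -row_free_unit -kermx_eq0; apply/eqP/row_matrixP => i.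
rewrite row0; apply/eqP/negPn/negP => r0.
have rT0 : (row i (kermx S))^T != 0.
  by apply: contra r0 => /eqP/(congr1 trmx); rewrite trmxK trmx0 => ->.
by have := Spos _ rT0; rewrite trmxK -row_mul mulmx_ker row0 mul0mx mxE ltxx.
Qed.

(* The determinant does not vanish along the segment from the identity to [S]. *)
Lemma posdef_det_gt0 (S : 'M[R]_n) : posdef S -> 0 < \det S.
Proof.
move=> [Ssym Spos].
(* The determinant along the segment is a polynomial in the parameter, so the intermediate value
   theorem for polynomials applies. *)
pose q : {poly R} := \det ((1 - 'X)%:M + 'X *: map_mx polyC S).
have qE s : q.[s] = \det ((1 - s)%:M + s *: S).
  rewrite -[q.[s]]/(horner_eval s q) -det_map_mx; congr determinant.
  apply/matrixP => i j; rewrite !mxE /= /horner_eval.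
  by rewrite hornerD hornerMn hornerM !hornerE.
have q_neq0 s : 0 <= s <= 1 -> q.[s] != 0.
  move=> /andP[s0 s1]; rewrite qE -unitfE -unitmxE; apply: posdef_unitmx; split.
    by rewrite linearD linearZ /= tr_scalar_mx Ssym.
  move=> v v0; rewrite mulmxDr mulmxDl mul_mx_scalar -scalemxAl -scalemxAr -scalemxAl.
  rewrite mxE [X in X + _]mxE [X in _ + X]mxE.
  have := Spos v v0; have := quad_gt0 v0.
  move: (_ ord0 ord0) (_ ord0 ord0) => a b a0 b0.
  have [->|sn0] := eqVneq s 0; first by rewrite subr0 mul1r mul0r addr0.
  rewrite ltr_wpDl//; first by rewrite mulr_ge0 ?subr_ge0// ltW.
  by rewrite mulr_gt0// lt_def sn0.
rewrite ltNge; apply/negP => dS.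
(* [poly_ivt] expects a sign change from nonpositive to nonnegative, whereas [q] starts at
   [\det 1 = 1]; hence the negation. *)
have [] := @poly_ivt R (- q) 0 1 ler01.
  rewrite !hornerN !qE subr0 subrr scale0r addr0 scale1r raddf0 add0r det1.
  by rewrite oppr_le0 ler01 oppr_ge0.
move=> x x01; rewrite rootN => /eqP; apply/eqP; exact: q_neq0.
Qed.

Lemma posdef_quad_invmx_ge0 (S : 'M[R]_n) (v : 'cV[R]_n) :
  posdef S -> 0 <= (v^T *m invmx S *m v) ord0 ord0.
Proof.
move=> Spd; have Su := posdef_unitmx Spd; have [Ssym Spos] := Spd.
have [z ->] : exists z, v = S *m z by exists (invmx S *m v); rewrite mulKVmx.
rewrite trmx_mul Ssym mulmxK// mulmxA.
have [->|z0] := eqVneq z 0; first by rewrite mulmx0 mxE.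
exact/ltW/Spos.
Qed.

Lemma gauss_density_ge0 (m : 'cV[R]_n) (S : 'M[R]_n) (y : 'cV[R]_n) :
  0 <= gauss_density m S y.
Proof. by rewrite mulr_ge0 ?powR_ge0 ?expR_ge0. Qed.

(** The exponent is nonpositive; replacing [2 * pi] by [pi] loses a factor, just as in
    [gauss_kernel_le]. *)
Lemma gauss_density_le (m : 'cV[R]_n) (S : 'M[R]_n) (y : 'cV[R]_n) :
  posdef S -> gauss_density m S y <= \det (pi *: S) `^ (- 2^-1).
Proof.
move=> Spd; have dS := posdef_det_gt0 Spd.
have pi0 : 0 < pi :> R := pi_gt0 R.
have d1 : 0 < \det (pi *: S) by rewrite detZ mulr_gt0// exprn_gt0.
have d12 : \det (pi *: S) <= \det ((2 * pi) *: S).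
  rewrite !detZ ler_wpM2r ?(ltW dS)//; apply: (lerXn2r n); rewrite ?nnegrE; lra.
apply: (@le_trans _ _ (\det ((2 * pi) *: S) `^ (- 2^-1))).
  rewrite /gauss_density ler_piMr ?powR_ge0// -expR0 ler_expR mulNr oppr_le0.
  by rewrite mulr_ge0// ?posdef_quad_invmx_ge0.
rewrite !powRN lef_pV2 ?posrE ?powR_gt0//; last exact: lt_le_trans d1 d12.
by apply: ge0_ler_powR; rewrite ?nnegrE//; [exact: ltW|exact: le_trans (ltW d1) d12].
Qed.

End positive_definite.

(** * Measurability of matrix functions and of path functionals *)

Section matrix_functions_measurable.
Context {R : realType} d (T : measurableType d).

(** Inversion is written as [f] times the square of a real power of its absolute value; at a zero of
    [f] both sides are 0. *)
Lemma measurable_inv (f : T -> R) :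
  measurable_fun setT f -> measurable_fun setT (fun x => (f x)^-1).
Proof.
move=> mf; rewrite (_ : (fun _ => _) = fun x => f x * (`|f x| `^ (-1)) ^+ 2); last first.
  apply/funext => x; rewrite powR_inv1// exprVn real_normK ?num_real//.
  have [->|fx0] := eqVneq (f x) 0; first by rewrite invr0 mul0r.
  by rewrite expr2 invfM mulrA divff// mul1r.
apply: measurable_funM => //; apply: measurable_funX.
by apply: (measurableT_comp (measurable_powR (-1))); exact: measurableT_comp.
Qed.

Lemma measurable_det n (A : T -> 'M[R]_n) :
  measurable_fun setT A -> measurable_fun setT (fun x => \det (A x)).
Proof.
move=> mA; rewrite /determinant; apply: measurable_sum => s.
apply: measurable_funM => //; apply: measurable_prod => i _.
exact: (measurableT_comp (measurable_entry i _) mA).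
Qed.

Lemma measurable_mulmx m n k (A : T -> 'M[R]_(m, n)) (B : T -> 'M[R]_(n, k)) :
  measurable_fun setT A -> measurable_fun setT B ->
  measurable_fun setT (fun x => A x *m B x).
Proof.
move=> mA mB; apply: measurable_fun_matrix => i j; under eq_fun do rewrite mxE.
apply: measurable_sum => l; apply: measurable_funM.
- exact: (measurableT_comp (measurable_entry i l) mA).
- exact: (measurableT_comp (measurable_entry l j) mB).
Qed.

Lemma measurable_scalemx m n (a : R) (A : T -> 'M[R]_(m, n)) :
  measurable_fun setT A -> measurable_fun setT (fun x => a *: A x).
Proof.
move=> mA; apply: measurable_fun_matrix => i j; under eq_fun do rewrite mxE.
apply: measurable_funM => //; exact: (measurableT_comp (measurable_entry i j) mA).
Qed.

Lemma measurable_invmx n (A : T -> 'M[R]_n) :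
  measurable_fun setT A -> measurable_fun setT (fun x => invmx (A x)).
Proof.
move=> mA; apply: measurable_fun_matrix => i j.
have mdet := measurable_det mA.
(* [invmx] returns a singular matrix unchanged, which the second summand reproduces; there the first
   one vanishes because [0^-1 = 0]. *)
rewrite (_ : (fun _ => _) = fun x => (\det (A x))^-1 * \adj (A x) i j +
    \1_[set 0] (\det (A x)) * A x i j); last first.
  apply/funext => x; rewrite /invmx unitmxE unitfE indicE.
  have [d0|d0] := eqVneq (\det (A x)) 0.
    by rewrite d0 invr0 mul0r add0r mem_set// mul1r.
  by rewrite memNset ?mul0r ?addr0 ?mxE//=; apply/eqP.
apply: measurable_funD; apply: measurable_funM.
- exact: measurable_inv.
- under eq_fun do rewrite mxE /cofactor.
  apply: measurable_funM => //; apply: measurable_det.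
  apply: measurable_fun_matrix => k l; under eq_fun do rewrite !mxE.
  exact: (measurableT_comp (measurable_entry _ _) mA).
- by apply: measurableT_comp => //; exact: measurable_indic.
- exact: (measurableT_comp (measurable_entry i j) mA).
Qed.

Lemma measurable_gauss_density n (m : T -> 'cV[R]_n) (S : T -> 'M[R]_n) (y : T -> 'cV[R]_n) :
  measurable_fun setT m -> measurable_fun setT S -> measurable_fun setT y ->
  measurable_fun setT (fun x => gauss_density (m x) (S x) (y x)).
Proof.
move=> mm mS my; apply: measurable_funM.
  apply: (measurableT_comp (measurable_powR _)); apply: measurable_det.
  exact: measurable_scalemx.
apply: measurableT_comp => //; apply: measurable_funM => //.
have mym : measurable_fun setT (fun x => y x - m x).
  apply: measurable_fun_matrix => i j; under eq_fun do rewrite !mxE.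
  by apply: measurable_funB; apply: (measurableT_comp (measurable_entry i j)).
apply: (measurableT_comp (measurable_entry ord0 ord0)).
apply: measurable_mulmx => //; apply: measurable_mulmx; last exact: measurable_invmx.
apply: measurable_fun_matrix => i j; under eq_fun do rewrite mxE.
exact: (measurableT_comp (measurable_entry j i) mym).
Qed.

End matrix_functions_measurable.

(** The generators of [path_events], named so that [g_sigma_algebraType] makes the set of paths a
    measurable space. *)
Definition path_cylinders {R : realType} (D : set R) d (U : measurableType d) :
    set (set (R -> U)) :=
  [set A | exists s B, [/\ D s, measurable B & A = [set x : R -> U | B (x s)]]].
Arguments path_cylinders {R} D {d} U.

Section path_space.
Context {R : realType}.

Lemma measurable_path_eval (D : set R) d (U : measurableType d) (s : R) : D s ->
  measurable_fun setT (fun x : g_sigma_algebraType (path_cylinders D U) => x s).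
Proof.
by move=> Ds _ B mB; rewrite setTI; apply: sub_gen_smallest; exists s, B.
Qed.

Lemma measurable_path (D : set R) d (U : measurableType d) d' (T : measurableType d')
    (Z : T -> g_sigma_algebraType (path_cylinders D U)) :
  (forall s, D s -> measurable_fun setT (Z ^~ s)) -> measurable_fun setT Z.
Proof.
move=> mZ _ B mB; rewrite setTI.
pose C : set (set (R -> U)) := [set A | measurable (Z @^-1` A)].
suff : path_events D (U := U) `<=` C by move/(_ _ mB).
apply: smallest_sub.
  split => [|A CA|F CF].
  - by rewrite /C/= preimage_set0.
  - by rewrite /C/= setTD preimage_setC; apply: measurableC.
  - by rewrite /C/= preimage_bigcup; apply: bigcup_measurable => k _; exact: CF.
move=> _ [s [A [Ds mA ->]]]; rewrite /C/=.
by rewrite -[X in measurable X]setTI; exact: (mZ s Ds measurableT A mA).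
Qed.

(** The law and the independence of the samples are given for whole trajectories of the pair; this
    carries them over to the observed component up to time [t]. *)
Lemma path_events_fst (t : R) d1 (U1 : measurableType d1) d2 (U2 : measurableType d2)
    (A : set (R -> U1)) :
  path_events `[0, t] A ->
  path_events `[0, +oo[ [set x : R -> U1 * U2 | A (fun s => (x s).1)].
Proof.
move=> mA.
pose phi (x : g_sigma_algebraType (path_cylinders `[0, +oo[ (U1 * U2)%type)) :
  g_sigma_algebraType (path_cylinders `[0, t] U1) := fun s => (x s).1.
have mphi : measurable_fun setT phi.
  apply: measurable_path => s; rewrite /= in_itv /= => /andP[s0 _].
  apply: (measurableT_comp measurable_fst).
  by apply: (measurable_path_eval (U := (U1 * U2)%type)); rewrite /= in_itv /= s0.
by have := mphi measurableT A mA; rewrite setTI.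
Qed.

End path_space.

(** * From the system and its samples to the abstract setting *)

Lemma adapted_measurable (R : realType) d (T : measurableType d) (F : R -> set (set T))
    d' (U : measurableType d') (X : R -> T -> U) :
  filtration F -> adapted F X -> forall s, 0 <= s -> measurable_fun setT (X s).
Proof.
move=> hF aX s s0 _ B mB; rewrite setTI.
exact: (filtration_sub hF s0 (aX _ s0 _ mB)).
Qed.

(** Mutual independence with the sure event at every index other than [i] and [j], which contributes
    a factor 1. *)
Lemma samples_pairwise_indep (R : realType) (N1 N2 k1 k2 : nat)
    (co : cg_coefficients R N1 N2 k1 k2)
    d (T : measurableType d) (P : probability T R)
    (u1 : R -> T -> 'cV[R]_N1) (u2 : R -> T -> 'cV[R]_N2)
    d' (T' : measurableType d') (P' : probability T' R) (L : nat)
    (v1 : 'I_L -> R -> T' -> 'cV[R]_N1) (v2 : 'I_L -> R -> T' -> 'cV[R]_N2)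
    (t : R) (i j : 'I_L) (A B : set (R -> 'cV[R]_N1)) :
  cg_samples co P u1 u2 P' v1 v2 -> i != j ->
  path_events `[0, t] A -> path_events `[0, t] B ->
  P' ([set w | A (v1 i ^~ w)] `&` [set w | B (v1 j ^~ w)]) =
  (P' [set w | A (v1 i ^~ w)] * P' [set w | B (v1 j ^~ w)])%E.
Proof.
move=> hv ij mA mB.
pose E (k : 'I_L) : set (R -> 'cV[R]_N1 * 'cV[R]_N2) :=
  if k == i then [set x | A (fun s => (x s).1)]
  else if k == j then [set x | B (fun s => (x s).1)] else setT.
have mE k : path_events `[0, +oo[ (E k).
  rewrite /E; case: ifP => _; first exact: path_events_fst mA.
  case: ifP => _; first exact: path_events_fst mB.
  by rewrite -setC0; apply: sigma_algebraC; exact: sigma_algebra0.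
have Ei : E i = [set x | A (fun s => (x s).1)] by rewrite /E eqxx.
have Ej : E j = [set x | B (fun s => (x s).1)] by rewrite /E eq_sym (negbTE ij) eqxx.
have := cg_samples_indep hv mE.
rewrite (bigD1 i)//= (bigD1 j)/=; last by rewrite eq_sym.
rewrite big1 ?mule1 => [|k /andP[ki kj]]; last first.
  by rewrite /E (negbTE ki) (negbTE kj) probability_setT.
rewrite Ei Ej => <-; congr (P' _); apply/seteqP; split => w /=.
- move=> [Aw Bw] k; rewrite /E; case: eqP => [->//|_].
  by case: eqP => [->//|_].
- by move=> Ew; split; [have := Ew i; rewrite Ei|have := Ew j; rewrite Ej].
Qed.

Unset Implicit Arguments.

Theorem theorem3p1 (R : realType) (N1 N2 k1 k2 : nat)
  (co : cg_coefficients R N1 N2 k1 k2) (hco : cg_regular co)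
  (* the system, and its conditional mean and covariance *)
  (d : measure_display) (T : measurableType d) (P : probability T R)
  (F : R -> set (set T)) (W1 : R -> T -> 'cV[R]_k1) (W2 : R -> T -> 'cV[R]_k2)
  (u1 : R -> T -> 'cV[R]_N1) (u2 : R -> T -> 'cV[R]_N2)
  (hu : cg_solution co P F W1 W2 u1 u2)
  (mu : R -> (R -> 'cV[R]_N1) -> 'cV[R]_N2)
  (Sg : R -> (R -> 'cV[R]_N1) -> 'M[R]_N2)
  (hfilter : cg_filter co P F W1 u1 u2 mu Sg)
  (* the fixed time, at which the conditional law has a density *)
  (t : R) (ht : 0 <= t)
  (hSg : {ae P, forall w, posdef (Sg t (u1 ^~ w))})
  (p : 'cV[R]_N1 -> 'cV[R]_N2 -> R)
  (hp : joint_density P u1 u2 t p)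
  (hp3 : forall y, times_differentiable 3 (p ^~ y))
  (* the L independent trajectories *)
  (d' : measure_display) (T' : measurableType d') (P' : probability T' R)
  (L : nat) (hL : (0 < L)%N)
  (v1 : 'I_L -> R -> T' -> 'cV[R]_N1) (v2 : 'I_L -> R -> T' -> 'cV[R]_N2)
  (hv : cg_samples co P u1 u2 P' v1 v2)
  (H : R) (hH : 0 < H) (c : 'I_N1 -> R) (hc : forall i, 0 < c i)
  (M : 'cV[R]_N1 -> 'cV[R]_N2 -> R)
  (hMmeas : measurable_fun setT (fun z : 'cV[R]_N1 * 'cV[R]_N2 => M z.1 z.2))
  (hM : forall x y (v : 'cV[R]_N1), enorm v <= 1 ->
     `|derive1n 3 (fun s : R => p (x + s *: v) y) 0| <= M x y) :
  let leb := (lebesgue_cV N1 \x lebesgue_cV N2)%E in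
  let phat := hybrid H c mu Sg v1 t in
  let pbar x y := \int[P']_w phat w x y in
  let MISE :=
    (\int[P']_w \int[leb]_z ((p z.1 z.2 - phat w z.1 z.2) ^+ 2)%:E)%E in
  let Variance :=
    (\int[P']_w \int[leb]_z ((phat w z.1 z.2 - pbar z.1 z.2) ^+ 2)%:E)%E in
  let Bias := (\int[leb]_z ((p z.1 z.2 - pbar z.1 z.2) ^+ 2)%:E)%E in
  [/\ MISE = (Variance + Bias)%E,
      (Variance <= (L%:R^-1)%:E *
         \int[P]_w (((\prod_i (pi * H * c i ^+ 2)) *
                     \det (pi *: Sg t (u1 ^~ w))) `^ (- 2^-1))%:E)%E &
      forall delta : R, 0 < delta ->
        (Bias <=
           ((1 + delta) / 4 * H ^+ 2)%:E *
             J (fun x y => (\sum_i c i ^+ 2 *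
                 'D_(delta_mx i ord0) ('D_(delta_mx i ord0) (p ^~ y)) x)%R) +
           ((1 + delta^-1) / 2 * H ^+ 3 * (\sum_i c i ^+ 2) ^+ 3)%:E * J M)%E].
Proof.
move=> leb phat pbar MISE Variance Bias.
(* On this space [mu t] and [Sg t] are measurable functions of the path, and [path_events] up to
   time [t] are its measurable sets; [cg_filter] then supplies the conditional law in the abstract
   form. *)
pose Om := g_sigma_algebraType (path_cylinders `[0, t] 'cV[R]_N1).
pose X (o : Om) : 'cV[R]_N1 := o t.
pose g (o : Om) y := gauss_density (mu t o) (Sg t o) y.
pose U (w : T) : Om := u1 ^~ w.
pose Yi i (w : T') : Om := v1 i ^~ w.
pose gb (o : Om) : R := \det (pi *: Sg t o) `^ (- 2^-1).
have mu1 s : 0 <= s -> measurable_fun setT (u1 s).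
  exact: (adapted_measurable (cg_filtration hu) (ito_adapted (cg_u1 hu))).
have mV : measurable_fun setT (u2 t).
  exact: (adapted_measurable (cg_filtration hu) (ito_adapted (cg_u2 hu))).
have mX : measurable_fun setT X.
  by apply: measurable_path_eval; rewrite /= in_itv /= ht lexx.
have mU : measurable_fun setT U.
  by apply: measurable_path => s; rewrite /= in_itv /= => /andP[s0 _]; exact: mu1.
have mYi i : measurable_fun setT (Yi i).
  apply: measurable_path => s; rewrite /= in_itv /= => /andP[s0 _].
  have [F' [W1' [W2' hi]]] := cg_samples_solution hv i.
  exact: (adapted_measurable (cg_filtration hi) (ito_adapted (cg_u1 hi)) s0).
have mmu : measurable_fun setT (fun o : Om => mu t o).
  by move=> _ B mB; rewrite setTI; exact: (cg_mean_path hfilter ht mB).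
have mSg : measurable_fun setT (fun o : Om => Sg t o).
  by move=> _ B mB; rewrite setTI; exact: (cg_cov_path hfilter ht mB).
have mg : measurable_fun setT (fun u : Om * 'cV[R]_N2 => g u.1 u.2).
  apply: measurable_gauss_density => //.
  - exact: (measurableT_comp mmu measurable_fst).
  - exact: (measurableT_comp mSg measurable_fst).
have g0 o y : 0 <= g o y by exact: gauss_density_ge0.
have mgb : measurable_fun setT gb.
  apply: (measurableT_comp (measurable_powR _)); apply: measurable_det.
  exact: measurable_scalemx.
have gb0 o : 0 <= gb o by exact: powR_ge0.
have cond A B : measurable A -> measurable B -> P ((U @^-1` A) `&` (u2 t @^-1` B)) =
    (\int[P]_(w in U @^-1` A) \int[lebesgue_cV N2]_(y in B) (g (U w) y)%:E)%E.
  exact: (cg_cond_law hfilter ht hSg).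
have joint C : measurable C -> P ((fun w => (X (U w), u2 t w)) @^-1` C) =
    (\int[lebesgue_cV N1 \x lebesgue_cV N2]_(z in C) (p z.1 z.2)%:E)%E.
  exact: (density_law hp).
have law i A : measurable A -> P' (Yi i @^-1` A) = P (U @^-1` A).
  by move=> mA; exact: (cg_samples_law hv i (path_events_fst mA)).
have indep (i j : 'I_L) : i != j -> forall A B, measurable A -> measurable B ->
    P' ((Yi i @^-1` A) `&` (Yi j @^-1` B)) = (P' (Yi i @^-1` A) * P' (Yi j @^-1` B))%E.
  by move=> ij A B mA mB; exact: (samples_pairwise_indep hv ij mA mB).
have gle : {ae P, forall w, forall y, g (U w) y <= gb (U w)}.
  by apply: filterS hSg => w Spd y; exact: gauss_density_le.
have mp := density_measurable hp; have p0 := density_ge0 hp.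
have prod0 : 0 <= \prod_i (pi * H * c i ^+ 2).
  by apply: prodr_ge0 => i _; rewrite !mulr_ge0 ?sqr_ge0 ?pi_ge0// ltW.
split.
- exact: (hybrid_mise hH hc mX mU mV mg g0 mp p0 cond joint hL mYi law).
- have := hybrid_variance_le hH hc mX mU mV mg g0 mp p0 cond joint hL mYi law indep
    mgb gb0 gle.
  move=> /le_trans; apply; apply: lee_wpmul2l; first by rewrite lee_fin invr_ge0.
  have mgbU : measurable_fun setT (fun w => gb (U w)) by exact: (measurableT_comp mgb mU).
  have mSgU : measurable_fun setT (fun w => \det (pi *: Sg t (u1 ^~ w))).
    apply: measurable_det; apply: measurable_scalemx; exact: (measurableT_comp mSg mU).
  (* The power of the product splits where the determinant is nonnegative, which positive
     definiteness grants only almost everywhere. *)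
  apply: ae_ge0_le_integral => //.
  + by move=> w _; rewrite lee_fin mulr_ge0 ?powR_ge0.
  + by apply/measurable_EFinP; exact: measurable_funM.
  + by move=> w _; rewrite lee_fin powR_ge0.
  + apply/measurable_EFinP; apply: (measurableT_comp (measurable_powR _)).
    exact: measurable_funM.
  apply: filterS hSg => w Spd _; rewrite lee_fin powRM//.
  by rewrite detZ mulr_ge0 ?exprn_ge0 ?pi_ge0// ltW// posdef_det_gt0.
- move=> delta delta0.
  exact: (hybrid_bias_le hH hc mX mU mV mg g0 mp p0 cond joint hL mYi law hp3 hMmeas hM delta0).
Qed.
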